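(* Fix a twisting parameter $\omega\in P^+$ and put $l_i=\langle\omega,\alpha_i^\vee\rangle$. Let $Z$ be a $\vert^{\mathrm{CG}}_\omega$-invariant function defined on a region $Y\subseteq\mathbb C^r$ satisfying Hypothesis (A) (stated in the context), such that $DZ$ is holomorphic on $Y$, with Taylor series expansion $\sum_{\lambda\in Q^+}a_\lambda\mathbf x^\lambda$ at $\mathbf 0$. Then the coefficients $a_\lambda$ are determined by those with $\langle\lambda,\alpha_i^\vee\rangle\le l_i$ for all $i$ (that is, two such functions whose coefficients agree for all $\lambda\in Q^+$ with $\langle\lambda,\alpha_i^\vee\rangle\le l_i$ for all $i$ have the same Taylor series at $\mathbf 0$).
   Context: Root data. $A$ is a symmetrizable generalized Cartan matrix of size $r$ with realization $(\mathfrak h,\Pi,\Pi^\vee)$, simple roots $\alpha_1,\dots,\alpha_r\in\mathfrak h^*$, simple coroots $h_1,\dots,h_r\in\mathfrak h$, Kac-Moody root system $\Phi$ with positive roots $\Phi^+$, and Weyl group $W\subset GL(\mathfrak h^* )$ generated by the simple reflections $\sigma_i$. Write $A=EB$ with $E$ diagonal and $B=(b_{ij})$ symmetric, normalized so that $b_{ij}\in\mathbb Z$, $b_{ii}\in2\mathbb Z$, $b_{ii}>0$; $\langle\cdot,\cdot\rangle$ is a non-degenerate symmetric $W$-invariant bilinear form on $\mathfrak h^*$ with $\langle\alpha_i,\alpha_j\rangle=b_{ij}$, $q(\alpha)=\frac12\langle\alpha,\alpha\rangle$ is the quadratic form (not the number $q$ below), and $\alpha_i^\vee=\alpha_i/q(\alpha_i)$,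 so $\lambda(h_i)=\langle\lambda,\alpha_i^\vee\rangle$. $Q=\bigoplus\mathbb Z\alpha_i$, $Q^+=\bigoplus\mathbb Z_{\ge0}\alpha_i$, $P^+=\{\lambda\in\mathfrak h^*\mid\langle\lambda,\alpha_i^\vee\rangle\in\mathbb Z_{\ge0}\ \forall i\}$. $\Phi^+_{\rm re}$ is the set of positive real roots. Parameters. Fix an integer $n\ge2$; $m_\alpha=n/\gcd(n,q(\alpha))$ for real roots $\alpha$, $m_i=m_{\alpha_i}$. Fix a real $q>1$ and complex numbers $g_t$ ($t\in\mathbb Z$) depending only on $t$ mod $n$, with $g_0=-1$ and $g_tg_{-t}=q$ if $t\not\equiv0\bmod n$. For $\lambda=\sum k_i\alpha_i\in Q$, $\mathbf x^\lambda=\prod x_i^{k_i}$. Action. For $\mathbf x$ with $x_i\ne0$ let $\sigma_i\mathbf x$ have $k$-th coordinate $x_kx_i^{-\langle\alpha_k,\alpha_i^\vee\rangle}$; for an $m_i$-th root of unity $\eta$ let $\varepsilon_{i,\eta}\mathbf x$ have $k$-th coordinate $\eta^{\langle\alpha_k,\alpha_i^\vee\rangle}x_k$; let $f_i^{(j)}(\mathbf x)=\frac1{m_i}\sum_{\eta\in\mu_{m_i}}\eta^{j-l_i-1}f(\varepsilon_{i,\eta}\mathbf x)$ and $$f(\mathbf x)\vert^{\mathrm{CG}}_\omega\sigma_i=\frac{x_i^{l_i+1}}{1-qx_i^{m_i}}\sum_{0\le j\le m_i-1}f_i^{(j)}(\sigma_i\mathbf x)\big[x_i^{-j}(1-q)-(x_i^{-m_i}-1)g_{q(\alpha_i)j}\big].$$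 $\vert^{\mathrm{CG}}_\omega$-invariant means $f\vert^{\mathrm{CG}}_\omega\sigma_i=f$ for all $i$. $D(\mathbf x;q)=\prod_{\alpha\in\Phi^+_{\rm re}}(1-q\mathbf x^{m_\alpha\alpha})$. Hypothesis (A). A $W$-invariant region $Y\subseteq\mathbb C^r$ satisfies Hypothesis (A) if for each $1\le j\le r$ there is a subset $Y_j\subseteq Y$ such that: $Y_j$ is an open connected Reinhardt domain containing $\mathbf 0$ (Reinhardt: stable under $(x_k)\mapsto(e^{i\theta_k}x_k)$ for all real $\theta_k$); the product $\prod_{\alpha\in\Phi^+_{\rm re}\setminus\{\alpha_j\}}(1-q\mathbf x^{m_\alpha\alpha})$ does not vanish on $Y_j$; and $Y_j$ is $\sigma_j$-invariant. Invariance of a set under $\sigma_i$ means $\sigma_i\mathbf x$ lies in the set for each point $\mathbf x$ of it with $x_i\neq0$. $Z$ is a meromorphic function on $Y$; the products are understood to converge where they are used. Such a $Z$ is holomorphic near $\mathbf 0$. *)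

(* Defs.v *)
From HB Require Import structures.
From mathcomp Require Import all_boot all_order all_algebra.
From mathcomp Require Import all_classical all_reals all_analysis.
From mathcomp Require Import complex.

Set Implicit Arguments.
Unset Strict Implicit.
Unset Printing Implicit Defensive.

Import Order.TTheory GRing.Theory Num.Theory.
Import numFieldNormedType.Exports.
Local Open Scope classical_set_scope.
Local Open Scope ring_scope.

(* The regular module [R[i]^o] carries the norm and the topology of the       *)
(* complex numbers; [R[i]] itself only has the algebraic structure.           *)
Notation Cplx R := (complex R)^o.

Section RootDatum.
Variables (R : realType) (r : nat).

Definition is_GCM (A : 'M[int]_r) : Prop :=
  [/\ forall i, A i i = 2,
      forall i j, i != j -> A i j <= 0 &
      forall i j, A i j = 0 -> A j i = 0].

(* A = E B with E = diag e. *)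
Definition symmetrized_by (A : 'M[int]_r) (e : 'rV[rat]_r) (B : 'M[int]_r) :
    Prop :=
  [/\ map_mx intr A = diag_mx e *m map_mx intr B :> 'M[rat]_r,
      forall i j, B i j = B j i,
      forall i, (2 %| B i i)%Z &
      forall i, 0 < B i i].

Record realization (A : 'M[int]_r) := Realization {
  cartan : vectType R[i];
  coroot : 'I_r -> cartan;
  sroot : 'I_r -> 'Hom(cartan, Cplx R);
  coroot_free : free [seq coroot i | i : 'I_r];
  sroot_free : free [seq sroot i | i : 'I_r];
  sroot_coroot : forall i j, sroot j (coroot i) = (A i j)%:~R;
  dim_cartan : (\dim {:cartan} + \rank (map_mx intr A : 'M[rat]_r) = 2 * r)%N
}.

Definition kdual A (H : realization A) := 'Hom(cartan H, Cplx R).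

Definition simple_refl A (H : realization A) (i : 'I_r) (lam : kdual H) :
    kdual H :=
  lam - (lam (coroot H i) : R[i]) *: sroot H i.

(* Simple reflections are involutions, so the group they generate consists    *)
(* of the words in them.                                                      *)
Inductive weyl A (H : realization A) : (kdual H -> kdual H) -> Prop :=
| weyl_id : weyl id
| weyl_refl i w : weyl w -> weyl (simple_refl i \o w).

Record root_datum := RootDatum {
  cmat : 'M[int]_r;
  symE : 'rV[rat]_r;
  symB : 'M[int]_r;
  krealization : realization cmat;
  kform : kdual krealization -> kdual krealization -> Cplx R;
  cmat_GCM : is_GCM cmat;
  cmat_sym : symmetrized_by cmat symE symB;
  form_sym : forall u v, kform u v = kform v u;
  form_linear : forall u, linear (kform u);
  form_nondeg : forall u, (forall v, kform u v = 0) -> u = 0;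
  form_weyl : forall w, weyl w -> forall u v, kform (w u) (w v) = kform u v;
  form_root : forall i j,
    kform (sroot krealization i) (sroot krealization j) = (symB i j)%:~R
}.

Variable S : root_datum.

Definition hdual := kdual (krealization S).
Definition simple_root (i : 'I_r) : hdual := sroot (krealization S) i.

Definition qform (lam : hdual) : Cplx R := kform lam lam / 2.

Definition alpha_check (i : 'I_r) : hdual :=
  ((qform (simple_root i))^-1 : R[i]) *: simple_root i.

Definition dominant (lam : hdual) : Prop :=
  forall i, exists k : nat, kform lam (alpha_check i) = k%:R.

(* Elements of Q^+, given by their coordinates in the basis of simple roots. *)
Definition Qplus := {ffun 'I_r -> nat}.

Definition of_Qplus (k : Qplus) : hdual := \sum_i simple_root i *+ k i.

Definition qsimple (i : 'I_r) : Qplus := [ffun j => (j == i) : nat].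

Definition real_root (lam : hdual) : Prop :=
  exists w i, @weyl _ (krealization S) w /\ lam = w (simple_root i).

Definition Phi_re_pos : set Qplus := [set k | real_root (of_Qplus k)].

(* Integer-valued form of [qform] on Q^+, see [qformE] below. *)
Definition qint (k : Qplus) : int :=
  ((\sum_i \sum_j (k i)%:Z * (k j)%:Z * symB S i j) %/ 2)%Z.

End RootDatum.

Arguments kform {R r} _.

Section Analysis.
Variables (R : realType) (r : nat).
Local Notation V := 'rV[Cplx R]_r.

Definition boxQ N (k : {ffun 'I_r -> 'I_N}) : Qplus r := [ffun i => k i : nat].

Definition xmonom (x : V) (k : Qplus r) : Cplx R := \prod_i x 0 i ^+ k i.

Definition abs_summable (P : set (Qplus r)) (u : Qplus r -> Cplx R) : Prop :=
  (\esum_(k in P) (Normc.normc (u k))%:E < +oo)%E.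

Definition box_sum (u : Qplus r -> Cplx R) : nat -> Cplx R :=
  fun N => \sum_(k : {ffun 'I_r -> 'I_N}) u (boxQ k).

Definition box_prod (P : set (Qplus r)) (u : Qplus r -> Cplx R) :
    nat -> Cplx R :=
  fun N => \prod_(k : {ffun 'I_r -> 'I_N} | `[< P (boxQ k) >]) u (boxQ k).

Definition holomorphic_on (U : set V) (f : V -> Cplx R) : Prop :=
  forall x, U x -> differentiable f x.

Definition generically (U : set V) (P : V -> Prop) : Prop :=
  exists W : set V,
    [/\ open W, W `<=` U, U `<=` closure W & forall x, W x -> P x].

(* A meromorphic function is represented by a total function whose values on *)
(* a nowhere dense set are irrelevant; accordingly, identities between        *)
(* meromorphic functions are required generically.                            *)
Definition meromorphic_on (Y : set V) (Z : V -> Cplx R) : Prop :=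
  forall p, Y p -> exists U f h,
    [/\ open U, U p, holomorphic_on U f, holomorphic_on U h &
        generically U (fun x => h x != 0 /\ Z x = f x / h x)].

(* The sum of the power series is automatically holomorphic on U. *)
Definition taylor_at0 (Z : V -> Cplx R) (a : Qplus r -> Cplx R) : Prop :=
  exists U : set V,
    [/\ open U, U 0,
        forall x, U x -> abs_summable setT (fun k => a k * xmonom x k) &
        generically U (fun x =>
          box_sum (fun k => a k * xmonom x k) N @[N --> \oo] --> Z x)].

Definition reinhardt (Y : set V) : Prop :=
  forall (theta : 'I_r -> R) x, Y x ->
    Y (\row_k (Complex (cos (theta k)) (sin (theta k)) * x 0 k)).

End Analysis.

Section CG.
Variables (R : realType) (r : nat) (S : root_datum R r).
Variables (n : nat) (q : R) (g : int -> Cplx R) (l : 'I_r -> nat).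
Local Notation V := 'rV[Cplx R]_r.
Local Notation A := (cmat S).

Definition gauss_params : Prop :=
  [/\ forall s t, (s = t %[mod n])%Z -> g s = g t,
      g 0 = -1 &
      forall t, ~~ (n %| t)%Z -> g t * g (- t) = q%:C%C].

Definition mroot (k : Qplus r) : nat := (n %/ gcdn n `|qint S k|)%N.
Definition msimple (i : 'I_r) : nat := mroot (qsimple i).

(* <alpha_k, alpha_i^vee> = A i k, see [form_alpha_check] below. *)
Definition sigma_act (i : 'I_r) (x : V) : V :=
  \row_k (x 0 k * x 0 i ^ (- A i k)).

Definition eps_act (i : 'I_r) (eta : Cplx R) (x : V) : V :=
  \row_k (eta ^ (A i k) * x 0 k).

Definition unity_roots (m : nat) : set (Cplx R) := [set eta | eta ^+ m = 1].

Definition fpart (i : 'I_r) (j : nat) (f : V -> Cplx R) (x : V) : Cplx R :=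
  (msimple i)%:R^-1 *
  \sum_(eta \in unity_roots (msimple i))
    eta ^ (j%:Z - (l i)%:Z - 1) * f (eps_act i eta x).

Definition CG_act (i : 'I_r) (f : V -> Cplx R) (x : V) : Cplx R :=
  let m := msimple i in
  let xi := x 0 i in
  xi ^+ (l i).+1 / (1 - q%:C%C * xi ^+ m) *
  \sum_(0 <= j < m) fpart i j f (sigma_act i x) *
    (xi ^- j * (1 - q%:C%C) - (xi ^- m - 1) * g (qint S (qsimple i) * j%:Z)).

(* The points of Y at which both sides of Z|sigma_i = Z only involve values   *)
(* of Z on Y; Y is not assumed to be stable under the maps [eps_act i eta].   *)
Definition CG_domain (Y : set V) (i : 'I_r) : set V :=
  [set x | [/\ Y x, x 0 i != 0 &
    forall eta, unity_roots (msimple i) eta ->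
      Y (eps_act i eta (sigma_act i x))]].

Definition CG_invariant (Y : set V) (Z : V -> Cplx R) : Prop :=
  forall i, generically (CG_domain Y i) (fun x => CG_act i Z x = Z x).

(* The family of roots is unordered, so convergence of a product of factors   *)
(* 1 - u_k means absolute convergence; the value is then the limit along any  *)
(* exhaustion, here by boxes of exponents.                                    *)
Definition rterm (x : V) (k : Qplus r) : Cplx R :=
  q%:C%C * xmonom x k ^+ mroot k.

Definition rprod_cvg (P : set (Qplus r)) (x : V) : Prop :=
  abs_summable P (rterm x).

Definition rprod (P : set (Qplus r)) (x : V) : Cplx R :=
  limn (box_prod P (fun k => 1 - rterm x k)).

Definition Dprod : V -> Cplx R := rprod (Phi_re_pos S).

Definition sigma_stable (i : 'I_r) (Y : set V) : Prop :=
  forall x, Y x -> x 0 i != 0 -> Y (sigma_act i x).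

Definition hypothesis_A (Y : set V) : Prop :=
  [/\ open Y, connected Y, forall i, sigma_stable i Y &
      forall j, exists Yj : set V, let P := Phi_re_pos S `\ qsimple j in
        [/\ Yj `<=` Y,
            [/\ open Yj, connected Yj, reinhardt Yj & Yj 0],
            forall x, Yj x -> rprod_cvg P x /\ rprod P x != 0 &
            sigma_stable j Yj]].

Definition DZ_holomorphic (Y : set V) (Z : V -> Cplx R) : Prop :=
  (forall x, Y x -> rprod_cvg (Phi_re_pos S) x) /\
  exists F, holomorphic_on Y F /\ generically Y (fun x => Dprod x * Z x = F x).

Record CG_function (Y : set V) (Z : V -> Cplx R) (a : Qplus r -> Cplx R) :
    Prop := CGFunction {
  CGf_region : hypothesis_A Y;
  CGf_mero : meromorphic_on Y Z;
  CGf_inv : CG_invariant Y Z;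
  CGf_DZ : DZ_holomorphic Y Z;
  CGf_taylor : taylor_at0 Z a
}.

End CG.

Section Compatibility.
Variables (R : realType) (r : nat) (S : root_datum R r).

Let formZr u a v : kform S u ((a : R[i]) *: v) = a * kform S u v.
Proof.
have L := @form_linear _ _ S u.
have h0 : kform S u 0 = 0.
  by have := L (-1) 0 0; rewrite scaler0 addr0 scaleN1r addNr.
by have := L a v 0; rewrite !addr0 h0 addr0.
Qed.

Let formDr u v w : kform S u (v + w) = kform S u v + kform S u w.
Proof. by have := @form_linear _ _ S u 1 v w; rewrite !scale1r. Qed.

Let form0r u : kform S u 0 = 0.
Proof. by have := formZr u 0 0; rewrite scale0r mul0r. Qed.

Let form_sumr u (F : 'I_r -> hdual S) :
  kform S u (\sum_i F i) = \sum_i kform S u (F i).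
Proof. exact: (big_morph _ (formDr u) (form0r u)). Qed.

Let formMnr u v k : kform S u (v *+ k) = k%:R * kform S u v.
Proof. by rewrite -scaler_nat formZr. Qed.

Lemma form_alpha_check i k :
  kform S (simple_root S k) (alpha_check S i) = (cmat S i k)%:~R.
Proof.
rewrite /alpha_check formZr /qform !form_root.
have [EA Bs _ Bp] := cmat_sym S.
have [A2 _ _] := cmat_GCM S.
have Eij j : (cmat S i j)%:~R = symE S 0 i * (symB S i j)%:~R :> rat.
  by have := congr1 (fun M : 'M[rat]_r => M i j) EA; rewrite mul_diag_mx !mxE.
have E : symB S i i * cmat S i k = 2 * symB S i k :> int.
  apply/eqP; rewrite -(eqr_int rat) !intrM Eij mulrCA mulrA -Eij A2.
  by apply/eqP; congr (_ * _).
have B0 : (symB S i i)%:~R != 0 :> Cplx R by rewrite intr_eq0 gt_eqF.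
have := congr1 (fun z : int => z%:~R : Cplx R) E; rewrite /= !intrM => E'.
rewrite (Bs k i); apply: (mulfI B0); rewrite [RHS]E' invf_div.
by rewrite mulrA [_ * (2 / _)]mulrC divfK.
Qed.

Lemma qformE (k : Qplus r) : qform (of_Qplus S k) = (qint S k)%:~R.
Proof.
have [_ Bs Bd _] := cmat_sym S.
set s := \sum_i \sum_j (k i)%:Z * (k j)%:Z * symB S i j.
have ev : (2 %| s)%Z.
  pose F i j := (k i)%:Z * (k j)%:Z * symB S i j.
  have split i : \sum_j F i j =
      \sum_(j < r | (j < i)%N) F i j + (F i i + \sum_(j < r | (i < j)%N) F i j).
    rewrite (bigID (fun j : 'I_r => (j < i)%N)) /=; congr (_ + _).
    rewrite (bigD1 i) ?ltnn //=; congr (_ + _).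
    by apply: eq_bigl => j; rewrite -leqNgt ltn_neqAle andbC eq_sym.
  have -> : s =
      \sum_i F i i + (\sum_(i < r) \sum_(j < r | (j < i)%N) F i j) *+ 2.
    rewrite /s (eq_bigr _ (fun i _ => split i)) !big_split /= addrCA mulr2n.
    congr (_ + (_ + _)); rewrite (exchange_big_dep xpredT) //=.
    apply: eq_bigr => i _; apply: eq_bigr => j _.
    by rewrite /F Bs [X in X * _]mulrC.
  apply: rpredD; last by rewrite -mulr_natr; exact: dvdz_mull.
  by apply: rpred_sum => i _; exact: dvdz_mull.
rewrite /qform /qint -/s; apply: (mulIf (x := 2%:R)); first by rewrite pnatr_eq0.
rewrite divfK ?pnatr_eq0 // -[RHS](intrM _ _ 2) divzK //.
rewrite /of_Qplus form_sumr /s [RHS]rmorph_sum; apply: eq_bigr => j _ /=.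
rewrite formMnr form_sym form_sumr mulr_sumr [RHS]rmorph_sum.
apply: eq_bigr => i _ /=.
by rewrite formMnr form_root !intrM mulrA Bs.
Qed.

(* So the sum over roots of unity in [fpart] is a genuine finite sum. *)
Lemma finite_mu (m : nat) : (0 < m)%N -> finite_set (@unity_roots R m).
Proof.
move=> m0; have [s Es] := closed_field_poly_normal ('X^m - 1%:P : {poly R[i]}).
apply: (sub_finite_set _ (finite_seq s)) => x /= xm.
have : root ('X^m - 1%:P : {poly R[i]}) x by rewrite rootE !hornerE xm subrr.
by rewrite Es lead_coefXnsubC // scale1r root_prod_XsubC.
Qed.

End Compatibility.

(* Main.v *)
Require Import Defs.
From mathcomp Require Import all_boot all_order all_algebra.
From mathcomp Require Import all_classical all_reals all_analysis.
From mathcomp Require Import complex ring lra zify.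
Set Implicit Arguments.
Unset Strict Implicit.
Unset Printing Implicit Defensive.
Import Order.TTheory GRing.Theory Num.Theory.
Import numFieldNormedType.Exports.
Local Open Scope classical_set_scope.
Local Open Scope ring_scope.

(* Fix j, put m = m_j, and let P_j be the product over the real roots other   *)
(* than alpha_j. Then F_j = (1 - q x_j^m) Z = DZ / P_j is, on Y_j, a limit,   *)
(* uniform on tori, of holomorphic functions. For such a function the mean of *)
(* F_j(x) x^(-lam) over the torus through x does not depend on x: locally     *)
(* this is Goursat's theorem on an annulus, and the set of points around      *)
(* which the mean has a given value is open and closed in Y_j. Near 0 the     *)
(* mean is b_lam = a_lam - q a_(lam - m alpha_j), extended by 0 outside of    *)
(* Q^+. Taking means in the functional equation therefore gives linear        *)
(* relations between the b_lam, and the bound |b_lam x^lam| <= sup |F_j| at   *)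
(* points sigma_j x with x_j small gives q^c b_(lam + c m alpha_j) -> 0.      *)
(*                                                                            *)
(* Now take differences for the two functions and argue by induction on the   *)
(* height of lam. If <lam, alpha_j^vee> > l_j, all the terms on the right of  *)
(* the relations at lam + c m alpha_j vanish by induction, except at c = 0    *)
(* when <lam, alpha_j^vee> = l_j + 1. So b_(lam + c m alpha_j) is             *)
(* q b_(lam + (c + 1) m alpha_j), and it vanishes by the decay; in the        *)
(* exceptional case the relation reads (1 + q) b_lam = 0, because g_0 = -1.   *)

(** * The complex exponential *)

(** Torus means play the role of Cauchy integrals: [tmean N] averages over points whose coordinates
    are 2^(N + 1)-th roots of unity, and [mean_lim] is the limit of these averages. That the limit
    does not depend on the torus rests on [goursat], a discrete Cauchy theorem for an annulus in
    logarithmic coordinates. [circle_inv_diff] applies it in one coordinate, [tmean_step] passes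
    from circles to tori, and [mean_lim_propagate] spreads the value over a connected Reinhardt
    domain. [quotient_mean_invariant] supplies the required invariance for F / P_j,
    [power_series_mean] computes the value near 0, and [mean_Fj] combines them.

    The functional equation, multiplied by (1 - q x_j^m)(1 - q x_j^(-m)), becomes an identity
    between continuous functions built from F_j alone ([functional_eq]). Its means give
    [coef_relation]. Where the right-hand side vanishes, the relation b_k = q b_(k + m alpha_j)
    still has nonzero solutions, proportional to q^(-c) along the string; their series has a pole at
    x_j^m = q. They are excluded by [coef_decay], because Y_j is sigma_j-stable and so contains tori
    with large |x_j| on which F_j is bounded. What remains is algebra along one alpha_j-string, done
    in [slice_top]. *)

Section DerivableBounds.

(** Epsilon form of derivability, valid at h = 0 as well. It carries the real derivatives of exp,
    sin and cos over to [cexp], and provides the linear approximation in [all_good];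
    [bound_is_derive] is the converse. *)
Lemma is_derive_bound (K : numFieldType) (f : K -> K^o) (x d : K) :
  is_derive x 1 f d -> forall e, 0 < e ->
  exists2 t, 0 < t & forall h, `|h| < t ->
    `|f (x + h) - f x - d * h| <= e * `|h|.
Proof.
case=> fx fd e e0.
have /cvgrPdist_le/(_ _ e0) := fx.
rewrite -[lim _]/('D_1 f x) fd near_withinE => -[t /= t0 H];
  exists t => // h ht.
have [->|h0] := eqVneq h 0.
  by rewrite addr0 subrr mulr0 subrr normr0 mulr0.
have := H h; rewrite /= sub0r normrN => /(_ ht h0).
rewrite distrC => B.
have -> : f (x + h) - f x - d * h =
          (h^-1 *: (f (h *: 1 + x) - f x) - d) * h.
  rewrite [h *: 1]mulr1 [h + x]addrC mulrBl /GRing.scale /= mulrAC mulVf //.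
  by rewrite mul1r.
by rewrite normrM ler_wpM2r.
Qed.

Lemma bound_is_derive (K : numFieldType) (f : K -> K^o) (x d : K) :
  (forall e, 0 < e -> exists2 t, 0 < t & forall h, `|h| < t ->
    `|f (x + h) - f x - d * h| <= e * `|h|) -> is_derive x 1 f d.
Proof.
move=> H.
have L : h^-1 *: ((f \o shift x) (h *: 1) - f x) @[h --> 0^'] --> (d : K^o).
  apply/cvgrPdist_le => e e0; have [t t0 Ht] := H _ e0.
  rewrite near_withinE; exists t => //= h /=.
  rewrite sub0r normrN => ht h0; have := Ht _ ht.
  rewrite -ler_pdivrMr ?normr_gt0 // -normf_div; apply: le_trans.
  rewrite distrC le_eqVlt; apply/orP; left; apply/eqP; congr `| _ |.
  rewrite [h *: 1]mulr1 [h + x]addrC /GRing.scale /= [h^-1 * _]mulrC.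
  by rewrite [RHS]mulrBl mulfK.
by apply: DeriveDef; [apply/cvg_ex; exists d|exact: (cvg_lim _ L)].
Qed.

End DerivableBounds.

Section ComplexExponential.
Variable R : realType.
Local Notation C := (Cplx R).
Implicit Types z w h : C.
Local Open Scope complex_scope.

Definition cexp z : C := Complex (expR (complex.Re z) * cos (complex.Im z))
  (expR (complex.Re z) * sin (complex.Im z)).

Lemma normC z : `|z| = (Normc.normc z)%:C :> C.
Proof. by []. Qed.

Lemma normc_ge0 z : 0 <= Normc.normc z.
Proof. by rewrite -(lecR 0) -normC normr_ge0. Qed.

Lemma ler_Re_norm (a b : R) : (`|a|%:C : C) <= `|Complex a b : C|.
Proof. exact: (normc_ge_Re (Complex a b)). Qed.

Lemma norm_real (a : R) : `|a%:C : C| = `|a|%:C.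
Proof. by rewrite normC /= expr0n addr0 sqrtr_sqr. Qed.

Lemma norm_imag (a : R) : `|Complex 0 a : C| = `|a|%:C.
Proof. by rewrite normC /= expr0n add0r sqrtr_sqr. Qed.

Lemma ler_Im_norm (a b : R) : (`|b|%:C : C) <= `|Complex a b : C|.
Proof.
by rewrite normC lecR -sqrtr_sqr ler_wsqrtr // lerDr sqr_ge0.
Qed.

Lemma ler_norm_ReIm (a b : R) : `|Complex a b : C| <= (`|a| + `|b|)%:C.
Proof.
have -> : Complex a b = a%:C + Complex 0 b :> C by simpc.
by rewrite rmorphD (le_trans (ler_normD _ _)) // norm_real norm_imag.
Qed.

Lemma cexp0 : cexp 0 = 1.
Proof. by rewrite /cexp /= expR0 cos0 sin0 mulr0 mulr1. Qed.

Lemma cexpD z w : cexp (z + w) = cexp z * cexp w.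
Proof.
case: z w => [a b] [c d]; rewrite /cexp /= expRD cosD sinD; simpc.
by congr Complex; ring.
Qed.

Lemma normc_cexp z : Normc.normc (cexp z) = expR (complex.Re z).
Proof.
rewrite /cexp /= !exprMn -mulrDr cos2Dsin2 mulr1 sqrtr_sqr.
by rewrite ger0_norm // expR_ge0.
Qed.

Lemma norm_cexp z : `|cexp z| = (expR (complex.Re z))%:C.
Proof. by rewrite normC normc_cexp. Qed.

Lemma cexp_neq0 z : cexp z != 0.
Proof. by rewrite -normr_gt0 norm_cexp ltcR expR_gt0. Qed.

Lemma cexpMn z n : cexp (z *+ n) = cexp z ^+ n.
Proof.
elim: n => [|n IH]; first by rewrite mulr0n cexp0.
by rewrite mulrS cexpD IH exprS.
Qed.

Definition twopii : C := Complex 0 (pi *+ 2).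

Lemma cexp_twopii : cexp twopii = 1.
Proof. by rewrite /cexp /= expR0 cos2pi sin2pi !mul1r. Qed.

Lemma unit_circle_angle (a b : R) : a ^+ 2 + b ^+ 2 = 1 ->
  exists2 t, - pi <= t <= pi & a = cos t /\ b = sin t.
Proof.
move=> E; have a1 : -1 <= a <= 1.
  rewrite -ler_norml -(@ler_pXn2r _ 2) ?nnegrE // expr1n real_normK ?num_real
    //.
  by rewrite -E lerDl sqr_ge0.
have Eb : b ^+ 2 = 1 - a ^+ 2 by rewrite -E addrC addKr.
have [b0|b0] := leP 0 b.
- exists (acos a).
    by rewrite acos_lepi // (le_trans _ (acos_ge0 a1)) // oppr_le0 pi_ge0.
  rewrite acosK //; split => //.
  by rewrite sin_acos // -Eb sqrtr_sqr ger0_norm.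
- exists (- acos a).
    by rewrite lerN2 acos_lepi // (le_trans _ (pi_ge0 R)) // oppr_le0 acos_ge0.
  rewrite cosN sinN acosK //; split => //.
  by rewrite sin_acos // -Eb sqrtr_sqr ltr0_norm // opprK.
Qed.

Lemma cexp_surj z : z != 0 -> exists w, cexp w = z.
Proof.
case: z => a b z0; set n := Normc.normc (Complex a b).
have n0 : 0 < n.
  by rewrite -(ltcR 0) -(normC (Complex a b)) normr_gt0.
have n2 : n ^+ 2 = a ^+ 2 + b ^+ 2.
  by rewrite sqr_sqrtr // addr_ge0 // sqr_ge0.
have [|t _ [Ea Eb]] := @unit_circle_angle (a / n) (b / n).
  by rewrite !expr_div_n -mulrDl -n2 divff // expf_neq0 // gt_eqF.
exists (Complex (ln n) t); rewrite /cexp /= lnK ?posrE // -Ea -Eb.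
by rewrite ![n * _]mulrC !divfK // gt_eqF.
Qed.

Lemma real_of_pos (e : C) : 0 < e -> exists2 t : R, 0 < t & e = t%:C.
Proof.
case: e => a b; rewrite ltcE /= => /andP[/eqP -> a0]; by exists a.
Qed.

(** Factoring out cexp z leaves the point 0, where the real and imaginary parts of exp h - 1 - h are
    estimated through the real derivatives. *)
Lemma is_derive_cexp z : is_derive z 1 cexp (cexp z).
Proof.
apply: bound_is_derive => _ /real_of_pos[e0 e00 ->].
(* [Re_le] and [Im_le] add up to at most 7 e |h|, as 1 + 2 + 2 + 2 = 7; the factor expR (Re z) is
   the norm of cexp z. *)
pose e := e0 / (expR (complex.Re z)) / 7%:R.
have ee : 0 < e by rewrite !divr_gt0 // expR_gt0.
have [t1 t10 H1] := is_derive_bound (is_derive_expR (0 : R)) ee.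
have [t2 t20 H2] := is_derive_bound (is_derive_sin (0 : R)) ee.
have [t3 t30 H3] := is_derive_bound (is_derive_cos (0 : R)) ee.
have [t4 t40 H4] := is_derive_bound (is_derive_expR (0 : R)) ltr01.
(* |a| < 1/2 gives expR a <= 2, and |a| < e turns |expR a - 1| |b| into a term 2 e |b|. *)
pose m := Num.min (Num.min t1 t2) (Num.min (Num.min t3 t4) (Num.min e 2^-1)).
exists m%:C; first by rewrite ltcR !lt_min t10 t20 t30 t40 ee /= invr_gt0.
case=> a b hm.
have am : `|a| < m by rewrite -ltcR (le_lt_trans (ler_Re_norm a b)).
have bm : `|b| < m by rewrite -ltcR (le_lt_trans (ler_Im_norm a b)).
move: am bm; rewrite !lt_min.
case/and3P => /andP[a1 a2] /andP[a3 a4] /andP[a5 a6].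
case/and3P => /andP[b1 b2] /andP[b3 b4] /andP[b5 b6].
have -> : cexp (z + Complex a b) - cexp z - cexp z * Complex a b =
   cexp z * (cexp (Complex a b) - 1 - Complex a b).
  by rewrite cexpD; ring.
rewrite normrM norm_cexp.
have {}H1 : `|expR a - 1 - a| <= e * `|a|.
  by have := H1 _ a1; rewrite add0r expR0 mul1r.
have {}H4 : `|expR a - 1| <= 2 * `|a|.
  have := H4 _ a4; rewrite add0r expR0 mul1r => h4.
  have -> : expR a - 1 = (expR a - 1 - a) + a by ring.
  by apply: (le_trans (ler_normD _ _)); lra.
have {}H2 : `|sin b - b| <= e * `|b|.
  by have := H2 _ b2; rewrite add0r sin0 cos0 mul1r subr0.
have {}H3 : `|cos b - 1| <= e * `|b|.
  by have := H3 _ b3; rewrite add0r cos0 sin0 oppr0 mul0r subr0.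
have ea : `|expR a| <= 2.
  have -> : expR a = (expR a - 1) + 1 by ring.
  by apply: (le_trans (ler_normD _ _)); rewrite normr1; lra.
have Re_le : `|expR a * cos b - 1 - a| <= e * `|a| + 2 * (e * `|b|).
  have -> : expR a * cos b - 1 - a = (expR a - 1 - a) + expR a * (cos b - 1).
    by ring.
  by rewrite (le_trans (ler_normD _ _)) // lerD // normrM ler_pM.
have Im_le : `|expR a * sin b - b| <= 2 * (e * `|b|) + 2 * (e * `|b|).
  have -> : expR a * sin b - b = expR a * (sin b - b) + (expR a - 1) * b.
    by ring.
  apply: (le_trans (ler_normD _ _)); apply: lerD; rewrite normrM;
    first by rewrite ler_pM.
  by rewrite mulrA ler_wpM2r // (le_trans H4) // ler_wpM2l // ltW.
have -> : cexp (Complex a b) - 1 - Complex a b =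
   Complex (expR a * cos b - 1 - a) (expR a * sin b - b).
  by rewrite /cexp /=; simpc.
apply: (le_trans (ler_wpM2l _ (ler_norm_ReIm _ _))).
  by rewrite ler0c expR_ge0.
have ha : `|a| <= Normc.normc (Complex a b) by rewrite -lecR ler_Re_norm.
have hb : `|b| <= Normc.normc (Complex a b) by rewrite -lecR ler_Im_norm.
rewrite normC -!rmorphM lecR.
have -> : e0 = expR (complex.Re z) * (7%:R * e).
  by rewrite /e; field; rewrite gt_eqF // expR_gt0.
rewrite -mulrA ler_wpM2l ?expR_ge0 //.
apply: (le_trans (lerD Re_le Im_le)).
set N := Normc.normc _ in ha hb *.
have : e * `|a| <= e * N by rewrite ler_wpM2l // ltW.
have : e * `|b| <= e * N by rewrite ler_wpM2l // ltW.
have : 0 <= e * N by rewrite mulr_ge0 ?normc_ge0 // ltW.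
lra.
Qed.

End ComplexExponential.

(** * A discrete Goursat theorem *)

Section Goursat.
Variable R : realType.
Local Notation C := (Cplx R).
Local Open Scope complex_scope.

Lemma nested_dyadic (u : nat -> R) :
  (forall k, u k <= u k.+1) ->
  (forall k, u k.+1 + (2 ^+ k.+1)^-1 <= u k + (2 ^+ k)^-1) ->
  exists s, forall k, u k <= s <= u k + (2 ^+ k)^-1.
Proof.
move=> u_nd v_ni.
have leu k l : (k <= l)%N -> u k <= u l.
  by move=> /subnK <-; elim: (l - k)%N => // m IH; rewrite addSn (le_trans IH).
have lev k l : (k <= l)%N -> u l + (2 ^+ l)^-1 <= u k + (2 ^+ k)^-1.
  by move=> /subnK <-; elim: (l - k)%N => // m IH;
    rewrite addSn (le_trans _ IH).
have p0 k : 0 <= (2 ^+ k)^-1 :> R by rewrite invr_ge0 exprn_ge0.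
have uv k l : u k <= u l + (2 ^+ l)^-1.
  have [kl|lk] := leqP k l; first by rewrite (le_trans (leu _ _ kl)) // lerDl.
  by rewrite (le_trans _ (lev _ _ (ltnW lk))) // lerDl.
have su : has_sup (range u).
  split; first by exists (u 0%N); exists 0%N.
  by exists (u 0%N + (2 ^+ 0)^-1) => _ [k _ <-].
exists (sup (range u)) => k; apply/andP; split.
  by apply: sup_upper_bound => //; exists k.
by apply: ge_sup => [|_ [l _ <-]] //; exists (u 0%N); exists 0%N.
Qed.

Variables (g : C -> C) (w1 w2 : C).

(** Coordinates on the parallelogram spanned by w1 and w2. In the application w is a logarithm and
    w2 = 2 pi i, so that the parallelogram is an annulus cut open. *)
Definition pt (s t : R) : C := s%:C * w1 + t%:C * w2.

Hypothesis g_diff : forall s t, 0 <= s <= 1 -> 0 <= t <= 1 ->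
  exists d : C, is_derive (pt s t) 1 g d.

Let h N (i j : nat) : C := g (pt (i%:R / 2 ^+ N) (j%:R / 2 ^+ N)).

(* Up to the factor of the mesh size, the left Riemann sum for the integral   *)
(* of g along the boundary of a cell; contributions of inner edges cancel     *)
(* exactly, and so does the sum of an affine function.                        *)
Let cell (f : nat -> nat -> C) (i j : nat) : C :=
  w2 * (f i.+1 j - f i j) - w1 * (f i j.+1 - f i j).

Let J f (a b L : nat) : C :=
  \sum_(a <= i < a + L) \sum_(b <= j < b + L) cell f i j.

Let J_quarter f a b L : J f a b (L + L) =
  J f a b L + J f a (b + L) L + (J f (a + L) b L + J f (a + L) (b + L) L).
Proof.
have S2 i : \sum_(b <= j < b + (L + L)) cell f i j =
    \sum_(b <= j < b + L) cell f i j + \sum_(b + L <= j < b + L + L) cell f i j.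
  by rewrite addnA (@big_cat_nat _ _ _ (b + L)) ?leq_addr.
rewrite /J (eq_bigr _ (fun i _ => S2 i)) big_split /= addnA.
have S1 (F : nat -> C) : \sum_(a <= i < a + L + L) F i =
    \sum_(a <= i < a + L) F i + \sum_(a + L <= i < a + L + L) F i.
  by rewrite (@big_cat_nat _ _ _ (a + L)) ?leq_addr.
by rewrite !S1 addrACA.
Qed.

Let J_telescope f a b L : J f a b L =
  w2 * (\sum_(b <= j < b + L) (f (a + L)%N j - f a j)) -
  w1 * (\sum_(a <= i < a + L) (f i (b + L)%N - f i b)).
Proof.
rewrite /J.
under eq_bigr do rewrite sumrB.
rewrite sumrB; congr (_ - _).
- rewrite exchange_big mulr_sumr /=; apply: eq_bigr => j _.
  by rewrite -mulr_sumr (telescope_sumr (f^~ j)) ?leq_addr.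
- rewrite mulr_sumr; apply: eq_bigr => i _.
  by rewrite -mulr_sumr (telescope_sumr (f i)) ?leq_addr.
Qed.

Let J_affine N a b L (c d : C) (f : nat -> nat -> C) :
  J f a b L =
  J (fun i j => f i j - (c + d * pt (i%:R / 2 ^+ N) (j%:R / 2 ^+ N))) a b L.
Proof.
apply: eq_bigr => i _; apply: eq_bigr => j _; rewrite /cell /pt.
rewrite -[i.+1]addn1 -[j.+1]addn1 !natrD !mulrDl !rmorphD /=.
set x := (_ / _)%:C; set y := (_ / _)%:C; set z := (_ / _)%:C.
ring.
Qed.

(** Only boundary terms survive the telescoping, so the bound is linear in L and not quadratic. *)
Let J_bound f a b L (e : C) :
  (forall i j, (a <= i <= a + L)%N -> (b <= j <= b + L)%N -> `|f i j| <= e) ->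
  `|J f a b L| <= (`|w1| + `|w2|) * (L%:R * (2 * e)).
Proof.
move=> fe; rewrite J_telescope.
have S (c : nat) (u v : nat -> C) : (forall i, (c <= i <= c + L)%N ->
    `|u i| <= e /\ `|v i| <= e) ->
    `|\sum_(c <= i < c + L) (u i - v i)| <= L%:R * (2 * e).
  move=> H; rewrite (le_trans (ler_norm_sum _ _ _)) //.
  have -> : L%:R * (2 * e) = \sum_(c <= i < c + L) 2 * e.
    by rewrite sumr_const_nat addKn mulr_natl.
  rewrite big_nat [leRHS]big_nat; apply: ler_sum => i /andP[ci iL].
  have [ui vi] := H i (introT andP (conj ci (ltnW iL))).
  by rewrite (le_trans (ler_normB _ _)) // mulr_natl mulr2n lerD.
rewrite mulrDl [leRHS]addrC (le_trans (ler_normB _ _)) //.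
rewrite !normrM lerD // ler_wpM2l //; apply: S => i iL; split; apply: fe => //;
  by rewrite ?leqnn ?leq_addr ?leq_addl.
Qed.

(** For the dyadic square of side 2^(-k) with corner (a, b) / 2^k: after scaling by the mesh size
    2^(-(k + p)) the boundary sum is at most e times the area 4^(-k). Bounds proportional to the
    area add up under quartering. *)
Let good (e : C) k a b := exists p0, forall p, (p0 <= p)%N ->
  `|J (h (k + p)) (a * 2 ^ p) (b * 2 ^ p) (2 ^ p)| <= e * 2 ^+ p / 2 ^+ k.

Let good_quarter e k a b :
  good e k.+1 a.*2 b.*2 -> good e k.+1 a.*2 b.*2.+1 ->
  good e k.+1 a.*2.+1 b.*2 -> good e k.+1 a.*2.+1 b.*2.+1 -> good e k a b.
Proof.
move=> [p1 H1] [p2 H2] [p3 H3] [p4 H4].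
exists (maxn (maxn p1 p2) (maxn p3 p4)).+1 => -[//|p].
rewrite ltnS !geq_max => /andP[/andP[l1 l2] /andP[l3 l4]].
rewrite -addSnnS expnS mul2n -addnn J_quarter.
have E x : (x * (2 ^ p + 2 ^ p) = x.*2 * 2 ^ p)%N by rewrite addnn; lia.
have E1 x : (x.*2 * 2 ^ p + 2 ^ p = x.*2.+1 * 2 ^ p)%N by lia.
rewrite !E !E1.
have -> : e * 2 ^+ p.+1 / 2 ^+ k = (e * 2 ^+ p / 2 ^+ k.+1 + e * 2 ^+ p / 2 ^+
  k.+1) + (e * 2 ^+ p / 2 ^+ k.+1 + e * 2 ^+ p / 2 ^+ k.+1).
  by rewrite !exprS; field; rewrite expf_neq0.
do 2!(apply: (le_trans (ler_normD _ _)); apply: lerD).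
all: try exact: H1; try exact: H2; try exact: H3; try exact: H4.
Qed.

Let next e k (c : nat * nat) : nat * nat :=
  if ~~ `[< good e k.+1 c.1.*2 c.2.*2 >] then (c.1.*2, c.2.*2)
  else if ~~ `[< good e k.+1 c.1.*2 c.2.*2.+1 >] then (c.1.*2, c.2.*2.+1)
  else if ~~ `[< good e k.+1 c.1.*2.+1 c.2.*2 >] then (c.1.*2.+1, c.2.*2)
  else (c.1.*2.+1, c.2.*2.+1).

Let next_bad e k c : ~ good e k c.1 c.2 ->
  ~ good e k.+1 (next e k c).1 (next e k c).2.
Proof.
move=> bad; rewrite /next.
case: asboolP => [g1|//]; case: asboolP => [g2|//].
by case: asboolP => [g3 g4|//]; apply: bad; exact: good_quarter.
Qed.

Let nextE e k c :
  ((next e k c).1 = c.1.*2 \/ (next e k c).1 = c.1.*2.+1) /\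
  ((next e k c).2 = c.2.*2 \/ (next e k c).2 = c.2.*2.+1).
Proof. by rewrite /next; do ?case: ifP => _ /=; split; auto. Qed.

Let dyadic_limit (c : nat -> nat) : c 0%N = 0%N ->
  (forall k, c k.+1 = (c k).*2 \/ c k.+1 = (c k).*2.+1) ->
  exists2 s : R, 0 <= s <= 1 &
    forall k, (c k)%:R / 2 ^+ k <= s <= (c k)%:R / 2 ^+ k + (2 ^+ k)^-1.
Proof.
move=> c0 cS.
have p0 k : 0 < 2 ^+ k :> R by rewrite exprn_gt0.
have E k : (2 ^+ k)^-1 = 2 / 2 ^+ k.+1 :> R.
  by rewrite exprS; field; rewrite gt_eqF.
have [k|k|s Hs] := @nested_dyadic (fun k => (c k)%:R / 2 ^+ k).
- rewrite E mulrA ler_pM2r ?invr_gt0 // -natrM ler_nat.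
  by case: (cS k) => ->; rewrite -muln2 // ltnW.
- have -> : (c k)%:R / 2 ^+ k + (2 ^+ k)^-1 = (c k * 2 + 2)%:R / 2 ^+ k.+1 :> R.
    by rewrite !(E k) mulrA -mulrDl natrD natrM.
  have -> : (c k.+1)%:R / 2 ^+ k.+1 + (2 ^+ k.+1)^-1 =
            (c k.+1).+1%:R / 2 ^+ k.+1 :> R.
    by rewrite -[in RHS]addn1 natrD mulrDl mul1r.
  rewrite ler_pM2r ?invr_gt0 // ler_nat.
  by case: (cS k) => ->; rewrite -muln2 ?addn2 ?addn1.
by exists s => //; have := Hs 0%N; rewrite c0 expr0 mul0r add0r invr1.
Qed.

(** Goursat's bisection: a bad unit square contains nested bad squares shrinking to a point. Near
    that point g is affine up to an error of e' times the diameter; the affine part contributes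
    nothing, and the error is small enough to make a small square good. *)
Let all_good e : 0 < e -> good e 0 0 0.
Proof.
move=> e0; apply: contrapT => bad0.
pose c := fix c k := if k is k'.+1 then next e k' (c k') else (0, 0)%N.
have bad k : ~ good e k (c k).1 (c k).2.
  by elim: k => // k /next_bad.
have [s s01 Hs] : exists2 s : R, 0 <= s <= 1 & forall k,
    (c k).1%:R / 2 ^+ k <= s <= (c k).1%:R / 2 ^+ k + (2 ^+ k)^-1.
  by apply: (dyadic_limit (c := fun k => (c k).1)) => // k;
    case: (nextE e k (c k)).
have [t t01 Ht] : exists2 t : R, 0 <= t <= 1 & forall k,
    (c k).2%:R / 2 ^+ k <= t <= (c k).2%:R / 2 ^+ k + (2 ^+ k)^-1.
  by apply: (dyadic_limit (c := fun k => (c k).2)) => // k;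
    case: (nextE e k (c k)).
have [d /is_derive_bound gd] := g_diff s01 t01.
pose W := `|w1| + `|w2|.
have W0 : 0 <= W by rewrite addr_ge0.
(* Chosen so that 2 W^2 e' <= e in the last estimate; the summand 1 keeps the denominator positive
   when W = 0. *)
pose e' := e / (2 * W ^+ 2 + 1).
have D0 : 0 < 2 * W ^+ 2 + 1 by rewrite ltr_wpDl // mulr_ge0 ?exprn_ge0.
have e'0 : 0 < e' by rewrite divr_gt0.
have [dl dl0 Hd] := gd _ e'0.
have [k Hk] : exists k, W / 2 ^+ k < dl.
  have [x x0 Ex] := real_of_pos dl0.
  have [y Ey] : exists y : R, W = y%:C.
    by apply/complex_realP; exact: ger0_real.
  have : (fun k => y * (2^-1) ^+ k) @ \oo --> y * 0.
    by apply: cvgMr; apply: cvg_expr; rewrite gtr0_norm ?invr_gt0 // invf_lt1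
      // ltr1n.
  rewrite mulr0 => /cvgrPdist_lt/(_ _ x0)[k _ /(_ k (leqnn k))].
  rewrite /= sub0r normrN => H; exists k; rewrite Ex Ey.
  have -> : y%:C / 2 ^+ k = (y * 2^-1 ^+ k)%:C :> C.
    by rewrite rmorphM rmorphXn fmorphV rmorph_nat exprVn.
  by rewrite ltcR (le_lt_trans (ler_norm _)).
apply: (bad k); exists 0%N => p _.
set a := (c k).1; set b := (c k).2.
have p0 n : 0 < 2 ^+ n :> R by rewrite exprn_gt0.
have near_corner (a0 i : nat) (u : R) :
    a0%:R / 2 ^+ k <= u <= a0%:R / 2 ^+ k + (2 ^+ k)^-1 ->
    (a0 * 2 ^ p <= i <= a0 * 2 ^ p + 2 ^ p)%N ->
    `|(i%:R / 2 ^+ (k + p) - u)%:C : C| <= (2 ^+ k)^-1.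
  move=> /andP[u1 u2] /andP[i1 i2].
  have E x : x%:R / 2 ^+ k = (x * 2 ^ p)%:R / 2 ^+ (k + p) :> R.
    by rewrite natrM natrX exprD; field; rewrite !gt_eqF.
  have E1 : (2 ^+ k)^-1 = (2 ^ p)%:R / 2 ^+ (k + p) :> R.
    by rewrite natrX exprD; field; rewrite !gt_eqF.
  have l1 : a0%:R / 2 ^+ k <= i%:R / 2 ^+ (k + p) :> R.
    by rewrite E ler_pM2r ?invr_gt0 // ler_nat.
  have l2 : i%:R / 2 ^+ (k + p) <= a0%:R / 2 ^+ k + (2 ^+ k)^-1 :> R.
    by rewrite E E1 -mulrDl ler_pM2r ?invr_gt0 // -natrD ler_nat.
  rewrite norm_real -[leRHS]/(_^-1).
  have -> : (2 ^+ k)^-1 = ((2 ^+ k)^-1)%:C :> C.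
    by rewrite fmorphV rmorphXn rmorph_nat.
  by rewrite lecR ler_distl; move: l1 l2 u1 u2; lra.
rewrite (J_affine (k + p) _ _ _ (g (pt s t) - d * pt s t) d).
have /J_bound : forall i j,
    (a * 2 ^ p <= i <= a * 2 ^ p + 2 ^ p)%N ->
    (b * 2 ^ p <= j <= b * 2 ^ p + 2 ^ p)%N ->
    `|h (k + p) i j - (g (pt s t) - d * pt s t + d * pt (i%:R / 2 ^+ (k + p))
      (j%:R / 2 ^+ (k + p)))|
    <= e' * (W / 2 ^+ k).
  move=> i j /(near_corner _ _ _ (Hs k)) hi /(near_corner _ _ _ (Ht k)) hj.
  rewrite /h; set z := pt (i%:R / _) _.
  have Ez : z - pt s t = (i%:R / 2 ^+ (k + p) - s)%:C * w1 + (j%:R / 2 ^+ (k +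
    p) - t)%:C * w2.
    rewrite /z /pt !rmorphB /=.
    move: (_ / _)%:C (_ / _)%:C s%:C t%:C => x y u v.
    by rewrite !mulrBl opprD addrACA.
  have zW : `|z - pt s t| <= W / 2 ^+ k.
    rewrite Ez (le_trans (ler_normD _ _)) // !normrM /W mulrDl.
    by rewrite ![_ / 2 ^+ k]mulrC lerD // ler_wpM2r.
  have := Hd _ (le_lt_trans zW Hk).
  rewrite [pt s t + _]addrC subrK.
  have -> : g z - g (pt s t) - d * (z - pt s t) =
            g z - (g (pt s t) - d * pt s t + d * z) by ring.
  by move=> /le_trans; apply; rewrite ler_wpM2l // ltW.
move=> /le_trans; apply; rewrite -/W.
have -> : W * ((2 ^ p)%:R * (2 * (e' * (W / 2 ^+ k)))) =
   (e' * (2 * W ^+ 2)) * (2 ^+ p / 2 ^+ k) by rewrite natrX; ring.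
rewrite -[leRHS]mulrA ler_wpM2r ?divr_ge0 ?exprn_ge0 //.
rewrite /e' mulrAC ler_pdivrMr // ler_wpM2l ?ltW //.
by rewrite ltrDl.
Qed.

(** Periodicity in t cancels the two sides parallel to w1. The sums along s = 0 and s = 1 remain;
    for a function of exp w and w2 = 2 pi i they are sums over two concentric circles. *)
Lemma goursat : (forall s, 0 <= s <= 1 -> g (pt s 1) = g (pt s 0)) ->
  w2 != 0 -> forall e : C, 0 < e -> exists p0, forall p, (p0 <= p)%N ->
  `|\sum_(0 <= j < 2 ^ p) (g (pt 1 (j%:R / 2 ^+ p)) - g (pt 0 (j%:R / 2 ^+ p)))|
    <= e * 2 ^+ p.
Proof.
move=> per w20 e e0.
have ew : 0 < e * `|w2| by rewrite mulr_gt0 // normr_gt0.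
have [p0 H] := all_good ew; exists p0 => p /H.
rewrite J_telescope !mul0n !add0n expr0 divr1.
rewrite [X in _ - w1 * X]big1_seq; last first.
  move=> i; rewrite mem_index_iota => /andP[_ /= ip].
  rewrite /h natrX divff ?expf_neq0 // mul0r per ?subrr //.
  rewrite divr_ge0 ?exprn_ge0 //= ler_pdivrMr ?exprn_gt0 // mul1r -natrX
    ler_nat.
  exact: ltnW.
rewrite mulr0 subr0 normrM [e * _]mulrC -mulrA ler_pM2l ?normr_gt0 //.
rewrite /h natrX.
under eq_bigr do rewrite divff ?expf_neq0 // mul0r.
by [].
Qed.

End Goursat.

(** * Means over grids of roots of unity *)

Section TorusMeans.
Variables (R : realType).
Local Notation C := (Cplx R).
Local Open Scope complex_scope.

Definition uroot n : C := cexp (twopii R / n%:R).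

Lemma uroot_exp n m : uroot n ^+ m = cexp (twopii R * (m%:R / n%:R)%:C).
Proof.
rewrite -cexpMn -[_ *+ m]mulr_natr; congr cexp.
by rewrite rmorphM fmorphV !rmorph_nat mulrAC mulrA.
Qed.

Lemma uroot1 n : (0 < n)%N -> uroot n ^+ n = 1.
Proof.
move=> n0; rewrite uroot_exp divff ?pnatr_eq0 -?lt0n // rmorph1 mulr1.
exact: cexp_twopii.
Qed.

Lemma uroot_neq1 n m : (0 < m < n)%N -> uroot n ^+ m != 1.
Proof.
move=> /andP[m0 mn]; rewrite uroot_exp.
set t := (m%:R / n%:R : R).
have t0 : 0 < t by rewrite divr_gt0 // ltr0n // (ltn_trans m0).
have t1 : t < 1 by rewrite ltr_pdivrMr ?ltr0n ?(ltn_trans m0) // mul1r ltr_nat.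
rewrite /twopii /cexp /=; simpc; rewrite /= expR0 !mul1r.
have -> : (pi *+ 2) * t = (pi * t) *+ 2 by rewrite mulrnAl.
rewrite mulr2n cosD -!expr2 eq_complex /= negb_and; apply/orP; left.
have s0 : 0 < sin (pi * t).
  by apply: sin_gt0_pi; rewrite mulr_gt0 ?pi_gt0 //= gtr_pMr ?pi_gt0.
by rewrite cos2sin2 lt_eqF // -addrA -opprD gtrBl addr_gt0 // exprn_gt0.
Qed.

Lemma norm_uroot n m : `|uroot n ^+ m| = 1.
Proof.
by rewrite uroot_exp norm_cexp /twopii /=; simpc; rewrite /= expR0.
Qed.

Variable r : nat.
Local Notation V := 'rV[C]_r.
Implicit Types (x y z : V) (G H : V -> C).

Definition hmul z x : V := \row_i (z 0 i * x 0 i).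

Lemma hmulE z x i : hmul z x 0 i = z 0 i * x 0 i.
Proof. by rewrite mxE. Qed.

Local Opaque hmul.

Lemma hmulA z y x : hmul z (hmul y x) = hmul (hmul z y) x.
Proof. by apply/rowP => i; rewrite !hmulE mulrA. Qed.

Lemma hmul1 x : hmul (const_mx 1) x = x.
Proof. by apply/rowP => i; rewrite hmulE mxE mul1r. Qed.

Lemma hmulC z y : hmul z y = hmul y z.
Proof. by apply/rowP => i; rewrite !hmulE mulrC. Qed.

Lemma hmulCA z y x : hmul z (hmul y x) = hmul y (hmul z x).
Proof. by rewrite !hmulA (hmulC z). Qed.

Definition zmonom x (m : 'rV[int]_r) : C := \prod_i x 0 i ^ m 0 i.

Lemma zmonomM z x m : zmonom (hmul z x) m = zmonom z m * zmonom x m.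
Proof.
rewrite -big_split; apply: eq_bigr => i _; rewrite hmulE /=.
by case: (m 0 i) => k; rewrite /exprz ?exprMn ?invfM.
Qed.

Definition nonzero x := forall i, x 0 i != 0.

Lemma zmonom_neq0 x m : nonzero x -> zmonom x m != 0.
Proof. by move=> x0; apply/prodf_neq0 => i _; rewrite expfz_neq0. Qed.

Lemma zmonomD x m k : nonzero x -> zmonom x (m + k) = zmonom x m * zmonom x k.
Proof.
by move=> x0; rewrite -big_split; apply: eq_bigr => i _; rewrite mxE expfzDr.
Qed.

Lemma zmonom0 x : zmonom x 0 = 1.
Proof. by apply: big1 => i _; rewrite mxE. Qed.

Definition crot (i : 'I_r) (c : C) : V := \row_l (if l == i then c else 1).

Lemma crot1 i : crot i 1 = const_mx 1.
Proof. by apply/rowP => l; rewrite !mxE if_same. Qed.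

Lemma crotM i c d : crot i (c * d) = hmul (crot i c) (crot i d).
Proof.
by apply/rowP => l; rewrite hmulE !mxE; case: (l == i); rewrite ?mul1r.
Qed.

Lemma nonzero_crot i c : c != 0 -> nonzero (crot i c).
Proof. by move=> c0 l; rewrite mxE; case: ifP => _; rewrite ?oner_eq0. Qed.

Lemma zmonom_crot i c m : zmonom (crot i c) m = c ^ m 0 i.
Proof.
rewrite /zmonom (bigD1 i) //= mxE eqxx big1 ?mulr1 // => j ji.
by rewrite mxE (negPf ji) exp1rz.
Qed.

Lemma nonzero_hmul z x : nonzero z -> nonzero x -> nonzero (hmul z x).
Proof. by move=> z0 x0 i; rewrite hmulE mulf_neq0. Qed.

Section Grid.
Variable N : nat.
Local Notation n := (2 ^ N.+1)%N.

Definition zeta : C := uroot n.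

(* The exponent is [N.+1] because ['Z_1] is not the trivial ring. Averages    *)
(* over these grids, which refine each other, play the role of integrals      *)
(* over the torus.                                                            *)
Definition grid := 'rV['Z_n]_r.

Definition gridpt (k : grid) : V := \row_i zeta ^+ k 0 i.

Let n1 : (1 < n)%N. Proof. by rewrite -{1}(expn0 2) ltn_exp2l. Qed.

Let n0 : (0 < n)%N. Proof. exact: ltnW. Qed.

Lemma zetaD (a b : 'Z_n) : zeta ^+ (a + b)%R = zeta ^+ a * zeta ^+ b.
Proof.
by rewrite -exprD /= [X in (_ %% X)%N]Zp_cast // expr_mod // uroot1.
Qed.

Let zetaN (a : 'Z_n) : zeta ^+ (- a)%R = (zeta ^+ a)^-1.
Proof.
have z0 : zeta ^+ a != 0 by rewrite expf_neq0 // cexp_neq0.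
by apply: (mulfI z0); rewrite -zetaD subrr expr0 divff.
Qed.

Lemma zetaMz (a : 'Z_n) (c : int) : zeta ^+ (a *~ c)%R = (zeta ^+ a) ^ c.
Proof.
have Mn m : zeta ^+ (a *+ m)%R = (zeta ^+ a) ^+ m.
  by elim: m => // m IH; rewrite mulrS zetaD IH exprS.
by case: c => m; rewrite /intmul /exprz ?zetaN Mn.
Qed.

Lemma gridptE k i : gridpt k 0 i = zeta ^+ k 0 i.
Proof. by rewrite mxE. Qed.

Lemma gridptD k l : hmul (gridpt k) (gridpt l) = gridpt (k + l).
Proof. by apply/rowP => i; rewrite hmulE !gridptE mxE zetaD. Qed.

Lemma gridpt_delta i (j : nat) : (j < n)%N ->
  gridpt (\row_l (if l == i then j%:R else 0)) = crot i (zeta ^+ j).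
Proof.
move=> jn; apply/rowP => l; rewrite !mxE; case: eqP => // _.
by rewrite val_Zp_nat // modn_small.
Qed.

Lemma nonzero_gridpt k : nonzero (gridpt k).
Proof. by move=> i; rewrite mxE expf_neq0 // cexp_neq0. Qed.

Lemma norm_gridpt k i : `|gridpt k 0 i| = 1.
Proof. by rewrite mxE norm_uroot. Qed.

Lemma norm_zmonom_gridpt k x (m : 'rV[int]_r) :
  `|zmonom (hmul (gridpt k) x) m| = `|zmonom x m|.
Proof.
rewrite zmonomM normrM [X in X * _](_ : _ = 1) ?mul1r // normr_prod big1 // =>
  i _.
have := norm_gridpt k i; case: (m 0 i) => u; rewrite /exprz.
  by rewrite normrX => ->; rewrite expr1n.
by rewrite normfV normrX => ->; rewrite expr1n invr1.
Qed.

Definition tmean G x : C := #|{: grid}|%:R^-1 * \sum_(k : grid) G (hmul (gridpt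
  k) x).

Lemma card_grid_neq0 : #|{: grid}|%:R != 0 :> C.
Proof. by rewrite pnatr_eq0 -lt0n; apply/card_gt0P; exists 0. Qed.

Lemma eq_tmean G H x : (forall k, G (hmul (gridpt k) x) = H (hmul (gridpt k)
  x)) ->
  tmean G x = tmean H x.
Proof. by move=> E; congr (_ * _); apply: eq_bigr => k _; exact: E. Qed.

Lemma tmeanD G H x : tmean (fun y => G y + H y) x = tmean G x + tmean H x.
Proof. by rewrite /tmean big_split mulrDr. Qed.

Lemma tmeanB G H x : tmean (fun y => G y - H y) x = tmean G x - tmean H x.
Proof. by rewrite /tmean sumrB mulrBr. Qed.

Lemma tmeanZ c G x : tmean (fun y => c * G y) x = c * tmean G x.
Proof. by rewrite /tmean -mulr_sumr mulrCA. Qed.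

Lemma tmean_sum (I : Type) (s : seq I) (P : pred I) (G : I -> V -> C) x :
  tmean (fun y => \sum_(i <- s | P i) G i y) x = \sum_(i <- s | P i) tmean (G
    i) x.
Proof. by rewrite /tmean exchange_big mulr_sumr. Qed.

Lemma norm_tmean G x e : (forall k, `|G (hmul (gridpt k) x)| <= e) ->
  `|tmean G x| <= e.
Proof.
move=> H; rewrite normrM normfV normr_nat mulrC ler_pdivrMr; last first.
  by rewrite lt_neqAle eq_sym card_grid_neq0 ler0n.
rewrite (le_trans (ler_norm_sum _ _ _)) // (le_trans (ler_sum _ (fun k _ => H
  k))) //.
by rewrite sumr_const mulr_natr.
Qed.

Lemma tmean_shift G x l : tmean G (hmul (gridpt l) x) = tmean G x.
Proof.
congr (_ * _); rewrite [RHS](reindex_inj (addIr l)) /=.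
by apply: eq_bigr => k _; rewrite hmulA gridptD.
Qed.

Lemma tmean_hmul G x y : tmean G (hmul y x) = tmean (fun z => G (hmul y z)) x.
Proof. by congr (_ * _); apply: eq_bigr => k _; rewrite hmulCA. Qed.

Lemma tmean_involution G x (f : V -> V) (F : grid -> grid) : involutive F ->
  (forall k, f (hmul (gridpt k) x) = hmul (gridpt (F k)) (f x)) ->
  tmean (G \o f) x = tmean G (f x).
Proof.
move=> FK Ff; congr (_ * _); rewrite [RHS](reindex_inj (inv_inj FK)) /=.
by apply: eq_bigr => k _; rewrite Ff.
Qed.

(** Shifting the grid in a coordinate with m_i nonzero multiplies the mean by zeta^(m_i), which
    differs from 1 because |m_i| < n. A grid only separates exponents that are small compared to its
    order. *)
Lemma tmean_zmonom (m : 'rV[int]_r) x : m != 0 -> (forall i, (`|m 0%R i| <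
  n)%N) ->
  tmean (zmonom^~ m) x = 0.
Proof.
move=> m0 mn; have [i mi0] : exists i, m 0 i != 0.
  apply: contra_notP (negP m0) => /forallNP H; apply/eqP/rowP => i.
  by rewrite mxE; apply/eqP; apply: contra_notT (H i).
pose d : grid := \row_l (if l == i then 1%:R else 0).
have E : zeta ^ m 0 i * tmean (zmonom^~ m) x = tmean (zmonom^~ m) x.
  rewrite -[RHS](tmean_shift _ _ d) tmean_hmul -tmeanZ; apply: eq_tmean => k.
  by rewrite [in RHS]zmonomM gridpt_delta // expr1 zmonom_crot.
have zm : zeta ^ m 0 i != 1.
  have := mn i; move: mi0; case: (m 0 i) => j j0 jn.
    by apply: uroot_neq1; rewrite lt0n jn andbT.
  by rewrite /exprz invr_eq1; apply: uroot_neq1.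
apply/eqP; move/eqP: E; rewrite -subr_eq0 -[X in _ - X]mul1r -mulrBl mulf_eq0.
by rewrite subr_eq0 (negPf zm).
Qed.

Definition cmean i G x : C :=
  n%:R^-1 * \sum_(0 <= j < n) G (hmul (crot i (zeta ^+ j)) x).

(** Each rotation in the circle mean is a translation of the grid. Torus means can therefore be
    compared one coordinate at a time. *)
Lemma tmean_cmean i G x : tmean (cmean i G) x = tmean G x.
Proof.
rewrite tmeanZ tmean_sum big_nat (eq_bigr (fun=> tmean G x)); last first.
  move=> j /andP[_ jn].
  by rewrite -(tmean_shift G x (\row_l (if l == i then j%:R else 0)))
    gridpt_delta // tmean_hmul.
rewrite -big_nat sumr_const_nat subn0 -[tmean _ _ *+ _]mulr_natl mulKf //
  pnatr_eq0 -lt0n.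
Qed.

Lemma tmean_eq0 (m : 'rV[int]_r) x : (forall i, (`|m 0%R i| < n)%N) ->
  tmean (zmonom^~ m) x = (m == 0)%:R.
Proof.
move=> mn; have [->|m0] := eqVneq m 0; last exact: tmean_zmonom.
rewrite /tmean (eq_bigr (fun=> 1)) => [|k _]; last by rewrite zmonom0.
by rewrite sumr_const mulVf // card_grid_neq0.
Qed.

End Grid.

(** * The action of sigma_j on exponents and on torus means *)

Section SimpleReflection.
Variables (S : root_datum R r) (j : 'I_r).

Lemma sigma_actE x k : sigma_act S j x 0 k = x 0 k * x 0 j ^ (- cmat S j k).
Proof. by rewrite mxE. Qed.

Local Opaque sigma_act.

(** The pairing with alpha_j^vee in coordinates with respect to the simple roots, see
    [pairing_form]; [zrefl] is sigma_j on exponents. *)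
Definition pairing (m : 'rV[int]_r) : int := \sum_k m 0 k * cmat S j k.

Definition zrefl (m : 'rV[int]_r) : 'rV[int]_r :=
  m - pairing m *: delta_mx 0 j.

Lemma sigma_act_hmul z x :
  sigma_act S j (hmul z x) = hmul (sigma_act S j z) (sigma_act S j x).
Proof.
apply/rowP => k; apply: (etrans (sigma_actE (hmul z x) k)).
apply: (etrans (congr2 (fun a b => a * b ^ _) (hmulE z x k) (hmulE z x j))).
apply: (etrans _ (esym (etrans (hmulE _ _ k)
  (congr2 *%R (sigma_actE z k) (sigma_actE x k))))).
rewrite [RHS]mulrACA; congr (_ * _).
by case: (- cmat S j k) => a; rewrite /exprz ?exprMn ?invfM.
Qed.

Lemma zreflE m k : zrefl m 0 k = m 0 k - pairing m * (k == j)%:R.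
Proof. by rewrite !mxE eqxx. Qed.

Lemma zmonom_sigma x m : nonzero x ->
  zmonom (sigma_act S j x) m = zmonom x (zrefl m).
Proof.
move=> x0; rewrite /zmonom.
under eq_bigr do rewrite sigma_actE.
under [RHS]eq_bigr do rewrite zreflE expfzDr //.
have E k : (x 0 k * x 0 j ^ (- cmat S j k)) ^ m 0 k =
           x 0 k ^ m 0 k * x 0 j ^ (- (m 0 k * cmat S j k)).
  rewrite expfzMl; congr (_ * _).
  by rewrite exprz_exp mulNr mulrC.
rewrite (eq_bigr _ (fun k _ => E k)) !big_split /=; congr (_ * _).
rewrite [RHS](bigD1 j) //= eqxx mulr1 [X in _ = _ * X]big1 ?mulr1; last first.
  by move=> k /negPf ->; rewrite mulr0 oppr0 expr0z.
rewrite /pairing -sumrN; elim/big_rec2: _ => [|k a b _ ->].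
  by rewrite expr0z.
by rewrite expfzDr.
Qed.

Lemma cmat_diag : cmat S j j = 2.
Proof. by have [] := cmat_GCM S. Qed.

Lemma pairingD (k k' : 'rV[int]_r) : pairing (k + k') = pairing k + pairing k'.
Proof. by rewrite /pairing -big_split; apply: eq_bigr => i _;
  rewrite mxE mulrDl. Qed.

Lemma pairingN (k : 'rV[int]_r) : pairing (- k) = - pairing k.
Proof. by rewrite /pairing -sumrN; apply: eq_bigr => i _;
  rewrite mxE mulNr. Qed.

Lemma pairing_delta (e : int) : pairing (e *: delta_mx 0 j) = e * 2.
Proof.
rewrite /pairing (bigD1 j) //= !mxE !eqxx mulr1 cmat_diag big1 ?addr0 // => i
  ij.
by rewrite !mxE (negPf ij) andbF mulr0 mul0r.
Qed.

Lemma zreflN (k : 'rV[int]_r) : zrefl (- k) = - zrefl k.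
Proof. by rewrite /zrefl pairingN scaleNr opprB opprK addrC. Qed.

Lemma zreflK (k : 'rV[int]_r) : zrefl (zrefl k) = k.
Proof.
have E : pairing (zrefl k) = - pairing k.
  by rewrite /zrefl pairingD -scaleNr pairing_delta; ring.
by rewrite {1}/zrefl E scaleNr opprK /zrefl subrK.
Qed.

Lemma sigma_actK x : x 0 j != 0 -> sigma_act S j (sigma_act S j x) = x.
Proof.
move=> xj; apply/rowP => k; rewrite !sigma_actE cmat_diag.
have -> : x 0 j * x 0 j ^ (- (2 : int)) = (x 0 j)^-1.
  by rewrite -{1}[x 0 j]expr1z -expfzDr.
by rewrite exprz_inv opprK -mulrA -expfzDr // addNr mulr1.
Qed.

Lemma sigma_act_neq0 x k : x 0 j != 0 -> (sigma_act S j x 0 k == 0) = (x 0 k ==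
  0).
Proof. by move=> xj; rewrite sigma_actE mulf_eq0 expfz_eq0 (negPf xj) andbF
  orbF. Qed.

Lemma nonzero_sigma x : nonzero x -> nonzero (sigma_act S j x).
Proof. by move=> x0 k; rewrite sigma_act_neq0. Qed.

(** On exponents of zeta, sigma_j is an integral linear involution of the grid group, so it permutes
    the grid points. *)
Lemma tmean_sigma N G x :
  tmean N (G \o sigma_act S j) x = tmean N G (sigma_act S j x).
Proof.
pose F (k : grid N) : grid N := \row_i (k 0 i + k 0 j *~ - cmat S j i).
have FE (k : grid N) i : F k 0 i = k 0 i + k 0 j *~ - cmat S j i by rewrite mxE.
have FK : involutive F.
  move=> k; apply/rowP => i; rewrite !FE cmat_diag.
  have -> : k 0 j + k 0 j *~ - (2 : int) = - k 0 j.
    by rewrite mulrNz -[X in X - _]mulr1z -mulrzBr.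
  by rewrite mulNrz mulrNz opprK subrK.
apply: tmean_involution FK _ => k; rewrite sigma_act_hmul; congr hmul.
by apply/rowP => i; rewrite sigma_actE !gridptE FE zetaD zetaMz.
Qed.

Lemma eps_act_hmul (eta : C) x :
  eps_act S j eta x = hmul (\row_k eta ^ cmat S j k) x.
Proof. by apply/rowP => k; rewrite !mxE. Qed.

Lemma zmonom_eps (eta : C) x m : eta != 0 ->
  zmonom (eps_act S j eta x) m = eta ^ pairing m * zmonom x m.
Proof.
move=> e0; rewrite eps_act_hmul zmonomM; congr (_ * _);
  rewrite /pairing /zmonom.
elim/big_rec2: _ => [|k a b _ ->]; first by rewrite expr0z.
by rewrite mxE exprz_exp -expfzDr // mulrC.
Qed.

End SimpleReflection.

End TorusMeans.

(** * Uniformity over compact tori *)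

Section TorusTopology.
Variables (R : realType) (r : nat).
Local Notation C := (Cplx R).
Local Notation V := 'rV[C]_r.
Local Open Scope complex_scope.
Local Opaque hmul.

Lemma cvg_rV (T : Type) (F : set_system T) {FF : Filter F} (f : T -> V) (v : V)
  :
  (forall i, f t 0 i @[t --> F] --> v 0 i) -> f @ F --> v.
Proof.
move=> H A [P vP PA]; apply: (filterS PA).
have : \forall t \near F, forall i : 'I_r, P 0 i (f t 0 i).
  by apply: filter_forall => i; exact: (H i _ (vP 0 i)).
by apply: filterS => t Pt i j; rewrite (ord1 i); exact: Pt.
Qed.

Lemma cvg_coord (T : Type) (F : set_system T) {FF : Filter F} (f : T -> V) (v :
  V) i :
  f @ F --> v -> f t 0 i @[t --> F] --> v 0 i.
Proof.
by move=> H; exact: (cvg_comp f (fun x : V => x 0 i) H (@coord_continuous _ _ _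
  0 i v)).
Qed.

Lemma cvg_hmul (T : Type) (F : set_system T) {FF : Filter F} (f g : T -> V) (u
  v : V) :
  f @ F --> u -> g @ F --> v -> hmul (f t) (g t) @[t --> F] --> hmul u v.
Proof.
move=> fu gv; apply: cvg_rV => i; rewrite hmulE.
under eq_fun do rewrite hmulE.
by apply: cvgM; exact: cvg_coord.
Qed.

Lemma nbhs_rVP (x : V) (A : set V) : nbhs x A <->
  exists2 e : R, 0 < e & forall y : V, (forall i, `|y 0 i - x 0 i| < e%:C) -> A
    y.
Proof.
split=> [/nbhs_ballP[e /= /real_of_pos[e' e'0 ->] H]|[e e0 H]].
  exists e' => // y Hy; apply: H; split; first by rewrite ltcR.
  by move=> i j; rewrite (ord1 i) /ball /= distrC.
apply/nbhs_ballP; exists e%:C; first by rewrite /= ltcR.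
move=> y [_ By]; apply: H => i; have := By 0 i.
by rewrite /ball /= distrC.
Qed.

Lemma cvg_real_complex (T : Type) (F : set_system T) {FF : Filter F} (f : T ->
  R) (a : R) :
  f @ F --> a -> ((f t)%:C : C) @[t --> F] --> (a%:C : C).
Proof.
move=> fa; apply/cvgrPdist_lt => _ /real_of_pos[e e0 ->].
have /cvgrPdist_lt/(_ _ e0) := fa; apply: filterS => t H.
by rewrite -rmorphB norm_real ltcR.
Qed.

Lemma cvg_cexp (T : Type) (F : set_system T) {FF : Filter F} (f : T -> C) (a :
  C) :
  f @ F --> a -> cexp (f t) @[t --> F] --> cexp a.
Proof.
move=> fa; apply: (cvg_comp _ _ fa); apply: differentiable_continuous.
by apply/derivable1_diffP; have [] := is_derive_cexp a.
Qed.

Definition tor : set V := [set z | forall i, `|z 0 i| = 1].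

Lemma tor_gridpt N (k : grid r N) : tor (gridpt R k).
Proof. by move=> i; exact: norm_gridpt. Qed.

Lemma compact_tor : compact tor.
Proof.
have -> : tor = [set z : V | forall i, [set c : C | `|c| = 1] (z ord0 i)] by [].
apply: (rV_compact (A := fun=> [set c : C | `|c| = 1])) => _.
have -> : [set c : C | `|c| = 1] =
          (fun t : R => cexp (Complex 0 1 * t%:C)) @` `[- pi, pi].
  apply/seteqP; split=> [[a b]|_ [t _ <-]] /=; last first.
    by rewrite norm_cexp /=; simpc; rewrite /= expR0.
  rewrite normC => /complexI ab.
  have [|t tpi [-> ->]] := @unit_circle_angle _ a b.
    rewrite -[LHS]sqr_sqrtr ?addr_ge0 ?sqr_ge0 //.
    by rewrite [Num.sqrt _]ab expr1n.
  exists t; first by rewrite in_itv.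
  by rewrite /cexp /=; simpc; rewrite /= expR0 !mul1r.
apply: continuous_compact; last exact: segment_compact.
apply: continuous_subspaceT => t; apply: cvg_cexp.
by apply: cvgMr; exact: cvg_real_complex.
Qed.

(** The compactness principle behind all uniformity on tori: joint validity near each point of [tor]
    and for large N gives a common threshold for N. *)
Lemma tor_near (P : nat -> V -> Prop) :
  (forall z, tor z -> \forall z' \near z & N \near \oo, P N z') ->
  \forall N \near \oo, forall z, tor z -> P N z.
Proof.
move=> H; have /compact_near_coveringP := compact_tor.
by move=> /(_ nat \oo P _ H).
Qed.

Variables (G : V -> C).

Definition cts_on_orbit x := forall z, tor z -> {for hmul z x, continuous G}.

Lemma orbit_bounded x : cts_on_orbit x ->
  exists M, forall z, tor z -> `|G (hmul z x)| <= M%:R.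
Proof.
move=> Gx; have : \forall N \near \oo, forall z, tor z -> `|G (hmul z x)| <=
  N%:R.
  apply: tor_near => z tz.
  have Gz : G (hmul y x) @[y --> z] --> G (hmul z x).
    have hz : hmul y x @[y --> z] --> hmul z x.
      by apply: (@cvg_hmul V (nbhs z) _ id (fun=> x));
        [exact: cvg_id|exact: cvg_cst].
    exact: (cvg_comp _ G hz (Gx z tz)).
  have [M HM] : exists M : nat, `|G (hmul z x)| + 1 <= M%:R.
    exists (Num.bound (Normc.normc (G (hmul z x)) + 1)).
    have -> : `|G (hmul z x)| + 1 = (Normc.normc (G (hmul z x)) + 1)%:C.
      by rewrite rmorphD rmorph1.
    rewrite -(rmorph_nat (real_complex R)) lecR ltW //.
    by rewrite archi_boundP // addr_ge0 ?normc_ge0.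
  exists ([set y | `|G (hmul z x) - G (hmul y x)| < 1], [set N | (M <= N)%N]).
    split; last by exists M.
    by move/cvgrPdist_lt: Gz; apply.
  case=> y N [/= yz MN].
  have -> : G (hmul y x) = G (hmul z x) - (G (hmul z x) - G (hmul y x)) by ring.
  rewrite (le_trans (ler_normB _ _)) // (le_trans (lerD (lexx _) (ltW yz))) //.
  by rewrite (le_trans HM) // ler_nat.
by case=> M _ /(_ M (leqnn M)) H; exists M.
Qed.

(** Uniform continuity under small rotations. Angles are measured in full turns, so 2^(-N) is the
    spacing of the 2^N-th roots of unity. *)
Lemma orbit_unif x i : cts_on_orbit x -> forall e : C, 0 < e ->
  \forall N \near \oo, forall z, tor z -> forall t : R, 0 <= t <= (2 ^+ N)^-1 ->
    `|G (hmul (crot i (cexp (twopii R * t%:C))) (hmul z x)) - G (hmul z x)| <=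
      e.
Proof.
move=> Gx e e0; apply: tor_near => z tz.
pose f (p : V * R) : C := G (hmul (crot i (cexp (twopii R * p.2%:C))) (hmul p.1
  x)).
have crot1 : crot i (cexp (twopii R * (0 : R)%:C)) = const_mx 1.
  by rewrite rmorph0 mulr0 cexp0 crot1.
have f0 : f (z, 0) = G (hmul z x) by rewrite /f /= crot1 hmul1.
have fz : f p @[p --> (z, 0 : R)] --> f (z, 0).
  rewrite f0.
  suff hz : hmul (crot i (cexp (twopii R * p.2%:C))) (hmul p.1 x)
      @[p --> (z, 0 : R)] --> hmul z x by exact: (cvg_comp _ G hz (Gx z tz)).
  rewrite -[X in _ --> X]hmul1 -crot1.
  apply: (@cvg_hmul _ (nbhs (z, 0 : R)) _
    (fun p : V * R => crot i (cexp (twopii R * p.2%:C))) (fun p => hmul p.1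
      x)); last first.
    by apply: (@cvg_hmul _ (nbhs (z, 0 : R)) _ fst (fun=> x));
      [exact: cvg_fst|exact: cvg_cst].
  apply: cvg_rV => l; rewrite mxE; under eq_fun do rewrite mxE.
  case: (l == i); last exact: cvg_cst.
  by apply: cvg_cexp; apply: cvgMr; apply: cvg_real_complex; exact: cvg_snd.
have e2 : 0 < e / 2 by rewrite divr_gt0.
move/cvgrPdist_le: fz => /(_ _ e2) [[A B] /= [Az B0] AB].
have {B0} [k Hk] : exists k, forall t : R, 0 <= t <= (2 ^+ k)^-1 -> B t.
  move/nbhs_ballP: B0 => [d /= d0 dB].
  have : (fun k => (2^-1 : R) ^+ k) @ \oo --> (0 : R).
    by apply: cvg_expr; rewrite gtr0_norm ?invr_gt0 // invf_lt1 // ltr1n.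
  move=> /cvgrPdist_lt/(_ _ d0)[k _ /(_ k (leqnn k))].
  rewrite /= sub0r normrN exprVn ger0_norm ?invr_ge0 ?exprn_ge0 // => kd.
  exists k => t /andP[t0 tk]; apply: dB; rewrite /ball /= sub0r normrN.
  by rewrite ger0_norm // (le_lt_trans tk).
exists (A, [set N | (k <= N)%N]); first by split => //; exists k.
case=> y N [/= Ay kN] t /andP[t0 tN].
have By0 : B 0 by apply: Hk; rewrite lexx invr_ge0 exprn_ge0.
have Bt : B t.
  apply: Hk; rewrite t0 (le_trans tN) // lef_pV2 ?posrE ?exprn_gt0 //.
  by rewrite ler_weXn2l // ler1n.
have H1 := AB (y, 0) (conj Ay By0).
have H2 := AB (y, t) (conj Ay Bt).
rewrite /= {2}/f /= crot1 hmul1 in H1.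
rewrite -/(f (y, t)).
have -> : f (y, t) - G (hmul y x) = (f (z, 0) - G (hmul y x)) - (f (z, 0) - f
  (y, t)).
  by ring.
by rewrite (le_trans (ler_normB _ _)) // [leRHS](splitr e) lerD.
Qed.

(** The finer grid splits into arcs of b = 2^(M - N) points, each starting at a coarse point and
    staying within e of its value. The estimate is uniform in M and z. *)
Lemma cmean_refine i N M x (e : C) : (N <= M)%N ->
  (forall z t, tor z -> 0 <= t <= (2 ^+ N.+1)^-1 ->
    `|G (hmul (crot i (cexp (twopii R * t%:C))) (hmul z x)) - G (hmul z x)| <=
      e) ->
  forall z, tor z ->
  `|cmean M i G (hmul z x) - cmean N i G (hmul z x)| <= e.
Proof.
move=> NM H z tz; set y := hmul z x.
pose b := (2 ^ (M - N))%N.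
have b0 : (0 < b)%N by rewrite expn_gt0.
have Eb : (2 ^ M.+1 = 2 ^ N.+1 * b)%N by rewrite -expnD addSn subnKC.
have nz k : (2 ^ k)%:R != 0 :> C by rewrite pnatr_eq0 -lt0n expn_gt0.
have bz : b%:R != 0 :> C by exact: nz.
have zM j l : (zeta R M) ^+ (j * b + l) =
    zeta R N ^+ j * cexp (twopii R * (l%:R / (2 ^ M.+1)%:R)%:C).
  rewrite !uroot_exp -cexpD -mulrDr -rmorphD; congr (cexp (_ * _%:C)).
  rewrite Eb natrD !natrM mulrDl; congr (_ + _).
  by rewrite -mulf_div divff ?mulr1 // pnatr_eq0 -lt0n.
have EM : cmean M i G y = (2 ^ N.+1)%:R^-1 * \sum_(0 <= j < 2 ^ N.+1)
    (b%:R^-1 * \sum_(0 <= l < b) G (hmul (crot i (zeta R M ^+ (j * b + l))) y)).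
  rewrite /cmean Eb natrM invfM -mulrA; congr (_ * _).
  rewrite big_nat_mul mulr_sumr; apply: eq_bigr => j _; congr (_ * _).
  rewrite mulSn addnC -{1}[(j * b)%N]add0n big_addn addKn.
  by apply: eq_bigr => l _; rewrite addnC.
rewrite EM /cmean -mulrBr -sumrB normrM normfV normr_nat mulrC ler_pdivrMr
  ?ltr0n ?expn_gt0 //.
rewrite (le_trans (ler_norm_sum _ _ _)) //.
have -> : e * (2 ^ N.+1)%:R = \sum_(0 <= j < 2 ^ N.+1) e.
  by rewrite sumr_const_nat subn0 mulr_natr.
rewrite ler_sum // => j _.
set w := G _.
have -> : w = b%:R^-1 * \sum_(0 <= l < b) w.
  by rewrite sumr_const_nat subn0 -[w *+ b]mulr_natl mulKf.
rewrite -mulrBr -sumrB normrM normfV normr_nat mulrC ler_pdivrMr ?ltr0n //.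
rewrite (le_trans (ler_norm_sum _ _ _)) //.
have -> : e * b%:R = \sum_(0 <= l < b) e by rewrite sumr_const_nat subn0
  mulr_natr.
rewrite big_nat [leRHS]big_nat ler_sum // => l /andP[_ lb].
have Ey : hmul (crot i (zeta R N ^+ j)) y =
    hmul (hmul (crot i (zeta R N ^+ j)) z) x by rewrite -hmulA.
rewrite zM [X in crot i X]mulrC crotM -hmulA /w Ey.
apply: H => [k|].
  rewrite hmulE normrM tz mulr1 mxE; case: (k == i); last by rewrite normr1.
  by rewrite norm_uroot.
rewrite divr_ge0 //= Eb natrM ler_pdivrMr ?mulr_gt0 ?ltr0n ?expn_gt0 //.
by rewrite mulrA natrX mulVf ?mul1r ?ler_nat 1?ltnW // expf_neq0.
Qed.

Definition circle_inv (i : 'I_r) (c : C) y := forall e : C, 0 < e ->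
  \forall N \near \oo,
    `|cmean N i G (hmul (crot i c) y) - cmean N i G y| <= e.

Lemma tmean_step i c x : cts_on_orbit x -> cts_on_orbit (hmul (crot i c) x) ->
  (forall z, tor z -> circle_inv i c (hmul z x)) -> forall e : C, 0 < e ->
  \forall N \near \oo,
    `|tmean N G (hmul (crot i c) x) - tmean N G x| <= e.
Proof.
move=> Gx Gcx cinv e e0.
have e3 : 0 < e / 3%:R by rewrite divr_gt0.
have S x' : cts_on_orbit x' -> \forall N \near \oo, forall M, (N <= M)%N ->
    forall z, tor z -> `|cmean M i G (hmul z x') - cmean N i G (hmul z x')| <=
      e / 3%:R.
  move=> Gx'; have [K _ HK] := orbit_unif i Gx' e3.
  exists K => // N /= KN M NM; apply: cmean_refine => // z t tz tN.
  by apply: (HK N.+1) => //=; rewrite (leq_trans KN).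
have [K1 _ H1] := S _ Gx; have [K2 _ H2] := S _ Gcx.
exists (maxn K1 K2) => // N /=; rewrite geq_max => /andP[KN1 KN2].
rewrite -(tmean_cmean _ i) -(tmean_cmean _ i G x) tmean_hmul -tmeanB.
apply: norm_tmean => k; have tz := tor_gridpt k.
have [K3 _ H3] := cinv _ tz _ e3.
pose M := maxn N K3.
have h1 := H1 N KN1 M (leq_maxl _ _) _ tz.
have h2 := H2 N KN2 M (leq_maxl _ _) _ tz.
have h3 := H3 M (leq_maxr _ _).
rewrite hmulCA in h2; set a := cmean N i G _; set b := cmean N i G _.
rewrite -/b in h1; rewrite -/a in h2.
set a' := cmean M i G _ in h2; set b' := cmean M i G _ in h1.
rewrite -/a' -/b' in h3.
clearbody a b a' b'.
have -> : a - b = (a' - b') - (a' - a) + (b' - b) by ring.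
apply: (le_trans (ler_normD _ _)).
have E : e = e / 3%:R + e / 3%:R + e / 3%:R by field.
rewrite [leRHS]E; apply: lerD h1; apply: (le_trans (ler_normB _ _)).
exact: lerD.
Qed.

End TorusTopology.

(** * Invariance of torus means *)

Section MeanInvariance.
Variables (R : realType) (r : nat).
Local Notation C := (Cplx R).
Local Notation V := 'rV[C]_r.
Local Open Scope complex_scope.
Local Opaque hmul.

Lemma cvg_sub0_trans (u v : nat -> C) (b : C) :
  (u N - v N @[N --> \oo] --> (0 : C)) -> v N @[N --> \oo] --> b ->
  u N @[N --> \oo] --> b.
Proof.
have -> : u = (fun N => (u N - v N) + v N).
  by apply/funext => N; rewrite subrK.
rewrite (funext (fun N => addrK (v N) (u N - v N))) => uv vb.
by rewrite -[b]add0r; exact: (cvgD uv vb).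
Qed.

Lemma differentiable_circle (i : 'I_r) (y : V) (w : C) :
  differentiable (fun w : C => hmul (crot i (cexp w)) y) w.
Proof.
pose c0 : V := \row_l (if l == i then 0 else y 0 l).
pose v : V := \row_l (if l == i then y 0 i else 0).
have -> : (fun w : C => hmul (crot i (cexp w)) y) = cst c0 + (fun w => cexp w
  *: v).
  apply/funext => u; apply/rowP => l; rewrite hmulE !mxE.
  by case: eqP => [->|_]; rewrite ?add0r // mulr0 addr0 mul1r.
apply: differentiableD; first exact: differentiable_cst.
apply: differentiableZl; apply/derivable1_diffP.
by have [] := is_derive_cexp w.
Qed.

(** [goursat] on the parallelogram spanned by tau and 2 pi i, for H along w -> exp w in coordinate
    i. It is used at level N + 1, since grid N has order 2^(N + 1). *)
Lemma circle_inv_diff (H : V -> C) (i : 'I_r) (tau : C) y :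
  (forall s t : R, 0 <= s <= 1 -> 0 <= t <= 1 -> differentiable H
    (hmul (crot i (cexp (s%:C * tau + t%:C * twopii R))) y)) ->
  circle_inv H i (cexp tau) y.
Proof.
move=> Hd e e0.
pose g (w : C) := H (hmul (crot i (cexp w)) y).
have twopi0 : twopii R != 0.
  by rewrite eq_complex /= eqxx /= mulrn_eq0 /= gt_eqF ?pi_gt0.
have [||p0 Hp] := @goursat R g tau (twopii R) _ _ twopi0 e e0.
- move=> s t s01 t01; exists ('D_1 g (pt tau (twopii R) s t)).
  apply: derivableP; apply/derivable1_diffP.
  apply: (@differentiable_comp _ _ _ _ _ H); first exact: differentiable_circle.
  exact: Hd.
- move=> s _; rewrite /g /pt rmorph0 rmorph1 mul0r mul1r addr0.
  by rewrite cexpD cexp_twopii mulr1.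
exists p0 => // N /= pN; have h := Hp N.+1 (leqW pN).
rewrite /cmean -mulrBr -sumrB normrM normfV normr_nat mulrC natrX.
rewrite ler_pdivrMr ?exprn_gt0 //; apply: le_trans h.
rewrite le_eqVlt; apply/orP; left; apply/eqP; congr `| _ |.
apply: eq_bigr => j _; rewrite /g /pt rmorph1 rmorph0 mul0r mul1r add0r.
have -> : (j%:R / 2 ^+ N.+1)%:C * twopii R =
          twopii R * (j%:R / (2 ^ N.+1)%:R)%:C by rewrite mulrC natrX.
rewrite cexpD -uroot_exp; congr (H _ - _).
rewrite hmulA; congr hmul; apply/rowP => l; rewrite hmulE !mxE mulrC.
by case: eqP; rewrite ?mulr1.
Qed.

Lemma norm_cmean N (i : 'I_r) (G : V -> C) x (e : C) :
  (forall z, tor z -> `|G (hmul z x)| <= e) -> `|cmean N i G x| <= e.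
Proof.
move=> H; rewrite normrM normfV normr_nat mulrC ler_pdivrMr ?ltr0n ?expn_gt0 //.
rewrite (le_trans (ler_norm_sum _ _ _)) //.
have -> : e * (2 ^ N.+1)%:R = \sum_(0 <= j < 2 ^ N.+1) e.
  by rewrite sumr_const_nat subn0 mulr_natr.
apply: ler_sum => j _; apply: H => k; rewrite mxE.
by case: (k == i); rewrite ?normr1 // norm_uroot.
Qed.

Lemma cmeanB N (i : 'I_r) (G H : V -> C) x :
  cmean N i (fun y => G y - H y) x = cmean N i G x - cmean N i H x.
Proof. by rewrite /cmean sumrB mulrBr. Qed.

(** Circle means are bounded by the supremum over the torus, so one sufficiently good approximation
    on both tori suffices. *)
Lemma circle_inv_lim (G : V -> C) (H : nat -> V -> C) i c y :
  (forall e : C, 0 < e -> \forall k \near \oo, forall z, tor z ->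
    `|H k (hmul z y) - G (hmul z y)| <= e) ->
  (forall e : C, 0 < e -> \forall k \near \oo, forall z, tor z ->
    `|H k (hmul z (hmul (crot i c) y)) - G (hmul z (hmul (crot i c) y))| <= e)
      ->
  (forall k, circle_inv (H k) i c y) -> circle_inv G i c y.
Proof.
move=> u1 u2 Hinv e e0.
have e3 : 0 < e / 3%:R by rewrite divr_gt0.
have [k1 _ h1] := u1 _ e3; have [k2 _ h2] := u2 _ e3.
pose k := maxn k1 k2.
have {}h1 := h1 k (leq_maxl _ _); have {}h2 := h2 k (leq_maxr _ _).
apply: filterS (Hinv k _ e3) => N h3.
have l1 : `|cmean N i (H k) y - cmean N i G y| <= e / 3%:R.
  by rewrite -cmeanB; exact: norm_cmean.
have l2 : `|cmean N i (H k) (hmul (crot i c) y) -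
    cmean N i G (hmul (crot i c) y)| <= e / 3%:R.
  by rewrite -cmeanB; exact: norm_cmean.
move: l1 l2 h3.
move: (cmean N i (H k) y) (cmean N i G y) (cmean N i (H k) (hmul (crot i c) y))
  (cmean N i G (hmul (crot i c) y)) => a b a' b' l1 l2 l3.
have -> : b' - b = (a' - a) - (a' - b') + (a - b) by ring.
apply: (le_trans (ler_normD _ _)).
have E : e = e / 3%:R + e / 3%:R + e / 3%:R by field.
rewrite [leRHS]E; apply: lerD l1; apply: (le_trans (ler_normB _ _)).
exact: lerD.
Qed.

(** Only moduli are constrained; in a coordinate where p vanishes the annulus is a disc. *)
Definition polyannulus (p : V) (e : R) : set V :=
  [set y | forall i, `|Normc.normc (y 0 i) - Normc.normc (p 0 i)| < e].

Local Opaque tmean cmean.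

Definition torus_stable (U : set V) := forall z x, tor z -> U x -> U (hmul z x).

Lemma open_polyannulus (U : set V) p : open U -> torus_stable U -> U p ->
  exists2 e, 0 < e & polyannulus p e `<=` U.
Proof.
move=> oU sU Up.
have /nbhs_rVP[e e0 He] : nbhs p U by apply: open_nbhs_nbhs.
exists e => // y Hy.
(* [y'] has the moduli of y and the arguments of p (where p_i = 0 it keeps y_i), so it is close to
   p; the torus element [z] turns it into y. *)
pose y' : V := \row_i (if p 0 i == 0 then y 0 i
                       else p 0 i * (`|y 0 i| / `|p 0 i|)).
pose z : V := \row_i (if (p 0 i == 0) || (y 0 i == 0) then 1
                      else y 0 i / y' 0 i).
have y'E i : y' 0 i = if p 0 i == 0 then y 0 i
                      else p 0 i * (`|y 0 i| / `|p 0 i|) by rewrite mxE.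
have zE i : z 0 i = if (p 0 i == 0) || (y 0 i == 0) then 1
                      else y 0 i / y' 0 i by rewrite mxE.
have ny' i : `|y' 0 i| = `|y 0 i|.
  rewrite y'E; have [//|p0] := eqVneq (p 0 i) 0.
  rewrite normrM normf_div !normr_id mulrC divfK //.
  by rewrite normr_eq0.
have -> : y = hmul z y'.
  apply/rowP => i; rewrite hmulE zE y'E.
  have [p0|p0] := eqVneq (p 0 i) 0; first by rewrite mul1r.
  have [->|yi0] := eqVneq (y 0 i) 0.
    by rewrite mul1r normr0 mul0r mulr0.
  by rewrite divfK // !mulf_neq0 ?invr_eq0 ?normr_eq0.
apply: sU.
  move=> i; rewrite zE; case: ifP => [_|/norP[_ yi0]]; first by rewrite normr1.
  by rewrite normf_div ny' divff // normr_eq0.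
apply: He => i; have := Hy i.
rewrite -ltcR -norm_real rmorphB /= -!normC y'E.
have [->|p0] := eqVneq (p 0 i) 0; first by rewrite normr0 !subr0 normr_id.
apply: le_lt_trans.
have -> : p 0 i * (`|y 0 i| / `|p 0 i|) - p 0 i =
    p 0 i / `|p 0 i| * (`|y 0 i| - `|p 0 i|).
  by rewrite mulrBr mulrAC -mulrA divfK ?normr_eq0 // mulrC -mulrA mulrC mulrA.
by rewrite normrM normf_div normr_id divff ?mul1r // normr_eq0.
Qed.

Lemma reinhardt_torus_stable (Y : set V) : reinhardt Y -> torus_stable Y.
Proof.
move=> RY z x tz Yx.
have H i : exists t : R, z 0 i = Complex (cos t) (sin t).
  have := tz i; case: (z 0 i) => a b; rewrite normC => /complexI ab.
  have [|t _ [-> ->]] := @unit_circle_angle _ a b; last by exists t.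
  rewrite -[LHS]sqr_sqrtr ?addr_ge0 ?sqr_ge0 //.
  by rewrite [Num.sqrt _]ab expr1n.
have [t Ht] := choice H; have := RY t x Yx.
congr (Y _); apply/rowP => i; rewrite mxE hmulE; congr (_ * _).
by rewrite Ht.
Qed.

Definition mean_lim (G : V -> C) x (b : C) := tmean N G x @[N --> \oo] --> b.

(* The property of G through which holomorphy enters: it holds for            *)
(* holomorphic functions, and passes to limits that are uniform on tori.      *)
Definition mean_invariant (U : set V) (G : V -> C) :=
  (forall x, U x -> nonzero x -> {for x, continuous G}) /\
  (forall i tau x, nonzero x ->
    (forall s : R, 0 <= s <= 1 -> U (hmul (crot i (cexp (s%:C * tau))) x)) ->
    circle_inv G i (cexp tau) x).

(** * Propagation of the mean over a connected domain *)

Section Propagation.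
Variables (U : set V) (G : V -> C).
Hypothesis sU : torus_stable U.
Hypothesis Ginv : mean_invariant U G.

Lemma tor_neq0 (z : V) : tor z -> nonzero z.
Proof. by move=> tz i; rewrite -normr_eq0 tz oner_eq0. Qed.

Lemma mean_invariant_cts x : U x -> nonzero x -> cts_on_orbit G x.
Proof.
move=> Ux x0 z tz; apply: Ginv.1; first exact: sU.
by apply: nonzero_hmul => //; exact: tor_neq0.
Qed.

Lemma mean_lim_step i tau x b : nonzero x ->
  (forall s : R, 0 <= s <= 1 -> U (hmul (crot i (cexp (s%:C * tau))) x)) ->
  mean_lim G x b -> mean_lim G (hmul (crot i (cexp tau)) x) b.
Proof.
move=> x0 Ux Gb.
have Ux0 : U x.
  by have := Ux 0; rewrite lexx ler01 mul0r cexp0 crot1 hmul1; apply.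
have Ux1 : U (hmul (crot i (cexp tau)) x).
  by have := Ux 1; rewrite lexx ler01 rmorph1 mul1r; apply.
have c0 := nonzero_crot i (cexp_neq0 tau).
have H : tmean N G (hmul (crot i (cexp tau)) x) - tmean N G x @[N --> \oo] -->
  (0 : C).
  apply/cvgrPdist_le => e e0.
  have inv z : tor z -> circle_inv G i (cexp tau) (hmul z x).
    move=> tz; apply: Ginv.2; first by apply: nonzero_hmul => //;
      exact: tor_neq0.
    by move=> s s01; rewrite hmulCA; apply: sU => //; exact: Ux.
  apply: filterS (tmean_step (mean_invariant_cts Ux0 x0)
    (mean_invariant_cts Ux1 (nonzero_hmul c0 x0)) inv e0) => N.
  by rewrite sub0r normrN.
exact: cvg_sub0_trans H Gb.
Qed.

(** Coordinates are replaced one at a time. Along exp(s tau) the modulus of the moving coordinate is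
    monotone in s, hence stays between its end values and inside the polyannulus. *)
Lemma mean_lim_polyannulus p e x x' b : polyannulus p e `<=` U ->
  polyannulus p e x -> polyannulus p e x' -> nonzero x -> nonzero x' ->
  mean_lim G x b -> mean_lim G x' b.
Proof.
move=> AU Ax Ax' x0 x'0 Gx.
pose X k : V := \row_i (if (i < k)%N then x' 0 i else x 0 i).
have XE k i : X k 0 i = if (i < k)%N then x' 0 i else x 0 i by rewrite mxE.
have X0 k : nonzero (X k) by move=> i; rewrite XE; case: ifP.
suff HX k : (k <= r)%N -> mean_lim G (X k) b.
  have := HX r (leqnn r); congr (mean_lim G _ b); apply/rowP => i.
  by rewrite XE ltn_ord.
elim: k => [_|k IH kr].
  have -> // : X 0%N = x by apply/rowP => i; rewrite XE.
pose i := Ordinal kr.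
have [tau Etau] := @cexp_surj R (x' 0 i / x 0 i) (mulf_neq0 (x'0 i) (invr_neq0
  (x0 i))).
have -> : X k.+1 = hmul (crot i (cexp tau)) (X k).
  apply/rowP => l; rewrite hmulE !XE mxE Etau ltnS leq_eqVlt.
  have [->|li] := eqVneq l i; first by rewrite eqxx ltnn divfK.
  have -> : (l == k :> nat) = false by apply: contra_neqF li => /eqP lk;
    exact/val_inj.
  by rewrite mul1r.
apply: mean_lim_step (IH (ltnW kr)) => // s /andP[s0 s1].
apply: AU => l; rewrite hmulE mxE XE.
have [->|li] := eqVneq l i; last by rewrite mul1r; case: ifP.
rewrite ltnn Normc.normcM normc_cexp.
have nx : Normc.normc (x' 0 i) = expR (complex.Re tau) * Normc.normc (x 0 i).
  by rewrite -normc_cexp Etau -Normc.normcM divfK.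
have -> : complex.Re (s%:C * tau) = s * complex.Re tau.
  by case: (tau) => a c; simpc.
have := Ax i; have := Ax' i; rewrite nx.
set a := Normc.normc (x 0 i); set t := complex.Re tau.
have a0 : 0 <= a by exact: normc_ge0.
rewrite !ltr_norml => /andP[l1 l2] /andP[l3 l4]; apply/andP.
have [t0|t0] := leP 0 t.
- have e1 : a <= expR (s * t) * a.
    by rewrite ler_peMl // -expR0 ler_expR mulr_ge0.
  have e2 : expR (s * t) * a <= expR t * a.
    by rewrite ler_wpM2r // ler_expR ler_piMl.
  by split; lra.
- have e1 : expR (s * t) * a <= a.
    by rewrite ler_piMl // -expR0 ler_expR mulr_ge0_le0 // ltW.
  have e2 : expR t * a <= expR (s * t) * a.
    by rewrite ler_wpM2r // ler_expR; nra.
  by split; lra.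
Qed.

Lemma nbhs_nonzero (x : V) (A : set V) : nbhs x A -> exists2 y, A y & nonzero y.
Proof.
move=> /nbhs_rVP[e e0 H].
exists (\row_i (if x 0 i == 0 then (e / 2)%:C else x 0 i)).
  apply: H => i; rewrite mxE; case: eqP => [->|_].
    by rewrite subr0 norm_real ltcR ger0_norm ?divr_ge0 1?ltW //; lra.
  by rewrite subrr normr0 ltcR.
move=> i; rewrite mxE; case: ifP => [_|/negbT//].
by rewrite fmorph_eq0 gt_eqF // divr_gt0.
Qed.

Lemma normc_sub (a b : C) : `|(Normc.normc a - Normc.normc b)%:C : C| <= `|a -
  b|.
Proof.
by rewrite rmorphB /= -!normC; exact: ler_dist_dist.
Qed.

Lemma nbhs_polyannulus (p : V) e : 0 < e -> nbhs p (polyannulus p e).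
Proof.
move=> e0; apply/nbhs_rVP; exists e => // y H i.
by rewrite -ltcR -norm_real (le_lt_trans _ (H i)) // normc_sub.
Qed.

(** The set [good] is closed in U: a polyannulus around a limit point p contains a point with
    nonzero coordinates at which the mean is known, even if p itself has zero coordinates. *)
Lemma mean_lim_propagate b : open U -> connected U -> U 0 ->
  (exists2 W, nbhs (0 : V) W & forall x, W x -> nonzero x -> mean_lim G x b) ->
  forall x, U x -> nonzero x -> mean_lim G x b.
Proof.
move=> oU cU U0 [W W0 HW].
pose good : set V := [set p | U p /\
  exists2 A, nbhs p A & forall x, A x -> nonzero x -> mean_lim G x b].
suff gU : good = U.
  move=> x Ux x0; have : good x by rewrite gU.
  by move=> [_ [A /nbhs_singleton Ax H]]; exact: H.
apply: cU; first by exists 0; split => //; exists W.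
- exists [set p | exists2 A, nbhs p A & forall x, A x -> nonzero x -> mean_lim
  G x b] => //.
  rewrite openE => p [A Ap HA].
  by apply: filterS (nbhs_interior Ap) => y Ay; exists A.
- exists (closure good); first exact: closed_closure.
  apply/seteqP; split => [p gp|p [Up cp]]; first by split;
    [case: gp|exact: subset_closure].
  split => //.
  have [e e0 AU] := open_polyannulus oU sU Up.
  exists (polyannulus p e); first exact: nbhs_polyannulus.
  have [y [[Uy [B By HB]] Ay]] := cp _ (nbhs_interior (nbhs_polyannulus p e0)).
  have [x [Bx Ax] x0] := nbhs_nonzero (filterI By Ay).
  by move=> x' Ax' x'0; apply: (mean_lim_polyannulus AU Ax) => //; exact: HB.
Qed.

End Propagation.
End MeanInvariance.

(** * Summable families and infinite products *)

Section Majorants.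
Variable R : realType.
Local Notation C := (Cplx R).
Local Open Scope complex_scope.

Definition majorized (T : R ^nat) (u : nat -> C) :=
  forall N M, (N <= M)%N -> `|u M - u N| <= (T M - T N)%:C.

(** The rate t depends on T alone, so one majorant yields uniform convergence of all sequences below
    it, in particular at all points near a given one. *)
Lemma majorized_cvg (T : R ^nat) (B : R) :
  (forall N M, (N <= M)%N -> T N <= T M) -> (forall N, T N <= B) ->
  exists2 t : R ^nat, t @ \oo --> (0 : R) &
    forall u, majorized T u ->
      exists2 l : C, u @ \oo --> l & forall N, `|l - u N| <= (t N)%:C.
Proof.
move=> Tnd TB.
have Tcvg : cvgn T.
  by apply: nondecreasing_is_cvgn => [N M /Tnd//|]; exists B => _ [N _ <-].
have t0 : (fun N => 2 * (limn T - T N)) @ \oo --> (0 : R).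
  rewrite -[X in _ --> X](mulr0 2) -(subrr (limn T)).
  by apply: cvgMr; apply: cvgB => //; exact: cvg_cst.
exists (fun N => 2 * (limn T - T N)) => // u uT.
have real_case (v : R ^nat) :
    (forall N M, (N <= M)%N -> `|v M - v N| <= T M - T N) ->
    exists l, forall N, `|l - v N| <= limn T - T N.
  move=> vT.
  (* v + T is nondecreasing and bounded above; v is then a difference of convergent sequences. *)
  have vTcvg : cvgn (v \+ T).
    apply: nondecreasing_is_cvgn => [N M NM /=|].
      by have := vT _ _ NM; rewrite ler_norml => /andP[]; lra.
    exists (v 0%N + B - T 0%N + B) => _ [N _ <-] /=.
    have := vT _ _ (leq0n N); rewrite ler_norml => /andP[_].
    by have := TB N; lra.
  pose l := limn (v \+ T) - limn T.
  have vl : v @ \oo --> l.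
    have -> : v = (v \+ T) \- T by apply/funext => N; rewrite /= addrK.
    exact: cvgB.
  exists l => N.
  have dl : `|v M - v N| @[M --> \oo] --> `|l - v N|.
    by apply: cvg_norm; apply: cvgB => //; exact: cvg_cst.
  have dr : T M - T N @[M --> \oo] --> limn T - T N.
    by apply: cvgB => //; exact: cvg_cst.
  apply: (ler_cvg_to dl dr); exists N => // M /=; exact: vT.
have ReIm N M : (N <= M)%N ->
    `|complex.Re (u M) - complex.Re (u N)| <= T M - T N /\
    `|complex.Im (u M) - complex.Im (u N)| <= T M - T N.
  move=> NM; have := uT _ _ NM; case: (u M) (u N) => [a b] [c d] H.
  by split; rewrite -lecR (le_trans _ H) //=;
    [exact: ler_Re_norm|exact: ler_Im_norm].
have [lr Hr] := real_case (fun N => complex.Re (u N)) (fun N M NM => (ReIm N M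
  NM).1).
have [li Hi] := real_case (fun N => complex.Im (u N)) (fun N M NM => (ReIm N M
  NM).2).
have H N : `|(Complex lr li : C) - u N| <= (2 * (limn T - T N))%:C.
  move: (Hr N) (Hi N); case: (u N) => a b /= hr hi.
  rewrite (le_trans (ler_norm_ReIm _ _)) // lecR.
  by rewrite mulr_natl mulr2n lerD.
exists (Complex lr li) => //.
apply/cvgrPdist_le => _ /real_of_pos[e e0 ->].
move/cvgrPdist_le: t0 => /(_ _ e0); apply: filterS => N.
rewrite sub0r normrN => h; rewrite (le_trans (H N)) // lecR.
exact: le_trans (ler_norm _) h.
Qed.

Lemma prod1_bound (I : Type) (s : seq I) (P : pred I) (u : I -> C) (m : I -> R)
  :
  (forall i, P i -> `|u i| <= (m i)%:C) ->
  `|\prod_(i <- s | P i) (1 - u i) - 1| <=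
    (\prod_(i <- s | P i) (1 + m i) - 1)%:C.
Proof.
move=> um; elim: s => [|i s IH]; first by rewrite !big_nil !subrr normr0.
rewrite !big_cons; case: ifP => // Pi.
set p := \prod_(i <- s | P i) (1 - u i) in IH *.
set b := \prod_(i <- s | P i) (1 + m i) in IH *.
have -> : (1 - u i) * p - 1 = (1 - u i) * (p - 1) - u i by ring.
have -> : ((1 + m i) * b - 1)%:C = (1 + m i)%:C * (b - 1)%:C + (m i)%:C :> C.
  by rewrite -rmorphM -rmorphD; congr (_%:C); ring.
apply: (le_trans (ler_normB _ _)); rewrite normrM; apply: lerD; last exact: um.
apply: ler_pM => //; apply: (le_trans (ler_normB _ _)).
by rewrite normr1 rmorphD rmorph1 lerD2l um.
Qed.

Lemma prod_norm_bound (I : Type) (s : seq I) (P : pred I) (u : I -> C) (m : I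
  -> R) :
  (forall i, P i -> `|u i| <= (m i)%:C) ->
  `|\prod_(i <- s | P i) (1 - u i)| <= (\prod_(i <- s | P i) (1 + m i))%:C.
Proof.
move=> um; rewrite normr_prod rmorph_prod; apply: ler_prod => i Pi.
rewrite normr_ge0 (le_trans (ler_normB _ _)) //.
by rewrite normr1 rmorphD rmorph1 lerD2l um.
Qed.

End Majorants.

(** * Sums and products over boxes of exponents *)

Section Boxes.
Variable r : nat.
Implicit Types (k : Qplus r).

Definition inbox N k := [forall i, (k i < N)%N].

Definition boxl N : seq (Qplus r) := [seq boxQ k | k : {ffun 'I_r -> 'I_N}].

Lemma boxl_uniq N : uniq (boxl N).
Proof.
rewrite map_inj_uniq ?enum_uniq // => k l /ffunP E; apply/ffunP => i.
by apply: val_inj; have := E i; rewrite !ffunE.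
Qed.

Lemma mem_boxl N k : (k \in boxl N) = inbox N k.
Proof.
apply/mapP/forallP => [[l _ ->] i|H]; first by rewrite ffunE ltn_ord.
exists [ffun i => Ordinal (H i)]; first by rewrite mem_enum.
by apply/ffunP => i; rewrite !ffunE.
Qed.

Lemma inbox_le N M k : (N <= M)%N -> inbox N k -> inbox M k.
Proof. by move=> NM /forallP H; apply/forallP => i;
  exact: leq_trans (H i) NM. Qed.

Lemma big_box (T : Type) (idx : T) (op : Monoid.com_law idx) N (P : pred (Qplus
  r)) F :
  \big[op/idx]_(k : {ffun 'I_r -> 'I_N} | P (boxQ k)) F (boxQ k) =
  \big[op/idx]_(k <- boxl N | P k) F k.
Proof. by rewrite big_map big_enum_cond. Qed.

Lemma boxl_split (T : Type) (idx : T) (op : Monoid.com_law idx) N M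
    (P : pred (Qplus r)) F : (N <= M)%N ->
  \big[op/idx]_(k <- boxl M | P k) F k =
  op (\big[op/idx]_(k <- boxl N | P k) F k)
     (\big[op/idx]_(k <- boxl M | P k && ~~ inbox N k) F k).
Proof.
move=> NM; rewrite (bigID (inbox N)) /=; congr (op _ _).
rewrite -[LHS]big_filter -[RHS]big_filter; apply: perm_big; apply: uniq_perm.
- by rewrite filter_uniq // boxl_uniq.
- by rewrite filter_uniq // boxl_uniq.
move=> k; rewrite !mem_filter !mem_boxl.
case: (P k) => //=; apply/andP/idP => [[]//|kN]; split => //.
exact: inbox_le kN.
Qed.

Lemma inboxP k : exists N, inbox N k.
Proof.
exists (\max_i k i).+1; apply/forallP => i; rewrite ltnS.
exact: (leq_bigmax i).
Qed.

Variable R : realType.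
Local Notation C := (Cplx R).
Local Open Scope complex_scope.

Lemma abs_summable_bound (P : set (Qplus r)) (u : Qplus r -> C) :
  abs_summable P u -> exists B : R, forall N,
    \sum_(k <- boxl N | `[< P k >]) Normc.normc (u k) <= B.
Proof.
rewrite /abs_summable => fin; set E := (esum _ _) in fin.
have E0 : (0 <= E)%E by apply: esum_ge0 => k _; rewrite lee_fin normc_ge0.
have Ef : E \is a fin_num by rewrite ge0_fin_numE.
exists (fine E) => N; rewrite -lee_fin fineK // -big_filter.
apply: esum_ge; exists [set` [seq k <- boxl N | `[< P k >]]].
  split; first exact: finite_seq.
  by move=> k /=; rewrite mem_filter => /andP[/asboolP].
rewrite -fsbig_seq ?filter_uniq ?boxl_uniq // sumEFin.
by [].
Qed.

Lemma box_sum_majorized (T : Qplus r -> R) (u : Qplus r -> C) :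
  (forall k : Qplus r, `|u k| <= (T k)%:C) ->
  majorized (fun N => \sum_(k <- boxl N) T k) (box_sum u).
Proof.
move=> uT N M NM; rewrite /box_sum !(big_box _ _ xpredT u).
rewrite (boxl_split _ xpredT u NM) (boxl_split _ xpredT T NM) /=.
have AK (Z : zmodType) (x y : Z) : x + y - x = y by rewrite addrAC subrr add0r.
rewrite !AK rmorph_sum.
by apply: (le_trans (ler_norm_sum _ _ _)); apply: ler_sum => k _; exact: uT.
Qed.

(** The increment from box N to box M is the product over box N times the new factors' product minus
    1; both are dominated by their analogues with 1 + T. *)
Lemma box_prod_majorized (P : set (Qplus r)) (T : Qplus r -> R) (u : Qplus r ->
  C) :
  (forall k, P k -> `|u k| <= (T k)%:C) ->
  majorized (fun N => \prod_(k <- boxl N | `[< P k >]) (1 + T k))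
    (box_prod P (fun k => 1 - u k)).
Proof.
move=> uT N M NM; rewrite /box_prod.
rewrite !(big_box _ _ (fun k => `[< P k >]) (fun k => 1 - u k)).
rewrite (boxl_split _ _ (fun k => 1 - u k) NM) (boxl_split _ _ (fun k => 1 + T
  k) NM) /=.
set p := \prod_(k <- boxl N | _) (1 - _); set b := \prod_(k <- boxl N | _) (1 +
  _).
rewrite -[X in _ - X]mulr1 -[X in (_ - X)%:C]mulr1 -!mulrBr normrM rmorphM.
apply: ler_pM => //; [apply: prod_norm_bound => k /asboolP Pk|
  apply: prod1_bound => k /andP[/asboolP Pk _]]; exact: uT.
Qed.

Lemma box_prod_bounded (P : set (Qplus r)) (T : Qplus r -> R) B :
  (forall k, P k -> 0 <= T k) ->
  (forall N, \sum_(k <- boxl N | `[< P k >]) T k <= B) ->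
  (forall N M, (N <= M)%N -> \prod_(k <- boxl N | `[< P k >]) (1 + T k)
     <= \prod_(k <- boxl M | `[< P k >]) (1 + T k)) /\
  (forall N, \prod_(k <- boxl N | `[< P k >]) (1 + T k) <= expR B).
Proof.
move=> T0 TB; split=> [N M NM|N].
  rewrite (boxl_split _ _ _ NM) /= ler_peMr //.
    by apply: prodr_ge0 => k /asboolP /T0; lra.
  apply: (big_ind (fun x : R => 1 <= x)) => // [x y x1 y1|k].
    by rewrite (le_trans x1) // ler_peMr // (le_trans ler01).
  by case/andP=> /asboolP /T0; lra.
apply: (@le_trans _ _ (expR (\sum_(k <- boxl N | `[< P k >]) T k)));
  last by rewrite ler_expR.
rewrite expR_sum; apply: ler_prod => k /asboolP /T0 k0.
by rewrite expR_ge1Dx andbT; lra.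
Qed.

Lemma box_sum_le (T : Qplus r -> R) : (forall k, 0 <= T k) ->
  forall N M, (N <= M)%N -> \sum_(k <- boxl N) T k <= \sum_(k <- boxl M) T k.
Proof.
by move=> T0 N M NM; rewrite (boxl_split _ _ _ NM) /= lerDl sumr_ge0.
Qed.

End Boxes.

(** * Power series *)

Section SeriesAndProducts.
Variables (R : realType) (r : nat).
Local Notation C := (Cplx R).
Local Notation V := 'rV[C]_r.
Local Open Scope complex_scope.
Local Opaque hmul tmean cmean.

Lemma differentiable_bigprod (I : Type) (s : seq I) (P : pred I)
    (f : I -> V -> C) (p : V) : (forall i, P i -> differentiable (f i) p) ->
  differentiable (fun y => \prod_(i <- s | P i) f i y) p.
Proof.
move=> H; elim: s => [|i s IH].
  have -> : (fun y => \prod_(i <- [::] | P i) f i y) = cst 1.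
    by apply/funext => y; rewrite big_nil.
  exact: differentiable_cst.
have [Pi|Pi] := boolP (P i).
  have -> : (fun y => \prod_(j <- i :: s | P j) f j y) =
      f i * (fun y => \prod_(j <- s | P j) f j y).
    by apply/funext => y; rewrite big_cons Pi.
  by apply: differentiableM => //; exact: H.
have -> // : (fun y => \prod_(j <- i :: s | P j) f j y) =
    (fun y => \prod_(j <- s | P j) f j y).
by apply/funext => y; rewrite big_cons (negPf Pi).
Qed.

Lemma differentiable_coordX (p : V) i n :
  differentiable (fun y : V => y 0 i ^+ n : C) p.
Proof.
have -> : (fun y : V => y 0 i ^+ n : C) = (fun y => \prod_(0 <= j < n) y 0 i).
  by apply/funext => y; rewrite prodr_const_nat subn0.
by apply: differentiable_bigprod => _ _; exact: differentiable_coord.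
Qed.

Lemma differentiable_xmonom (p : V) k : differentiable (@xmonom R r ^~ k) p.
Proof. by apply: differentiable_bigprod => i _;
  exact: differentiable_coordX. Qed.

Lemma differentiable_zmonom (p : V) m : nonzero p ->
  differentiable (@zmonom R r ^~ m) p.
Proof.
move=> p0; apply: differentiable_bigprod => i _.
case: (m 0 i) => n; first exact: differentiable_coordX.
apply: differentiableV; first exact: differentiable_coordX.
by rewrite expf_neq0.
Qed.

(** The geometric half of Abel's lemma: absolute convergence at p' gives a common majorant on a
    neighbourhood of p. Each p_i is moved outwards along its own argument. *)
Lemma dominating_point (U : set V) p : open U -> U p -> exists2 p', U p' &
  nonzero p' /\ nbhs p [set y : V | forall i, `|y 0 i| < `|p' 0 i|].
Proof.
move=> oU Up.
have /nbhs_rVP[e e0 He] : nbhs p U by apply: open_nbhs_nbhs.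
have e2 : 0 < e / 2 by rewrite divr_gt0.
have e2C : 0 < (e / 2)%:C :> C by rewrite ltcR.
pose u i : C := if p 0 i == 0 then 1 else p 0 i / `|p 0 i|.
pose p' : V := \row_i (p 0 i + (e / 2)%:C * u i).
have p'E i : p' 0 i = p 0 i + (e / 2)%:C * u i by rewrite mxE.
have nu i : `|u i| = 1.
  rewrite /u; case: eqVneq => [_|pi0]; first by rewrite normr1.
  by rewrite normf_div normr_id divff // normr_eq0.
have np' i : `|p' 0 i| = `|p 0 i| + (e / 2)%:C.
  rewrite p'E; have [pi0|pi0] := eqVneq (p 0 i) 0.
    by rewrite pi0 normr0 !add0r normrM nu mulr1 gtr0_norm.
  have -> : p 0 i + (e / 2)%:C * u i = u i * (`|p 0 i| + (e / 2)%:C).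
    rewrite mulrDr [(e / 2)%:C * _]mulrC; congr (_ + _).
    by rewrite /u (negPf pi0) divfK // normr_eq0.
  by rewrite normrM nu mul1r gtr0_norm // ltr_wpDl.
exists p'.
  apply: He => i; rewrite p'E addrAC subrr add0r normrM nu mulr1 gtr0_norm //.
  by rewrite ltcR; lra.
split=> [i|]; first by rewrite -normr_gt0 np' ltr_wpDl.
apply/nbhs_rVP; exists (e / 2) => // y Hy i; rewrite np'.
have -> : y 0 i = p 0 i + (y 0 i - p 0 i) by rewrite addrC subrK.
by rewrite (le_lt_trans (ler_normD _ _)) // ltrD2l.
Qed.

Lemma le_xmonom (y p : V) k : (forall i, `|y 0 i| <= `|p 0 i|) ->
  `|xmonom y k| <= `|xmonom p k|.
Proof.
move=> yp; rewrite !normr_prod; apply: ler_prod => i _.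
by rewrite normr_ge0 !normrX lerXn2r ?nnegrE.
Qed.

Lemma cts_eps (S : V -> C) (p : V) : {for p, continuous S} <->
  forall e : R, 0 < e -> \forall y \near p, `|S p - S y| <= e%:C.
Proof.
split=> [Sp e e0|H A /nbhs_ballP[_ /= /real_of_pos[e e0 ->] eA]].
  have h : S y @[y --> p] --> S p by [].
  by move/cvgrPdist_le: h; apply; rewrite ltcR.
have e2 : 0 < e / 2 by rewrite divr_gt0.
apply: filterS (H _ e2) => y Hy; apply: eA; rewrite /ball /=.
by rewrite (le_lt_trans Hy) // ltcR; lra.
Qed.

Definition locally_unif (f : nat -> V -> C) (S : V -> C) (p : V) :=
  exists2 t : R ^nat, t @ \oo --> (0 : R) &
    \forall y \near p, forall N, `|S y - f N y| <= (t N)%:C.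

Section LocallyUniform.
Variables (f : nat -> V -> C) (S : V -> C) (p : V).
Hypothesis fS : locally_unif f S p.
Hypothesis fc : forall N, {for p, continuous (f N)}.

Lemma locally_unif_cts : {for p, continuous S}.
Proof.
have [t t0 H] := fS; apply/cts_eps => e e0.
have e3 : 0 < e / 3 by rewrite divr_gt0.
have /cvgrPdist_le/(_ _ e3)[N _ /(_ N (leqnn N))] := t0.
rewrite sub0r normrN => tN.
have {}tN : t N <= e / 3 by apply: le_trans tN; exact: ler_norm.
have /cts_eps/(_ _ e3) := @fc N.
have Hp := nbhs_singleton H.
move: H; apply: filterS2 => y Hy fy.
have -> : S p - S y = (S p - f N p) + (f N p - f N y) - (S y - f N y) by ring.
have -> : e%:C = (e / 3)%:C + (e / 3)%:C + (e / 3)%:C :> C.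
  by rewrite -!rmorphD; congr (_%:C); field.
have le3 z : `|S z - f N z| <= (t N)%:C -> `|S z - f N z| <= (e / 3)%:C.
  by move/le_trans; apply; rewrite lecR.
apply: (le_trans (ler_normB _ _)); apply: lerD; last exact: le3.
by apply: (le_trans (ler_normD _ _)); apply: lerD => //; exact: le3.
Qed.

(** Convergence jointly in y and N passes to products and quotients and is the form of input that
    [tor_near] takes. *)
Lemma locally_unif_joint :
  f q.2 q.1 @[q --> filter_prod (nbhs p) \oo] --> S p.
Proof.
have [t t0 H] := fS; apply/cvgrPdist_le => _ /real_of_pos[e e0 ->].
have e2 : 0 < e / 2 by rewrite divr_gt0.
have /cvgrPdist_le/(_ _ e2) tN := t0.
have /cts_eps/(_ _ e2) Sy := locally_unif_cts.
exists ([set y | (forall N, `|S y - f N y| <= (t N)%:C) /\ `|S p - S y| <= (e /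
  2)%:C],
        [set N | `|0 - t N| <= e / 2]).
  by split => //=; exact: filterI.
case=> y N [/= [h1 h2]]; rewrite sub0r normrN => h3.
have -> : S p - f N y = (S p - S y) + (S y - f N y) by ring.
have -> : e%:C = (e / 2)%:C + (e / 2)%:C :> C.
  by rewrite -!rmorphD; congr (_%:C); field.
apply: (le_trans (ler_normD _ _)); apply: lerD => //.
by rewrite (le_trans (h1 N)) // lecR (le_trans _ h3) // ler_norm.
Qed.

End LocallyUniform.

Section PowerSeries.
Variables (U : set V) (a : Qplus r -> C).
Hypotheses (oU : open U) (U0 : U 0).
Hypothesis aU : forall x, U x -> abs_summable setT (fun k => a k * xmonom x k).

Definition psum (x : V) : C := limn (box_sum (fun k => a k * xmonom x k)).

(** Extended by 0 to Z^r, because shifted and reflected exponents may leave Q^+. *)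
Definition acoef (m : 'rV[int]_r) : C :=
  if [forall i, 0 <= m 0 i] then a [ffun i => `|m 0%R i|%N] else 0.

Definition qvec (k : Qplus r) : 'rV[int]_r := \row_i (k i)%:Z.

Lemma qvecE k i : qvec k 0 i = (k i)%:Z.
Proof. by rewrite mxE. Qed.

Lemma acoef_qvec k : acoef (qvec k) = a k.
Proof.
rewrite /acoef ifT; last by apply/forallP => i; rewrite qvecE.
by congr a; apply/ffunP => i; rewrite ffunE qvecE.
Qed.

Lemma acoef_neg (m : 'rV[int]_r) i : m 0 i < 0 -> acoef m = 0.
Proof.
move=> mi; rewrite /acoef ifF //; apply/negbTE/negP => /forallP/(_ i).
by rewrite leNgt mi.
Qed.

Lemma power_series : exists W : set V, [/\ open W, W 0, torus_stable W &
  exists2 t : R ^nat, t @ \oo --> (0 : R) & forall y, W y ->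
    box_sum (fun k => a k * xmonom y k) @ \oo --> psum y /\
    forall N, `|psum y - box_sum (fun k => a k * xmonom y k) N| <= (t N)%:C].
Proof.
have [p Up [p0 W0]] := dominating_point oU U0.
exists [set y : V | forall i, `|y 0 i| < `|p 0 i|]; split.
- rewrite openE => y Wy.
  rewrite /interior /=.
  have H i : nbhs y (fun y' : V => `|y' 0 i| < `|p 0 i|).
    have d0 : 0 < `|p 0 i| - `|y 0 i| by rewrite subr_gt0.
    have h : (y' : V) 0 i @[y' --> y] --> y 0 i by exact: coord_continuous.
    move/cvgrPdist_lt: h => /(_ _ d0); apply: filterS => y' Hy'.
    have -> : y' 0 i = y 0 i - (y 0 i - y' 0 i) by ring.
    by rewrite (le_lt_trans (ler_normB _ _)) // addrC -ltrBrDr.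
  exact: filter_forall H.
- exact: nbhs_singleton W0.
- by move=> z x tz Wx i; rewrite hmulE normrM tz mul1r.
pose T k := Normc.normc (a k * xmonom p k).
have T0 k : 0 <= T k by exact: normc_ge0.
have [B HB] := abs_summable_bound (aU Up).
have HB' N : \sum_(k <- boxl r N) T k <= B.
  by apply: le_trans (HB N); rewrite le_eqVlt; apply/orP; left; apply/eqP;
    apply: eq_bigl => k; apply/esym/asboolP.
have [t t0 H] := @majorized_cvg R _ B (box_sum_le T0) HB'.
exists t => // y Wy.
have [|l ul Hl] := H (box_sum (fun k => a k * xmonom y k)).
  apply: box_sum_majorized => k; rewrite /T -normC !normrM ler_wpM2l //.
  by apply: le_xmonom => i; exact: ltW.
have -> : psum y = l by apply: cvg_lim.
by split.
Qed.

Lemma differentiable_box_sum N (y : V) :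
  differentiable (fun y => box_sum (fun k => a k * xmonom y k) N : C) y.
Proof.
have -> : (fun y => box_sum (fun k => a k * xmonom y k) N) =
    \sum_(k : {ffun 'I_r -> 'I_N}) (fun y : V => a (boxQ k) * xmonom y (boxQ
      k)).
  by apply/funext => x; rewrite fct_sumE.
elim/big_ind: _ => [|f g df dg|k _]; first exact: differentiable_cst.
  exact: differentiableD.
by apply: differentiableM; [exact: differentiable_cst|exact:
  differentiable_xmonom].
Qed.

Lemma zmonom_qvec (y : V) k m : nonzero y ->
  xmonom y k * zmonom y m = zmonom y (qvec k + m).
Proof.
move=> y0; rewrite zmonomD //; congr (_ * _).
by apply: eq_bigr => i _; rewrite qvecE.
Qed.

(** For the series truncated to a box the mean is exactly the coefficient once the grid separates
    the exponents ([tmean_eq0]); the tail adds at most t M times the modulus of x^(-m). *)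
Lemma power_series_mean : exists W : set V, [/\ open W, W 0,
  forall y, W y -> box_sum (fun k => a k * xmonom y k) @ \oo --> psum y,
  forall y, W y -> {for y, continuous psum} &
  forall m x, W x -> nonzero x ->
    mean_lim (fun y => psum y * zmonom y (- m)) x (acoef m)].
Proof.
have [W [oW W0 sW [t t0 H]]] := power_series.
exists W; split => //.
- by move=> y /H[].
- move=> y Wy; apply: (@locally_unif_cts (fun N y => box_sum (fun k => a k *
  xmonom y k) N)).
    exists t => //; have : nbhs y W by apply: open_nbhs_nbhs.
    by apply: filterS => z /H[].
  by move=> N; apply: differentiable_continuous; exact: differentiable_box_sum.
move=> m x Wx x0; apply/cvgrPdist_le => e e0.
pose c := `|zmonom x (- m)|.
have c0 : 0 < c by rewrite normr_gt0 zmonom_neq0.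
(* The box M makes the tail small and also contains m whenever m lies in Q^+. *)
have [M Mm HM] : exists2 M, (forall k, qvec k = m -> inbox M k) & (t M)%:C * c
  <= e.
  have [k0 Hk0] := inboxP [ffun i => `|m 0%R i|%N : nat].
  have /real_of_pos[d d0 Ed] : 0 < e / c by rewrite divr_gt0.
  have /cvgrPdist_le/(_ _ d0)[k1 _ Hk1] := t0.
  exists (maxn k0 k1).
    move=> k Ek; apply: (inbox_le (leq_maxl _ _)).
    suff -> : k = [ffun i => `|m 0%R i|%N] by [].
    by apply/ffunP => i; rewrite ffunE -Ek qvecE.
  rewrite -ler_pdivlMr // Ed lecR.
  have := Hk1 (maxn k0 k1) (leq_maxr _ _); rewrite sub0r normrN.
  exact: le_trans (ler_norm _).
(* From K on, the grid order exceeds every coordinate of k - m for k in box M. *)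
have [K HK] : exists K, forall N, (K <= N)%N -> forall k i, inbox M k ->
    (`|(qvec k - m)%R 0%R i| < 2 ^ N.+1)%N.
  have [b Hb] : exists b, forall i, (`|m 0%R i| <= b)%N.
    by exists (\max_i `|m 0%R i|)%N => i; apply: (leq_bigmax i).
  exists (M + b)%N => N KN k i /forallP/(_ i) kM; have mi := Hb i.
  apply: (@leq_trans N.+1); last exact: ltnW (ltn_expl _ _).
  rewrite !mxE ltnS (leq_trans _ KN) //.
  by move: kM mi; lia.
exists K => // N /HK {}HK.
have -> : acoef m = tmean N (fun y => box_sum (fun k => a k * xmonom y k) M *
  zmonom y (- m)) x.
  rewrite (eq_tmean (H := fun y => \sum_(k <- boxl r M) a k * zmonom y (qvec k
    - m))); last first.
    move=> k; rewrite /box_sum (big_box _ _ xpredT (fun k => a k * xmonom _ k))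
      mulr_suml.
    apply: eq_bigr => l _; rewrite -mulrA zmonom_qvec //.
    by apply: nonzero_hmul => //; exact: nonzero_gridpt.
  rewrite tmean_sum big_seq.
  rewrite (eq_bigr (fun k => a k * (qvec k == m)%:R)); last first.
    move=> k kM; rewrite tmeanZ tmean_eq0 ?subr_eq0 // => i.
    by apply: HK; rewrite -mem_boxl.
  rewrite -big_seq.
  have [[k Ek]|noneg] := pselect (exists k, qvec k = m).
    rewrite -Ek acoef_qvec (bigD1_seq k) ?boxl_uniq //=; last first.
      by rewrite mem_boxl; exact: Mm.
    rewrite eqxx mulr1 big1 ?addr0 // => l lk.
    rewrite (_ : _ == _ = false) ?mulr0 //;
      apply: contra_neqF lk => /eqP/rowP E.
    by apply/ffunP => i; have := E i; rewrite !qvecE => -[].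
  rewrite big1 => [|k _]; last first.
    by rewrite (_ : _ == _ = false) ?mulr0 //; apply/eqP => E; apply: noneg;
      exists k.
  rewrite /acoef; case: ifP => // /forallP m0; case: noneg.
  exists [ffun i => `|m 0%R i|%N]; apply/rowP => i.
  by rewrite qvecE ffunE gez0_abs.
rewrite -tmeanB; apply: norm_tmean => k; set y := hmul _ x.
have Wy : W y by apply: sW => //; exact: tor_gridpt.
rewrite -mulrBl normrM; apply: le_trans HM.
have -> : `|zmonom y (- m)| = c by exact: norm_zmonom_gridpt.
apply: ler_wpM2r; first exact: ltW.
by rewrite distrC; have [_ ->] := H _ Wy.
Qed.

End PowerSeries.

End SeriesAndProducts.

(** * Quotients by products over roots *)

Section RootProducts.
Variables (R : realType) (r : nat) (S : root_datum R r) (n : nat) (q : R).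
Local Notation C := (Cplx R).
Local Notation V := 'rV[C]_r.
Local Open Scope complex_scope.
Local Opaque hmul tmean cmean.

Local Notation rterm := (rterm S n q).
Local Notation rprod := (rprod S n q).
Local Notation rprod_cvg := (rprod_cvg S n q).
Let bprod P N (y : V) : C := box_prod P (fun k => 1 - rterm y k) N.

Lemma bprodE P N y :
  bprod P N y = \prod_(k <- boxl r N | `[< P k >]) (1 - rterm y k).
Proof. exact: (big_box _ _ (fun k => `[< P k >]) (fun k => 1 - rterm y k)). Qed.

Lemma differentiable_bprod P N (y : V) : differentiable (bprod P N) y.
Proof.
apply: differentiable_bigprod => k _; apply: differentiableB.
  exact: differentiable_cst.
apply: differentiableM; first exact: differentiable_cst.
have -> : (fun y : V => xmonom y (boxQ k) ^+ mroot S n (boxQ k)) =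
    (fun y => \prod_(0 <= j < mroot S n (boxQ k)) xmonom y (boxQ k)).
  by apply/funext => x; rewrite prodr_const_nat subn0.
by apply: differentiable_bigprod => _ _; exact: differentiable_xmonom.
Qed.

Lemma le_rterm (y p : V) k : (forall i, `|y 0 i| <= `|p 0 i|) ->
  `|rterm y k| <= `|rterm p k|.
Proof.
move=> yp; rewrite normrM [leRHS]normrM; apply: ler_wpM2l => //.
rewrite normrX [leRHS]normrX; apply: lerXn2r; rewrite ?nnegrE //.
exact: le_xmonom.
Qed.

Section Convergence.
Variables (U : set V) (P : set (Qplus r)).
Hypotheses (oU : open U) (PU : forall x, U x -> rprod_cvg P x).

Lemma rprod_local (p : V) : U p ->
  locally_unif (bprod P) (rprod P) p /\ bprod P N p @[N --> \oo] --> rprod P p.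
Proof.
move=> Up; have [p' Up' [_ W0]] := dominating_point oU Up.
pose T k := Normc.normc (rterm p' k).
have T0 k : P k -> 0 <= T k by move=> _; exact: normc_ge0.
have [B HB] := abs_summable_bound (PU Up').
have [nd bd] := box_prod_bounded T0 HB.
have [t t0 H] := majorized_cvg nd bd.
have Hy (y : V) : (forall i, `|y 0 i| < `|p' 0 i|) ->
    bprod P N y @[N --> \oo] --> rprod P y /\
    forall N, `|rprod P y - bprod P N y| <= (t N)%:C.
  move=> Hy; have [|l ul Hl] := H (fun N => bprod P N y).
    apply: box_prod_majorized => k _; rewrite /T -normC.
    by apply: le_rterm => i; exact: ltW.
  have -> : rprod P y = l by apply: cvg_lim.
  by split.
split; last by have [] := Hy p (nbhs_singleton W0).
by exists t => //; apply: filterS W0 => y /Hy[].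
Qed.

(** Later partial products only gain factors, so a zero of one is a zero of all later ones and of
    the limit. *)
Lemma bprod_neq0 N (p : V) : U p -> rprod P p != 0 -> bprod P N p != 0.
Proof.
move=> Up; apply: contraNneq => b0.
have [_ cv] := rprod_local Up.
suff c0 : bprod P N p @[N --> \oo] --> (0 : C) by rewrite -(cvg_unique _ cv c0).
apply: cvg_near_cst; exists N => // M /= NM.
by rewrite bprodE (boxl_split _ _ _ NM) /= -bprodE b0 mul0r.
Qed.

Lemma rprod_cts (p : V) : U p -> {for p, continuous (rprod P)}.
Proof.
move=> Up; apply: locally_unif_cts (rprod_local Up).1 _ => N.
exact: differentiable_continuous (differentiable_bprod _ _ _).
Qed.

End Convergence.

Section Quotient.
Variables (U : set V) (P : set (Qplus r)) (F : V -> C).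
Hypotheses (oU : open U) (sU : torus_stable U).
Hypothesis PU : forall x, U x -> rprod_cvg P x /\ rprod P x != 0.
Hypothesis FU : holomorphic_on U F.

Let PU1 x (Ux : U x) := (PU Ux).1.

Lemma quotient_cts p : U p -> {for p, continuous (fun y => F y / rprod P y)}.
Proof.
move=> Up; have Fp : F y @[y --> p] --> F p := differentiable_continuous (FU
  Up).
have Pp : rprod P y @[y --> p] --> rprod P p := rprod_cts oU PU1 Up.
exact: (cvgM Fp (cvgV (PU Up).2 Pp)).
Qed.

Let G m y : C := F y / rprod P y * zmonom y m.
Let H m N y : C := F y / bprod P N y * zmonom y m.

Let G_cts m p : U p -> nonzero p -> {for p, continuous (G m)}.
Proof.
move=> Up p0.
have Fp : F y / rprod P y @[y --> p] --> F p / rprod P p := quotient_cts Up.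
have zp : zmonom y m @[y --> p] --> zmonom p m.
  exact: differentiable_continuous (differentiable_zmonom _ p0).
exact: (cvgM Fp zp).
Qed.

Let H_diff m N p : U p -> nonzero p -> differentiable (H m N) p.
Proof.
move=> Up p0; apply: differentiableM; last exact: differentiable_zmonom.
apply: differentiableM; first exact: FU.
apply: differentiableV; first exact: differentiable_bprod.
exact: (bprod_neq0 oU PU1 _ Up (PU Up).2).
Qed.

Let H_joint m p : U p -> nonzero p ->
  H m x.2 x.1 @[x --> filter_prod (nbhs p) \oo] --> G m p.
Proof.
move=> Up p0.
have c1 : fst @ filter_prod (nbhs p) \oo --> p by exact: cvg_fst.
have Fp : F x.1 @[x --> filter_prod (nbhs p) \oo] --> F p.
  exact: (cvg_comp fst F c1 (differentiable_continuous (FU Up))).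
have zp : zmonom x.1 m @[x --> filter_prod (nbhs p) \oo] --> zmonom p m.
  exact: (cvg_comp fst (@zmonom R r ^~ m) c1
    (differentiable_continuous (differentiable_zmonom _ p0))).
have Pp : bprod P x.2 x.1 @[x --> filter_prod (nbhs p) \oo] --> rprod P p.
  apply: locally_unif_joint (rprod_local oU PU1 Up).1 _ => N.
  exact: differentiable_continuous (differentiable_bprod _ _ _).
exact: (cvgM (cvgM Fp (cvgV (PU Up).2 Pp)) zp).
Qed.

Lemma dist_halves (u v w : C) (e : R) : `|u - v| <= (e / 2)%:C ->
  `|u - w| <= (e / 2)%:C -> `|w - v| <= e%:C.
Proof.
move=> uv uw; have -> : w - v = (u - v) - (u - w) by ring.
have -> : e%:C = (e / 2)%:C + (e / 2)%:C :> C.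
  by rewrite -!rmorphD; congr (_%:C); field.
by apply: (le_trans (ler_normB _ _)); apply: lerD.
Qed.

Let H_unif m x : U x -> nonzero x -> forall e : C, 0 < e ->
  \forall N \near \oo, forall z, tor z ->
    `|H m N (hmul z x) - G m (hmul z x)| <= e.
Proof.
move=> Ux x0 _ /real_of_pos[e e0 ->]; apply: tor_near => z tz.
have Uz : U (hmul z x) by exact: sU.
have z0 : nonzero (hmul z x) by apply: nonzero_hmul => //; exact: tor_neq0.
have e2 : 0 < e / 2 by rewrite divr_gt0.
have e2C : 0 < (e / 2)%:C :> C by rewrite ltcR.
have /cvgrPdist_le/(_ _ e2C) [[A B] /= [Az Bo] AB] := @H_joint m _ Uz z0.
have [A' A'z HA'] : exists2 A' : set V, nbhs (hmul z x) A' &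
    forall y, A' y -> `|G m (hmul z x) - G m y| <= (e / 2)%:C.
  have /cts_eps/(_ _ e2) A'z := @G_cts m _ Uz z0.
  by exists [set y | `|G m (hmul z x) - G m y| <= (e / 2)%:C].
have hz : hmul y x @[y --> z] --> hmul z x.
  by apply: (@cvg_hmul _ _ V (nbhs z) _ id (fun=> x));
    [exact: cvg_id|exact: cvg_cst].
exists ([set y | A (hmul y x) /\ A' (hmul y x)], B).
  split; last exact: Bo.
  have h1 : nbhs z (fun y => A (hmul y x)) := hz _ Az.
  have h2 : nbhs z (fun y => A' (hmul y x)) := hz _ A'z.
  exact: filterI h1 h2.
case=> y N [/= [Ay /HA' Gy] BN]; have /= Hy := AB (hmul y x, N) (conj Ay BN).
exact: dist_halves Gy Hy.
Qed.

(** Holomorphy of the infinite product is bypassed: the quotients by finite partial products are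
    holomorphic and converge uniformly on tori. *)
Lemma quotient_mean_invariant m : mean_invariant U (fun y => F y / rprod P y *
  zmonom y m).
Proof.
split=> [x Ux x0|i tau x x0 HU]; first exact: G_cts.
have Ux0 : U x.
  by have := HU 0; rewrite lexx ler01 mul0r cexp0 crot1 hmul1; apply.
have Ux1 : U (hmul (crot i (cexp tau)) x).
  by have := HU 1; rewrite lexx ler01 rmorph1 mul1r; apply.
apply: (@circle_inv_lim _ _ (G m) (H m)) => [||k].
- exact: H_unif.
- by apply: H_unif => //; apply: nonzero_hmul => //;
  exact/nonzero_crot/cexp_neq0.
apply: circle_inv_diff => s t s01 t01; apply: H_diff; last first.
  by apply: nonzero_hmul => //; exact/nonzero_crot/cexp_neq0.
(* The summand t 2 pi i of the exponent is a torus rotation, under which U is stable; the summand s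
   tau stays in U by [HU]. *)
rewrite addrC cexpD crotM.
rewrite -hmulA; apply: sU; last exact: HU.
move=> l; rewrite mxE; case: ifP => _; rewrite ?normr1 // norm_cexp /twopii.
by simpc; rewrite /= expR0.
Qed.

End Quotient.

End RootProducts.

(** * Limits of means and generic identities *)

Section MeanLimits.
Variables (R : realType) (r : nat).
Local Notation C := (Cplx R).
Local Notation V := 'rV[C]_r.
Local Open Scope complex_scope.
Local Opaque hmul tmean.
Implicit Types (G H : V -> C) (x : V).

Lemma eq_mean_lim G H x b : (forall N, tmean N G x = tmean N H x) ->
  mean_lim G x b -> mean_lim H x b.
Proof. by rewrite /mean_lim => /funext ->. Qed.

Lemma mean_limB G H x b c : mean_lim G x b -> mean_lim H x c ->
  mean_lim (fun y => G y - H y) x (b - c).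
Proof.
by move=> Gb Hc; rewrite /mean_lim (funext (fun N => tmeanB N G H x));
  exact: (cvgB Gb Hc).
Qed.

Lemma mean_limD G H x b c : mean_lim G x b -> mean_lim H x c ->
  mean_lim (fun y => G y + H y) x (b + c).
Proof.
by move=> Gb Hc; rewrite /mean_lim (funext (fun N => tmeanD N G H x));
  exact: (cvgD Gb Hc).
Qed.

Lemma mean_limZ (k : C) G x b : mean_lim G x b ->
  mean_lim (fun y => k * G y) x (k * b).
Proof.
by move=> Gb; rewrite /mean_lim (funext (fun N => tmeanZ N k G x));
  apply: cvgMr; exact: Gb.
Qed.

Lemma mean_lim_sum (I : eqType) (s : seq I) (G : I -> V -> C) x (b : I -> C) :
  (forall i, i \in s -> mean_lim (G i) x (b i)) ->
  mean_lim (fun y => \sum_(i <- s) G i y) x (\sum_(i <- s) b i).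
Proof.
move=> H; elim: s H => [|i s IH] H.
  rewrite big_nil; apply: (@eq_mean_lim (fun y => 0 * 0)).
    by move=> N; apply: eq_tmean => k; rewrite big_nil mul0r.
  rewrite /mean_lim (funext (fun N => tmeanZ N 0 (fun=> 0) x)).
  under eq_fun do rewrite mul0r.
  exact: cvg_cst.
rewrite big_cons.
have Hs k : k \in s -> mean_lim (G k) x (b k).
  by move=> ks; apply: H; rewrite inE ks orbT.
apply: eq_mean_lim (mean_limD (H i (mem_head i s)) (IH Hs)) => N.
by apply: eq_tmean => k; rewrite big_cons.
Qed.

Lemma mean_lim_unique G x b c : mean_lim G x b -> mean_lim G x c -> b = c.
Proof. by move=> Gb Gc; exact: (cvg_unique _ Gb Gc). Qed.

Lemma zmonom_deltaZ (x : V) (i : 'I_r) (e : int) :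
  zmonom x (e *: delta_mx 0 i) = x 0 i ^ e.
Proof.
rewrite /zmonom (bigD1 i) //= !mxE !eqxx mulr1 big1 ?mulr1 // => k ki.
by rewrite !mxE eqxx (negPf ki) mulr0 expr0z.
Qed.

End MeanLimits.

(** * Generic identities and continuity *)

Section Generic.
Variables (R : realType) (r : nat).
Local Notation C := (Cplx R).
Local Notation V := 'rV[C]_r.
Local Open Scope complex_scope.
Local Opaque hmul sigma_act eps_act.

Definition cts_at (f : V -> C) (x : V) := {for x, continuous f}.

Lemma cts_atM f g x : cts_at f x -> cts_at g x -> cts_at (fun y => f y * g y) x.
Proof. by move=> fx gx; exact: (cvgM fx gx). Qed.

Lemma cts_atB f g x : cts_at f x -> cts_at g x -> cts_at (fun y => f y - g y) x.
Proof. by move=> fx gx; exact: (cvgB fx gx). Qed.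

Lemma cts_at_cst (c : C) x : cts_at (fun=> c) x.
Proof. exact: differentiable_continuous (differentiable_cst c x). Qed.

Lemma cts_at_sum (I : eqType) (s : seq I) (f : I -> V -> C) x :
  (forall i, i \in s -> cts_at (f i) x) -> cts_at (fun y => \sum_(i <- s) f i
    y) x.
Proof.
move=> H; elim: s H => [|i s IH] H.
  have -> : (fun y => \sum_(i <- [::]) f i y) = (fun=> 0).
    by apply/funext => y; rewrite big_nil.
  exact: cts_at_cst.
have -> : (fun y => \sum_(j <- i :: s) f j y) =
    (fun y => f i y + \sum_(j <- s) f j y).
  by apply/funext => y; rewrite big_cons.
have Hs k : k \in s -> cts_at (f k) x by move=> ks; apply: H;
  rewrite inE ks orbT.
exact: (cvgD (H i (mem_head i s)) (IH Hs)).
Qed.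

Lemma cts_at_comp (f : V -> C) (g : V -> V) x :
  {for x, continuous g} -> cts_at f (g x) -> cts_at (fun y => f (g y)) x.
Proof. by move=> gx fx; exact: (cvg_comp g f gx fx). Qed.

Lemma cts_at_coordX i n (x : V) : cts_at (fun y : V => y 0 i ^+ n) x.
Proof. exact: differentiable_continuous (differentiable_coordX _ _ _). Qed.

Lemma cts_at_coordV i n (x : V) : x 0 i != 0 -> cts_at (fun y : V => y 0 i ^-
  n) x.
Proof.
move=> xi; have h : (y : V) 0 i ^+ n @[y --> x] --> x 0 i ^+ n :=
  @cts_at_coordX i n x.
have xn : x 0 i ^+ n != 0 by rewrite expf_neq0.
exact: (cvgV xn h).
Qed.

Lemma cts_at_coordZ i (n : int) (x : V) : x 0 i != 0 -> cts_at (fun y : V => y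
  0 i ^ n) x.
Proof. by case: n => n xi; [exact: cts_at_coordX|exact: cts_at_coordV]. Qed.

(** Applied to the difference of two continuous sides, this turns a generic identity into one that
    holds everywhere. *)
Lemma cts_zero (E : V -> C) x : cts_at E x ->
  (forall A, nbhs x A -> exists2 y, A y & E y = 0) -> E x = 0.
Proof.
move=> Ex H; apply/eqP; apply: contrapT => /negP Ex0.
have /real_of_pos[d d0 Ed] : 0 < `|E x| by rewrite normr_gt0.
have d2 : 0 < d / 2 by rewrite divr_gt0.
have /cts_eps/(_ _ d2)/H[y] := Ex.
by move=> h Ey; move: h; rewrite Ey subr0 Ed lecR; lra.
Qed.

Lemma nbhs_sub (x : V) (A B : set V) : nbhs x A -> A `<=` B -> nbhs x B.
Proof. by move=> Ax AB; exact: filterS AB Ax. Qed.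

Lemma nbhsI (x : V) (A B : set V) : nbhs x A -> nbhs x B -> nbhs x (A `&` B).
Proof. by move=> Ax Bx; exact: filterI Ax Bx. Qed.

Lemma cts_nbhs (f : V -> V) x (A : set V) : {for x, continuous f} ->
  nbhs (f x) A -> nbhs x [set y | A (f y)].
Proof. by move=> fx /fx. Qed.

(** The conclusion is a neighbourhood and not a single point, so that further generic conditions can
    be imposed inside it. *)
Lemma generic_near (U : set V) (P : V -> Prop) x A : generically U P -> U x ->
  nbhs x A -> exists y : V, nbhs y [set z | [/\ A z, U z & P z]].
Proof.
move=> [W [oW WU UW WP]] Ux Ax.
have [y [Wy Ay]] := UW x Ux _ (nbhs_interior Ax).
exists y; have Wn : nbhs y W by apply: open_nbhs_nbhs.
apply: nbhs_sub (filterI Wn Ay) _ => z [Wz Az].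
by split => //; [exact: WU|exact: WP].
Qed.

Variables (S : root_datum R r) (j : 'I_r).

Lemma sigma_cts (x : V) : x 0 j != 0 -> {for x, continuous (sigma_act S j)}.
Proof.
move=> xj; suff h : sigma_act S j y @[y --> x] --> sigma_act S j x by exact: h.
apply: (@cvg_rV R r V (nbhs x) _ (sigma_act S j) (sigma_act S j x)) => k.
have E : (fun y : V => sigma_act S j y 0 k) =
    (fun y : V => y 0 k * y 0 j ^ (- cmat S j k)).
  by apply/funext => y; exact: sigma_actE.
suff H v : v = x 0 k * x 0 j ^ (- cmat S j k) ->
    sigma_act S j y 0 k @[y --> x] --> v by exact: H (sigma_actE S j x k).
move=> ->; rewrite E.
have hk : (y : V) 0 k @[y --> x] --> x 0 k by exact: coord_continuous.
exact: (cvgM hk (@cts_at_coordZ j (- cmat S j k) x xj)).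
Qed.

Lemma eps_actE (eta : C) (x : V) k : eps_act S j eta x 0 k = eta ^ cmat S j k *
  x 0 k.
Proof. by rewrite eps_act_hmul hmulE mxE. Qed.

Lemma eps_cts (eta : C) (x : V) : {for x, continuous (eps_act S j eta)}.
Proof.
suff h : eps_act S j eta y @[y --> x] --> eps_act S j eta x by exact: h.
under eq_fun do rewrite eps_act_hmul.
rewrite eps_act_hmul; apply: (@cvg_hmul _ _ V (nbhs x) _ (fun=> _) id).
  exact: cvg_cst.
exact: cvg_id.
Qed.

Lemma eps_act_coord (eta : C) (x : V) : eps_act S j eta x 0 j = eta ^+ 2 * x 0
  j.
Proof. by rewrite eps_act_hmul hmulE mxE cmat_diag. Qed.

Lemma eps_actK (eta : C) x : eta != 0 -> eps_act S j eta (eps_act S j eta^-1 x)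
  = x.
Proof.
move=> e0; apply/rowP => k; apply: (etrans (eps_actE _ _ _)).
apply: (etrans (congr1 (fun c => _ * c) (eps_actE eta^-1 x k))).
by rewrite mulrA -expfzMl divff // exp1rz mul1r.
Qed.

Lemma sigma_act_coord (x : V) : x 0 j != 0 -> sigma_act S j x 0 j = (x 0 j)^-1.
Proof.
move=> xj; rewrite sigma_actE cmat_diag -{1}[x 0 j]expr1z -expfzDr //.
Qed.

Lemma tor_eps m (eta : C) : (0 < m)%N -> eta ^+ m = 1 ->
  tor (\row_k eta ^ cmat S j k : V).
Proof.
move=> m0 em k; rewrite mxE.
have ne : `|eta| = 1.
  by apply/eqP; rewrite -(@pexpr_eq1 _ _ m) // -normrX em normr1.
by case: (cmat S j k) => i; rewrite /exprz ?normfV normrX ne expr1n ?invr1.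
Qed.

End Generic.

(** * Relations between the coefficients *)

Section CGRelations.
Variables (R : realType) (r : nat) (S : root_datum R r) (n : nat) (q : R).
Variables (g : int -> Cplx R) (l : 'I_r -> nat).
Local Notation C := (Cplx R).
Local Notation V := 'rV[C]_r.
Local Open Scope complex_scope.
Local Opaque hmul tmean cmean sigma_act eps_act.

Hypotheses (hn : (2 <= n)%N) (hq : 1 < q).

Variables (Y : set V) (Z : V -> C) (a : Qplus r -> C).
Hypothesis hZ : CG_function S n q g l Y Z a.

Variable j : 'I_r.
Let m := msimple S n j.
Let P := Phi_re_pos S `\ qsimple j.

Lemma msimple_gt0 : (0 < m)%N.
Proof.
rewrite /m /msimple /mroot divn_gt0 ?gcdn_gt0 ?(ltn_trans _ hn) //.
by rewrite dvdn_leq ?dvdn_gcdl // (ltn_trans _ hn).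
Qed.

Lemma xmonom_qsimple (x : V) : xmonom x (qsimple j) = x 0 j.
Proof.
rewrite /xmonom (bigD1 j) //= ffunE eqxx expr1 big1 ?mulr1 // => i ij.
by rewrite ffunE (negPf ij) expr0.
Qed.

Lemma rterm_qsimple (x : V) : rterm S n q x (qsimple j) = q%:C * x 0 j ^+ m.
Proof. by rewrite /rterm xmonom_qsimple. Qed.

Lemma Phi_qsimple : Phi_re_pos S (qsimple j).
Proof.
exists id, j; split; first exact: weyl_id.
rewrite /of_Qplus (bigD1 j) //= ffunE eqxx mulr1n big1 ?addr0 // => i ij.
by rewrite ffunE (negPf ij) mulr0n.
Qed.

Section Domain.
Variables (Yj : set V) (F : V -> C).
Hypothesis YjY : Yj `<=` Y.
Hypotheses (oYj : open Yj) (cYj : connected Yj) (rYj : reinhardt Yj) (Yj0 : Yj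
  0).
Hypothesis PYj : forall x, Yj x -> rprod_cvg S n q P x /\ rprod S n q P x != 0.
Hypothesis sYj : sigma_stable S j Yj.
Hypothesis FY : holomorphic_on Y F.
Hypothesis DZF : generically Y (fun x => Dprod S n q x * Z x = F x).

Let FYj : holomorphic_on Yj F.
Proof. by move=> x /YjY; exact: FY. Qed.

Let tYj : torus_stable Yj := reinhardt_torus_stable rYj.

Let Fj (x : V) : C := F x / rprod S n q P x.

Let Fj_cts x : Yj x -> cts_at Fj x.
Proof. exact: (quotient_cts oYj PYj FYj). Qed.

Lemma Dprod_split x : Yj x -> Dprod S n q x = (1 - q%:C * x 0 j ^+ m) * rprod S
  n q P x.
Proof.
move=> Yx; have [PYj1 _] := rprod_local oYj (fun x Yx => (PYj Yx).1) Yx.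
have [_ cP] := rprod_local oYj (fun x Yx => (PYj Yx).1) Yx.
suff cD : (box_prod (Phi_re_pos S) (fun k => 1 - rterm S n q x k) N : C) @[N
  --> \oo] -->
    ((1 - q%:C * x 0 j ^+ m) * rprod S n q P x : C) by apply: cvg_lim cD.
have [K HK] := inboxP (qsimple j).
have c1 : ((1 - q%:C * x 0 j ^+ m) *
    box_prod P (fun k => 1 - rterm S n q x k) N : C) @[N --> \oo] -->
    ((1 - q%:C * x 0 j ^+ m) * rprod S n q P x : C).
  by apply: cvgMr; exact: cP.
apply: cvg_trans c1; apply: near_eq_cvg; exists K => // N /= KN.
rewrite /box_prod !(big_box _ _ (fun k => `[< _ k >]) (fun k => 1 - rterm S n q
  x k)).
rewrite -[RHS]big_filter (bigD1_seq (qsimple j)) ?filter_uniq ?boxl_uniq //=;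
  last first.
  rewrite mem_filter mem_boxl (inbox_le KN HK) andbT.
  by apply/asboolP; exact: Phi_qsimple.
rewrite rterm_qsimple; congr (_ * _); rewrite big_filter_cond;
  apply: eq_bigl => k.
apply/asboolP/andP => [[Pk kj]|[/asboolP Pk kj]]; split => //.
- exact/asboolP.
- by apply/eqP => E; apply: kj.
by move=> /= E; rewrite E eqxx in kj.
Qed.

Lemma Z_eq x : Yj x -> Dprod S n q x * Z x = F x ->
  (1 - q%:C * x 0 j ^+ m) * Z x = Fj x.
Proof.
move=> Yx; rewrite Dprod_split // /Fj => <-.
have [_ P0] := PYj Yx.
by rewrite [_ * rprod _ _ _ _ _ * _]mulrAC mulfK.
Qed.


Definition bcoef (k : 'rV[int]_r) : C :=
  acoef a k - q%:C * acoef a (k - m%:Z *: delta_mx 0 j).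

Let m0 : (0 < m)%N := msimple_gt0.

(** F_j and (1 - q x_j^m) times the power series are continuous and agree wherever both generic
    identities hold, hence near 0; the second term of the factor shifts exponents by m alpha_j. *)
Lemma Fj_near0 : exists2 W : set V, nbhs (0 : V) W &
  forall x, W x -> nonzero x -> forall k : 'rV[int]_r,
    mean_lim (fun y => Fj y * zmonom y (- k)) x (bcoef k).
Proof.
have [U [oU U0 aU UZ]] := CGf_taylor hZ.
have [W1 [oW1 W10 cvW1 ctsW1 meanW1]] := power_series_mean oU U0 aU.
have oW : open (W1 `&` Yj `&` U) by exact: openI (openI oW1 oYj) oU.
have n0 : nbhs (0 : V) (W1 `&` Yj `&` U).
  exact: open_nbhs_nbhs (conj oW (conj (conj W10 Yj0) U0)).
have /nbhs_rVP[e e0 He] := n0.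
have HW (x : V) : (forall i, `|x 0 i| < e%:C) -> (W1 `&` Yj `&` U) x.
  by move=> Hx; apply: He => i; rewrite mxE subr0.
have eqF (x : V) : (W1 `&` Yj `&` U) x -> Fj x = (1 - q%:C * x 0 j ^+ m) * psum
  a x.
  move=> Wx; have [[W1x Yx] Ux] := Wx; apply/eqP; rewrite -subr_eq0; apply/eqP.
  apply: (@cts_zero _ _ (fun y => Fj y - (1 - q%:C * y 0 j ^+ m) * psum a y)).
    apply: cts_atB; first exact: Fj_cts.
    apply: cts_atM; last exact: ctsW1.
    apply: cts_atB; first exact: cts_at_cst.
    by apply: cts_atM; [exact: cts_at_cst|exact: cts_at_coordX].
  move=> A Ax.
  have A1 : nbhs x (A `&` (W1 `&` Yj `&` U)).
    exact: nbhsI Ax (open_nbhs_nbhs (conj oW Wx)).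
  have [y Hy] := generic_near DZF (YjY Yx) A1.
  have [[_ [_ Uy]] _ _] := nbhs_singleton Hy.
  have [z Hz] := generic_near UZ Uy Hy.
  have [[[Az [[W1z Yz] Uz]] _ DZz] _ Zz] := nbhs_singleton Hz.
  exists z => //; rewrite -(Z_eq Yz DZz).
  by rewrite (cvg_unique _ Zz (cvW1 _ W1z)) // subrr.
exists [set x : V | forall i, `|x 0 i| < e%:C].
  by apply/nbhs_rVP; exists e => // y Hy i; have := Hy i; rewrite mxE subr0.
move=> x Hx x0 k; have [[W1x _] _] := HW x Hx.
have h := mean_limB (meanW1 k x W1x x0)
  (mean_limZ (k := q%:C) (meanW1 (k - m%:Z *: delta_mx 0 j) x W1x x0)).
suff E N : tmean N (fun y => psum a y * zmonom y (- k) - q%:C *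
    (psum a y * zmonom y (- (k - m%:Z *: delta_mx 0 j)))) x =
    tmean N (fun y => Fj y * zmonom y (- k)) x by exact: (eq_mean_lim E h).
apply: eq_tmean => t; set y := hmul _ x.
have y0 : nonzero y by apply: nonzero_hmul => //; exact: nonzero_gridpt.
rewrite eqF; last first.
  by apply: HW => i; rewrite hmulE normrM norm_gridpt mul1r.
have -> : - (k - m%:Z *: delta_mx 0 j) = - k + m%:Z *: delta_mx 0 j.
  by rewrite opprB addrC.
rewrite (zmonomD _ _ y0) zmonom_deltaZ -exprnP.
move: (psum a y) (zmonom y (- k)) (y 0 j ^+ m) => s z w; ring.
Qed.

Lemma mean_Fj x : Yj x -> nonzero x -> forall k : 'rV[int]_r,
  mean_lim (fun y => Fj y * zmonom y (- k)) x (bcoef k).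
Proof.
move=> Yx x0 k; have [W W0 HW] := Fj_near0.
apply: (mean_lim_propagate tYj (quotient_mean_invariant oYj tYj PYj FYj (- k))
  oYj cYj Yj0) => //.
by exists W => // y Wy y0; exact: HW.
Qed.

Let mu : seq C := finmap.enum_fset (fset_set (@unity_roots R m)).

Let in_mu (eta : C) : eta \in mu -> eta ^+ m = 1.
Proof. by rewrite in_fset_set ?inE //; exact: finite_mu. Qed.

Let mu_neq0 (eta : C) : eta \in mu -> eta != 0.
Proof.
move=> /in_mu; apply: contra_eq_neq => ->.
by rewrite expr0n (gtn_eqF m0) eq_sym oner_eq0.
Qed.

Let kern s (y : V) : C :=
  y 0 j ^- s * (1 - q%:C) - (y 0 j ^- m - 1) * g (qint S (qsimple j) * s%:Z).

(** The slash action without its denominator 1 - q x_j^m, see [CG_actE]. *)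
Let rhs (G : V -> C) (y : V) : C := y 0 j ^+ (l j).+1 *
  \sum_(0 <= s < m) (m%:R^-1 * \sum_(eta <- mu)
    eta ^ (s%:Z - (l j)%:Z - 1) * G (eps_act S j eta (sigma_act S j y))) * kern
      s y.

Let CG_actE (G : V -> C) y : CG_act S n q g l j G y =
  (1 - q%:C * y 0 j ^+ m)^-1 * rhs G y.
Proof.
rewrite /CG_act /rhs -/m mulrA [_^-1 * _]mulrC; congr (_ * _).
apply: eq_bigr => s _; congr (_ * _); rewrite /fpart -/m; congr (_ * _).
by rewrite fsbig_finite //; exact: finite_mu.
Qed.

Let good (y : V) := [/\ Yj y, y 0 j != 0 & `|q%:C * y 0 j ^+ m| < 1].

Let good_neq1 (y : V) : good y -> (1 - q%:C * y 0 j ^+ m != 0) /\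
  (1 - q%:C * y 0 j ^- m != 0).
Proof.
move=> [Yy yj yq]; have q0 : 0 < q%:C :> C by rewrite ltcR (lt_trans _ hq).
split; rewrite subr_eq0; apply: contraTneq yq.
  by move=> <-; rewrite normr1 ltxx.
move=> E; have -> : q%:C * y 0 j ^+ m = q%:C ^+ 2.
  have -> : y 0 j ^+ m = q%:C.
    by rewrite -[LHS]mul1r E divfK // expf_neq0.
  by rewrite expr2.
rewrite normrX gtr0_norm // le_gtF // exprn_ege1 //.
by rewrite -(rmorph1 (real_complex R)) lecR ltW.
Qed.

Let eps_coordX (y : V) eta : eta \in mu -> y 0 j != 0 ->
  eps_act S j eta (sigma_act S j y) 0 j ^+ m = y 0 j ^- m.
Proof.
move=> /in_mu e1 yj; rewrite eps_act_coord sigma_act_coord //.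
by rewrite exprMn exprAC e1 expr1n mul1r exprVn.
Qed.

Let Yj_eps (y : V) eta : eta \in mu -> Yj y -> y 0 j != 0 ->
  Yj (eps_act S j eta (sigma_act S j y)).
Proof.
move=> emu Yy yj; rewrite eps_act_hmul; apply: tYj; last exact: sYj.
exact: tor_eps (in_mu emu).
Qed.

(** At every point eps_eta sigma_j y the m-th power of the j-th coordinate is y_j^(-m). The factor 1
    - q y_j^(-m) is thus common to all terms and turns each value of Z into one of F_j. *)
Let functional_at (y : V) : good y -> CG_act S n q g l j Z y = Z y ->
  (1 - q%:C * y 0 j ^+ m) * Z y = Fj y ->
  (forall eta, eta \in mu -> let w := eps_act S j eta (sigma_act S j y) in
     (1 - q%:C * w 0 j ^+ m) * Z w = Fj w) ->
  (1 - q%:C * y 0 j ^- m) * Fj y = rhs Fj y.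
Proof.
move=> gy; have [n1 n2] := good_neq1 gy; have [Yy yj _] := gy.
rewrite CG_actE => ZE FE wE.
have -> : Fj y = rhs Z y by rewrite -FE -ZE mulrA divff // mul1r.
rewrite /rhs mulrCA; congr (_ * _); rewrite mulr_sumr; apply: eq_bigr => s _.
rewrite mulrA; congr (_ * _); rewrite mulrCA; congr (_ * _).
rewrite mulr_sumr big_seq [RHS]big_seq; apply: eq_bigr => eta emu.
by rewrite mulrCA -(wE _ emu) /= eps_coordX.
Qed.

Let zgood (y : V) := Yj y /\ (1 - q%:C * y 0 j ^+ m) * Z y = Fj y.

Let dense_Z (y : V) A : Yj y -> nbhs y A -> exists y' : V, nbhs y' (A `&`
  zgood).
Proof.
move=> Yy Ay; have Ay' : nbhs y (A `&` Yj).
  exact: nbhsI Ay (open_nbhs_nbhs (conj oYj Yy)).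
have [z Hz] := generic_near DZF (YjY Yy) Ay'; exists z.
by apply: nbhs_sub Hz _ => w [[Aw Yw] _ /(Z_eq Yw)].
Qed.

Let nj (w : V) : w 0 j != 0 -> nbhs w [set w : V | w 0 j != 0].
Proof.
move=> wj; have h : (y : V) 0 j @[y --> w] --> w 0 j by exact: coord_continuous.
exact: cvgr_neq0 h wj.
Qed.

(** Induction over the roots of unity: [phi] is a homeomorphism where y_j is nonzero, with inverse
    [psi], so density of [zgood] pulls back along it. Each root shrinks the neighbourhood found for
    the others. *)
Let dense_eps (s : seq C) (y : V) A : (forall eta, eta \in s -> eta \in mu) ->
  nbhs y (A `&` [set y : V | Yj y /\ y 0 j != 0]) ->
  exists y' : V, nbhs y' (A `&` [set y : V | [/\ Yj y, y 0 j != 0 &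
    forall eta, eta \in s -> zgood (eps_act S j eta (sigma_act S j y))]]).
Proof.
elim: s y A => [|eta s IH] y A smu Ay.
  by exists y; apply: nbhs_sub Ay _ => z [Az [Yz zj]]; split.
have smu' e : e \in s -> e \in mu by move=> es; apply: smu; rewrite inE es orbT.
have [y1 Hy1] := IH y A smu' Ay.
have emu : eta \in mu by apply: smu; rewrite mem_head.
have e0 := mu_neq0 emu; have ei0 : eta^-1 != 0 by rewrite invr_eq0.
have [_ [Yy1 y1j _]] := nbhs_singleton Hy1.
have [B {}Hy1 HB] : exists2 B : set V, nbhs y1 B & forall z, B z ->
    [/\ A z, Yj z & forall e, e \in s -> zgood (eps_act S j e (sigma_act S j
      z))].
  eexists; first exact: Hy1.
  by move=> z [Az [Yz _ Hz]].
pose phi w : V := eps_act S j eta (sigma_act S j w).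
pose psi w : V := sigma_act S j (eps_act S j eta^-1 w).
have phi_j w : (w : V) 0 j != 0 -> phi w 0 j != 0.
  by move=> wj; rewrite eps_act_coord sigma_act_coord // mulf_neq0 ?invr_eq0
    ?expf_neq0.
have eps_j w : (w : V) 0 j != 0 -> eps_act S j eta^-1 w 0 j != 0.
  by move=> wj; rewrite eps_act_coord mulf_neq0 ?expf_neq0.
have phiK (w : V) : w 0 j != 0 -> psi (phi w) = w.
  move=> wj; have := eps_actK S j (sigma_act S j w) ei0.
  by rewrite invrK /psi /phi => ->; exact: sigma_actK.
have psiK (w : V) : w 0 j != 0 -> phi (psi w) = w.
  by move=> wj; rewrite /psi /phi sigma_actK ?eps_j // eps_actK.
have psi_cts (w : V) : w 0 j != 0 -> {for w, continuous psi}.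
  move=> wj; have c1 := @eps_cts _ _ S j eta^-1 w.
  exact: (cvg_comp (eps_act S j eta^-1) (sigma_act S j) c1 (sigma_cts (eps_j _
    wj))).
have phi_cts (w : V) : w 0 j != 0 -> {for w, continuous phi}.
  move=> wj; have c1 := @sigma_cts _ _ S j w wj.
  exact: (cvg_comp (sigma_act S j) (eps_act S j eta) c1 (@eps_cts _ _ S j eta
    _)).
have B1 : nbhs (phi y1) ([set w | B (psi w)] `&` [set w : V | w 0 j != 0]).
  apply: nbhsI; last exact/nj/phi_j.
  have hB : nbhs (psi (phi y1)) B by rewrite (phiK _ y1j); exact: Hy1.
  exact: (cts_nbhs (@psi_cts _ (phi_j _ y1j)) hB).
have [w Hw] := dense_Z (Yj_eps emu Yy1 y1j) B1.
have [[Bw wj] zw] := nbhs_singleton Hw.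
have pj : psi w 0 j != 0.
  by rewrite sigma_act_coord ?eps_j // invr_eq0 eps_j.
exists (psi w).
rewrite -(psiK _ wj) in Hw.
have h1 := nbhsI (cts_nbhs (@phi_cts _ pj) Hw) (nj pj).
apply: (nbhs_sub h1) => z [[[/= Bz pzj] zz] zj].
rewrite (phiK _ zj) in Bz; have [Az Yz Hz] := HB _ Bz.
split; [exact: Az|split; [exact: Yz|exact: zj|]] => e.
by rewrite inE => /orP[/eqP ->|es]; [exact: zz|exact: Hz].
Qed.

Lemma norm_lt1_near (u v : C) (d : R) : 1 - `|v| = d%:C -> 0 < d ->
  `|v - u| <= (d / 2)%:C -> `|u| < 1.
Proof.
move=> Ed d0 vu; have -> : u = v - (v - u) by ring.
apply: (le_lt_trans (ler_normB _ _)); rewrite addrC -ltrBrDr Ed.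
by apply: (le_lt_trans vu); rewrite ltcR; lra.
Qed.

(** Both sides are continuous at x, and arbitrarily near x all the generic identities required by
    [functional_at] hold at once. *)
Lemma functional_eq x : good x -> (1 - q%:C * x 0 j ^- m) * Fj x = rhs Fj x.
Proof.
move=> gx; have [Yx xj xq] := gx.
apply/eqP; rewrite -subr_eq0; apply/eqP.
apply: (@cts_zero _ _ (fun y => (1 - q%:C * y 0 j ^- m) * Fj y - rhs Fj y)).
  apply: cts_atB.
    apply: cts_atM; last exact: Fj_cts.
    apply: cts_atB; first exact: cts_at_cst.
    by apply: cts_atM; [exact: cts_at_cst|exact: cts_at_coordV].
  apply: cts_atM; first exact: cts_at_coordX.
  apply: cts_at_sum => s _; apply: cts_atM.
    apply: cts_atM; first exact: cts_at_cst.
    apply: cts_at_sum => eta emu; apply: cts_atM; first exact: cts_at_cst.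
    apply: (@cts_at_comp _ _ Fj (fun y => eps_act S j eta (sigma_act S j y))).
      exact: (cvg_comp (sigma_act S j) (eps_act S j eta) (sigma_cts xj)
        (@eps_cts _ _ S j eta _)).
    by apply: Fj_cts; exact: Yj_eps.
  apply: cts_atB.
    by apply: cts_atM; [exact: cts_at_coordV|exact: cts_at_cst].
  apply: cts_atM; last exact: cts_at_cst.
  by apply: cts_atB; [exact: cts_at_coordV|exact: cts_at_cst].
move=> A Ax.
have gn : nbhs x [set y | good y].
  have h : cts_at (fun y => q%:C * y 0 j ^+ m) x.
    by apply: cts_atM; [exact: cts_at_cst|exact: cts_at_coordX].
  have d0 : 0 < 1 - `|q%:C * x 0 j ^+ m| by rewrite subr_gt0.
  have [d d00 Ed] := real_of_pos d0.
  have d2 : 0 < d / 2 by rewrite divr_gt0.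
  have n1 := (cts_eps _ _).1 h _ d2.
  have n2 := nj xj.
  have n3 : nbhs x Yj by exact: open_nbhs_nbhs.
  apply: (nbhs_sub (nbhsI n1 (nbhsI n2 n3))) => y [hy [yj Yy]].
  by split; [exact: Yy|exact: yj|exact: norm_lt1_near Ed d00 hy].
have CGx : CG_domain S n Y j x.
  split => //; first exact: YjY.
  move=> eta em; apply: YjY; apply: Yj_eps => //.
  by rewrite in_fset_set ?inE //; exact: finite_mu.
(* Successive refinements: [y1] for the invariance of Z, [y2] for the formula for Z at the point,
   [y3] for the same formula at its images. *)
have [y1 Hy1] := generic_near (CGf_inv hZ j) CGx (nbhsI Ax gn).
have [[_ [Yy1 _ _]] _ _] := nbhs_singleton Hy1.
have [y2 Hy2] := dense_Z Yy1 Hy1.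
pose A2 : set V := A `&` [set y | [/\ good y, CG_act S n q g l j Z y = Z y &
  zgood y]].
have Hy3 : nbhs y2 (A2 `&` [set y : V | Yj y /\ y 0 j != 0]).
  apply: nbhs_sub Hy2 _ => y [[[Ay gy] _ CGy] zy]; split; first by split.
  by have [Yy yj _] := gy.
have [y3 Hy3'] := dense_eps (fun eta (h : eta \in mu) => h) Hy3.
have [[Ay [gy CGy [_ zy]]] [Yy yj wy]] := nbhs_singleton Hy3'.
exists y3 => //; apply/eqP; rewrite subr_eq0; apply/eqP.
by apply: (functional_at gy CGy zy) => eta emu /=; exact: (wy _ emu).2.
Qed.

Lemma cancel_factor (E a1 a2 a3 : C) : E != 0 ->
  E * (a1 * (E^-1 * (a2 * a3))) = a3 * a2 * a1.
Proof. by move=> E0; rewrite mulrCA mulVKf // [RHS]mulrC [a3 * a2]mulrC. Qed.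

(** Change of variables: the torus through x is carried to the one through eps_eta sigma_j x, where
    the monomial of exponent e alpha_j - k becomes, up to a power of eta, the one of exponent -kap
    with kap = sigma_j(k - e alpha_j). *)
Let mean_refl (k : 'rV[int]_r) eta e x : eta \in mu -> Yj x -> nonzero x ->
  let kap := zrefl S j (k - e *: delta_mx 0 j) in
  mean_lim (fun y => y 0 j ^ e * zmonom y (- k) * Fj (eps_act S j eta
    (sigma_act S j y)))
    x (eta ^ pairing S j kap * bcoef kap).
Proof.
move=> emu Yx x0 kap; have e0 := mu_neq0 emu.
pose w := eps_act S j eta (sigma_act S j x).
have w0 : nonzero w.
  rewrite /w eps_act_hmul; apply: nonzero_hmul; last exact: nonzero_sigma.
  by move=> i; rewrite mxE expfz_neq0.
have h := mean_limZ (k := eta ^ pairing S j kap) (@mean_Fj _ (Yj_eps emu Yx (x0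
  j)) w0 kap).
pose G (y : V) := eta ^ pairing S j kap * (Fj y * zmonom y (- kap)).
suff E N : tmean N G w = tmean N (fun y => y 0 j ^ e * zmonom y (- k) *
    Fj (eps_act S j eta (sigma_act S j y))) x.
  by rewrite /mean_lim -(funext E); exact: h.
apply: (etrans (congr1 (tmean N G) (eps_act_hmul S j eta (sigma_act S j x)))).
apply: (etrans (tmean_hmul _ _ _ _)).
apply: (etrans (esym (tmean_sigma S j N _ x))).
apply: eq_tmean => t; set y := hmul (gridpt R t) x.
have y0 : nonzero y by apply: nonzero_hmul => //; exact: nonzero_gridpt.
rewrite /= -eps_act_hmul /G zmonom_eps // pairingN zmonom_sigma // zreflN
  zreflK.
have -> : - (k - e *: delta_mx 0 j) = - k + e *: delta_mx 0 j.
  by rewrite opprB addrC.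
rewrite (zmonomD _ _ y0) zmonom_deltaZ -invr_expz.
have h0 : eta ^ pairing S j kap != 0 by rewrite expfz_neq0.
exact: cancel_factor.
Qed.

Definition refl_coef (k : 'rV[int]_r) (eta : C) (e : int) : C :=
  let kap := zrefl S j (k - e *: delta_mx 0 j) in
  eta ^ pairing S j kap * bcoef kap.

Lemma good_near0 : exists x, good x /\ nonzero x.
Proof.
have n0 : nbhs (0 : V) (Yj `&` [set x : V | `|q%:C * x 0 j ^+ m| < 1]).
  apply: nbhsI; first exact: open_nbhs_nbhs.
  have h : cts_at (fun y : V => q%:C * y 0 j ^+ m) 0.
    by apply: cts_atM; [exact: cts_at_cst|exact: cts_at_coordX].
  have h2 : 0 < 2^-1 :> R by rewrite invr_gt0.
  apply: nbhs_sub ((cts_eps _ _).1 h _ h2) _ => y /=.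
  rewrite mxE expr0n (gtn_eqF m0) mulr0 sub0r normrN => /le_lt_trans; apply.
  by rewrite -(rmorph1 (real_complex R)) ltcR invf_lt1 // ltr1n.
have [x [Yx xq] x0] := nbhs_nonzero n0.
by exists x; split => //; split.
Qed.

Lemma lhs_factor (f z c w : C) : f * z - c * (f * (z * w)) = (1 - c * w) * f *
  z.
Proof. ring. Qed.

Lemma rhs_factor (f z p s w e c d u : C) :
  d * e * ((1 - u) * (p * s * z * f) - c * (p * w * z * f - p * z * f)) =
  p * z * (d * (e * f)) * (s * (1 - u) - (w - 1) * c).
Proof. ring. Qed.

Lemma coef_relation (k : 'rV[int]_r) :
  bcoef k - q%:C * bcoef (k + m%:Z *: delta_mx 0 j) =
  \sum_(0 <= s < m) \sum_(eta <- mu) m%:R^-1 * eta ^ (s%:Z - (l j)%:Z - 1) *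
    ((1 - q%:C) * refl_coef k eta ((l j).+1%:Z - s%:Z) -
     g (qint S (qsimple j) * s%:Z) *
       (refl_coef k eta ((l j).+1%:Z - m%:Z) - refl_coef k eta (l j).+1%:Z)).
Proof.
have [x [gx x0]] := good_near0; have [Yx xj xq] := gx.
have hL := mean_limB (@mean_Fj _ Yx x0 k)
  (mean_limZ (k := q%:C) (@mean_Fj _ Yx x0 (k + m%:Z *: delta_mx 0 j))).
pose A eta (e : int) (y : V) : C :=
  y 0 j ^ e * zmonom y (- k) * Fj (eps_act S j eta (sigma_act S j y)).
pose B s eta (y : V) : C := m%:R^-1 * eta ^ (s%:Z - (l j)%:Z - 1) *
    ((1 - q%:C) * A eta ((l j).+1%:Z - s%:Z) y -
     g (qint S (qsimple j) * s%:Z) *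
       (A eta ((l j).+1%:Z - m%:Z) y - A eta (l j).+1%:Z y)).
have hR : mean_lim (fun y => \sum_(0 <= s < m) \sum_(eta <- mu) B s eta y) x
  (\sum_(0 <= s < m) \sum_(eta <- mu) m%:R^-1 * eta ^ (s%:Z - (l j)%:Z - 1) *
    ((1 - q%:C) * refl_coef k eta ((l j).+1%:Z - s%:Z) -
     g (qint S (qsimple j) * s%:Z) *
       (refl_coef k eta ((l j).+1%:Z - m%:Z) - refl_coef k eta (l j).+1%:Z))).
  apply: mean_lim_sum => s _; apply: mean_lim_sum => eta emu.
  apply: mean_limZ; apply: mean_limB; apply: mean_limZ.
    exact: mean_refl.
  by apply: mean_limB; exact: mean_refl.
apply: (mean_lim_unique hL).
apply: eq_mean_lim hR => N; apply: eq_tmean => t; set y := hmul (gridpt R t) x.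
have y0 : nonzero y by apply: nonzero_hmul => //; exact: nonzero_gridpt.
have gy : good y.
  split; first exact: tYj (tor_gridpt R t) Yx.
    exact: y0.
  by rewrite normrM normrX hmulE normrM norm_gridpt mul1r -normrX -normrM.
have yj := y0 j.
have -> : Fj y * zmonom y (- k) -
    q%:C * (Fj y * zmonom y (- (k + m%:Z *: delta_mx 0 j))) =
    (1 - q%:C * y 0 j ^- m) * Fj y * zmonom y (- k).
  have -> : - (k + m%:Z *: delta_mx 0 j) = - k + (- m%:Z) *: delta_mx 0 j.
    by rewrite opprD scaleNr.
  rewrite (zmonomD _ _ y0) zmonom_deltaZ.
  have -> : y 0 j ^ (- m%:Z) = y 0 j ^- m by rewrite -invr_expz -exprnP.
  exact: lhs_factor.
rewrite functional_eq // /rhs mulrAC mulr_sumr; apply: eq_bigr => s _.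
rewrite mulr_sumr mulrA mulr_sumr mulr_suml; apply: eq_bigr => eta emu.
rewrite /B /A /kern.
have E (u : nat) : y 0 j ^ ((l j).+1%:Z - u%:Z) = y 0 j ^+ (l j).+1 * y 0 j ^-
  u.
  by rewrite expfzDr // -invr_expz -!exprnP.
rewrite !E -exprnP.
exact: rhs_factor.
Qed.

Lemma eq_lexx (x y : C) : x = y -> x <= y.
Proof. by move=> ->. Qed.

(** At y = sigma_j x one has y_j = 1 / x_j, so the bound by y^(-(k + c m alpha_j)) decays like
    |x_j|^(c m); together with q^c this is the c-th power of |q x_j^m| < 1. *)
Lemma coef_decay (k : 'rV[int]_r) :
  (q%:C ^+ c * bcoef (k + (c * m)%N%:Z *: delta_mx 0 j) : C) @[c --> \oo] -->
    (0 : C).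
Proof.
have [x [gx x0]] := good_near0; have [Yx xj xq] := gx.
pose y := sigma_act S j x.
have Yy : Yj y by exact: sYj.
have y0 : nonzero y by exact: nonzero_sigma.
have yj : y 0 j = (x 0 j)^-1 by exact: sigma_act_coord.
have cF : cts_on_orbit Fj y by move=> z tz; apply: Fj_cts; exact: tYj.
have [M HM] := orbit_bounded cF.
have bnd k' : `|bcoef k'| <= M%:R * `|zmonom y (- k')|.
  apply/ler_addgt0Pr => _ /real_of_pos[e e0 ->].
  have := @mean_Fj _ Yy y0 k'; rewrite /mean_lim => /cvgrPdist_le.
  have e0C : 0 < e%:C :> C by rewrite ltcR.
  move=> /(_ _ e0C)[N _ /(_ N (leqnn N)) hN].
  have -> : bcoef k' = tmean N (fun y => Fj y * zmonom y (- k')) y +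
     (bcoef k' - tmean N (fun y => Fj y * zmonom y (- k')) y) by rewrite addrC
       subrK.
  apply: (le_trans (ler_normD _ _)); apply: lerD; last exact: hN.
  apply: norm_tmean => t; rewrite normrM; apply: ler_pM.
  - exact: normr_ge0.
  - exact: normr_ge0.
  - exact: HM (tor_gridpt R t).
  - by apply: eq_lexx; exact: norm_zmonom_gridpt.
set X := q%:C * x 0 j ^+ m in xq.
have bnd2 c : `|q%:C ^+ c * bcoef (k + (c * m)%N%:Z *: delta_mx 0 j)| <=
    M%:R * `|zmonom y (- k)| * `|X| ^+ c.
  rewrite normrM normrX.
  apply: (le_trans (ler_wpM2l (exprn_ge0 _ (normr_ge0 _)) (bnd _))).
  have -> : - (k + (c * m)%N%:Z *: delta_mx 0 j) = - k + (- (c * m)%N%:Z) *: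
    delta_mx 0 j.
    by rewrite opprD scaleNr.
  rewrite (zmonomD _ _ y0) zmonom_deltaZ yj normrM.
  have -> : (x 0 j)^-1 ^ (- (c * m)%N%:Z) = (x 0 j ^+ m) ^+ c.
    by rewrite exprz_inv opprK -exprnP mulnC exprM.
  rewrite /X normrM exprMn normrX le_eqVlt; apply/orP; left; apply/eqP.
  ring.
have Xr : exists2 p : R, `|p| < 1 & `|X| = p%:C.
  exists (Normc.normc X) => //.
  by rewrite -ltcR ger0_norm ?normc_ge0 // -normC.
have [p p1 Xp] := Xr.
have [b bE] : exists b : R, M%:R * `|zmonom y (- k)| = b%:C.
  exists (M%:R * Normc.normc (zmonom y (- k))).
  by rewrite rmorphM rmorph_nat.
have lim0 : (fun c => b * p ^+ c) @ \oo --> (0 : R).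
  rewrite -[X in _ --> X](mulr0 b); apply: cvgMr; exact: cvg_expr.
apply/cvgrPdist_le => _ /real_of_pos[e e0 ->].
move/cvgrPdist_le: lim0 => /(_ _ e0); apply: filterS => c.
rewrite !sub0r !normrN => h; apply: (le_trans (bnd2 c)).
by rewrite Xp bE -rmorphXn -rmorphM lecR (le_trans (ler_norm _)).
Qed.

End Domain.

(** All that is retained from the analysis. Only coefficients occur, so the relations of two
    functions on different regions can be subtracted. *)
Definition coef_relations : Prop :=
  (forall k : 'rV[int]_r, bcoef k - q%:C * bcoef (k + m%:Z *: delta_mx 0 j) =
  \sum_(0 <= s < m) \sum_(eta <- finmap.enum_fset (fset_set (@unity_roots R m)))
    m%:R^-1 * eta ^ (s%:Z - (l j)%:Z - 1) *
    ((1 - q%:C) * refl_coef k eta ((l j).+1%:Z - s%:Z) -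
     g (qint S (qsimple j) * s%:Z) *
       (refl_coef k eta ((l j).+1%:Z - m%:Z) - refl_coef k eta (l j).+1%:Z))) /\
  (forall k : 'rV[int]_r,
    (q%:C ^+ c * bcoef (k + (c * m)%N%:Z *: delta_mx 0 j) : C) @[c --> \oo]
      --> (0 : C)).

Lemma CG_coef : coef_relations.
Proof.
have [_ _ _ HA] := CGf_region hZ; have [Yj [YjY [oY cY rY Y0] PY sY]] := HA j.
have [DY [F [FY DZF]]] := CGf_DZ hZ.
by split=> k; [exact: (coef_relation YjY oY cY rY Y0 PY sY FY DZF)|
  exact: (coef_decay YjY oY cY rY Y0 PY sY FY DZF)].
Qed.

End CGRelations.

(** * Solving the relations *)

Section Recursion.
Variables (R : realType) (r : nat) (S : root_datum R r) (n : nat) (q : R).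
Local Notation C := (Cplx R).
Local Open Scope complex_scope.
Hypotheses (hn : (2 <= n)%N) (hq : 1 < q).
Variable j : 'I_r.
Let m := msimple S n j.
Let mu : seq C := finmap.enum_fset (fset_set (@unity_roots R m)).

Let m0 : (0 < m)%N := msimple_gt0 S hn j.

Lemma mem_mu (eta : C) : (eta \in mu) = (eta ^+ m == 1).
Proof.
rewrite in_fset_set; last exact: finite_mu.
by apply/idP/eqP; rewrite inE.
Qed.

Lemma unity_sum s : (0 < s < m)%N -> \sum_(eta <- mu) eta ^+ s = 0.
Proof.
move=> sm; pose z := uroot R m.
have zm : z ^+ m = 1 by exact: uroot1.
have z0 : z != 0 by exact: cexp_neq0.
have p : perm_eq mu [seq z * eta | eta <- mu].
  apply: uniq_perm; first exact: finmap.fset_uniq.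
    by rewrite map_inj_uniq ?finmap.fset_uniq //; exact: mulfI.
  move=> eta; rewrite mem_mu; apply/eqP/mapP => [em|[e]].
    exists (z^-1 * eta); last by rewrite mulrA divff // mul1r.
    by rewrite mem_mu exprMn exprVn zm em invr1 mulr1.
  by rewrite mem_mu => /eqP em ->; rewrite exprMn zm em mulr1.
have E : z ^+ s * \sum_(eta <- mu) eta ^+ s = \sum_(eta <- mu) eta ^+ s.
  rewrite mulr_sumr [RHS](perm_big _ p) big_map; apply: eq_bigr => eta _.
  by rewrite exprMn.
apply/eqP; move/eqP: E; rewrite -subr_eq0 -[X in _ - X]mul1r -mulrBl mulf_eq0.
by rewrite subr_eq0 (negPf (uroot_neq1 _ sm)).
Qed.

(** Links the integer [pairing] to the form used in the theorem, whose inequalities thereby become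
    inequalities of integers. *)
Lemma pairing_form (k : Qplus r) i :
  kform S (of_Qplus S k) (alpha_check S i) = (pairing S i (qvec k))%:~R.
Proof.
rewrite form_sym /of_Qplus.
have D u v w : kform S u (v + w) = kform S u v + kform S u w.
  by have := @form_linear _ _ S u 1 v w; rewrite !scale1r.
have Z0 u : kform S u 0 = 0.
  by apply: (addrI (kform S u 0)); rewrite -D !addr0.
have M u v t : kform S u (v *+ t) = kform S u v *+ t.
  by elim: t => [|t IH]; rewrite ?mulr0n ?Z0 // !mulrS D IH.
rewrite (big_morph _ (D _) (Z0 _)) /pairing rmorph_sum; apply: eq_bigr => s _.
rewrite /= M form_sym -/(simple_root S s) form_alpha_check qvecE intrM.
by rewrite mulr_natl.
Qed.

Variables (g : int -> C) (hg : gauss_params n q g) (l : 'I_r -> nat).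
Variables (a1 a2 : Qplus r -> C).

Let b k : C := bcoef S n q a1 j k - bcoef S n q a2 j k.
Let d : 'rV[int]_r := delta_mx 0 j.

Hypotheses (rel1 : coef_relations S n q g l a1 j) (rel2 : coef_relations S n q
  g l a2 j).

Let X (k : 'rV[int]_r) (eta : C) (e : int) : C :=
  let kap := zrefl S j (k - e *: d) in eta ^ pairing S j kap * b kap.

Let XE k eta e : X k eta e =
  refl_coef S n q a1 j k eta e - refl_coef S n q a2 j k eta e.
Proof. exact: mulrBr. Qed.

Lemma relation_sub (c u v x1 x2 y1 y2 z1 z2 : C) :
  c * (u * (x1 - x2) - v * (y1 - y2 - (z1 - z2))) =
  c * (u * x1 - v * (y1 - z1)) - c * (u * x2 - v * (y2 - z2)).
Proof. ring. Qed.

Let b_relation (k : 'rV[int]_r) : b k - q%:C * b (k + m%:Z *: d) =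
   \sum_(0 <= s < m) \sum_(eta <- mu) m%:R^-1 * eta ^ (s%:Z - (l j)%:Z - 1) *
    ((1 - q%:C) * X k eta ((l j).+1%:Z - s%:Z) -
     g (qint S (qsimple j) * s%:Z) *
       (X k eta ((l j).+1%:Z - m%:Z) - X k eta (l j).+1%:Z)).
Proof.
have [r1 _] := rel1; have [r2 _] := rel2.
have -> : b k - q%:C * b (k + m%:Z *: d) =
  (bcoef S n q a1 j k - q%:C * bcoef S n q a1 j (k + m%:Z *: d)) -
  (bcoef S n q a2 j k - q%:C * bcoef S n q a2 j (k + m%:Z *: d)).
  by rewrite /b; ring.
rewrite r1 r2 -sumrB; apply: eq_bigr => s _; rewrite -sumrB;
  apply: eq_bigr => eta _.
by rewrite !XE; exact: esym (relation_sub _ _ _ _ _ _ _ _ _).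
Qed.

Let b_decay (k : 'rV[int]_r) :
  (q%:C ^+ c * b (k + (c * m)%N%:Z *: d) : C) @[c --> \oo] --> (0 : C).
Proof.
have [_ r1] := rel1; have [_ r2] := rel2.
have h := cvgB (r1 k) (r2 k); rewrite subrr in h.
have E : (fun c => q%:C ^+ c * b (k + (c * m)%N%:Z *: d) : C) =
  (fun c => q%:C ^+ c * bcoef S n q a1 j (k + (c * m)%N%:Z *: d) -
            q%:C ^+ c * bcoef S n q a2 j (k + (c * m)%N%:Z *: d)).
  by apply/funext => c; rewrite -mulrBr.
by rewrite E; exact: h.
Qed.

Let q0 : q%:C != 0 :> C.
Proof. by rewrite fmorph_eq0 gt_eqF // (lt_trans _ hq). Qed.

Let geometric (f : nat -> C) : (forall c, f c = q%:C * f c.+1) ->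
  (q%:C ^+ c * f c : C) @[c --> \oo] --> (0 : C) -> f 0%N = 0.
Proof.
move=> fS lim.
have E c : q%:C ^+ c * f c = f 0%N.
  by elim: c => [|c IH]; rewrite ?mul1r // exprSr -mulrA -fS.
have cst : (q%:C ^+ c * f c : C) @[c --> \oo] --> f 0%N.
  by rewrite (funext E); exact: cvg_cst.
exact: (cvg_unique _ cst lim).
Qed.

(** * Vanishing along an alpha_j-string *)

Section Slice.
Variable k : 'rV[int]_r.
Hypothesis large : ((l j).+1%:Z <= pairing S j k)%R.
Hypothesis lower : forall c : nat, (0 < c)%N -> acoef a1 (k - c%:Z *: d) =
  acoef a2 (k - c%:Z *: d).

Let b_lower (c : nat) : (0 < c)%N -> b (k - c%:Z *: d) = 0.
Proof.
move=> c0; rewrite /b /bcoef lower // -/m -/d.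
have -> : k - c%:Z *: d - m%:Z *: d = k - (c + m)%N%:Z *: d.
  by rewrite -addrA -opprD -scalerDl.
by rewrite lower ?subrr // addn_gt0 c0.
Qed.

(** The reflected exponents stay on the string through k. In the relations e is at most l_j + 1, so
    for large pairing the multiple of alpha_j is negative and [lower] applies. *)
Let kapE (c : nat) (e : int) : zrefl S j (k + (c * m)%N%:Z *: d - e *: d) =
  k + (e - pairing S j k - (c * m)%N%:Z) *: d.
Proof.
rewrite /zrefl !pairingD pairingN !pairing_delta -/d.
rewrite -!addrA; congr (_ + _); rewrite -!scaleNr -!scalerDl; congr (_ *: _).
ring.
Qed.

Let X_lower (c : nat) (e : int) eta : e - pairing S j k - (c * m)%N%:Z < 0 ->
  X (k + (c * m)%N%:Z *: d) eta e = 0.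
Proof.
move=> neg; rewrite /X kapE.
have [u u0 ->] : exists2 u : nat, (0 < u)%N &
    e - pairing S j k - (c * m)%N%:Z = - u%:Z.
  by move: neg; case: (e - _ - _) => [//|u] _; exists u.+1 => //; rewrite NegzE.
by rewrite scaleNr b_lower // mulr0.
Qed.

Let step_zero (c : nat) : ((l j).+1%:Z < pairing S j k + (c * m)%N%:Z) ->
  b (k + (c * m)%N%:Z *: d) = q%:C * b (k + (c.+1 * m)%N%:Z *: d).
Proof.
move=> hc; apply/eqP; rewrite -subr_eq0; apply/eqP.
have -> : k + (c.+1 * m)%N%:Z *: d = k + (c * m)%N%:Z *: d + m%:Z *: d.
  by rewrite -addrA -scalerDl mulSn addnC.
rewrite b_relation big_nat big1 // => s /andP[_ sm]; apply: big1 => eta _.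
rewrite !X_lower ?subrr ?mulr0 ?subrr ?mulr0 //; lia.
Qed.

Let b_far (c : nat) : ((l j).+1%:Z < pairing S j k + (c * m)%N%:Z) ->
  b (k + (c * m)%N%:Z *: d) = 0.
Proof.
move=> hc; pose f i := b (k + ((c + i) * m)%N%:Z *: d).
suff f0 : f 0%N = 0 by rewrite -f0 /f addn0.
have E i : f i = b (k + (c * m)%N%:Z *: d + (i * m)%N%:Z *: d).
  by rewrite /f -addrA -scalerDl mulnDl.
apply: geometric => [i|].
  rewrite /f step_zero ?addnS //.
  by apply: (lt_le_trans hc); rewrite lerD2l lez_nat leq_mul2r leq_addr orbT.
rewrite (funext (fun i => congr1 (fun z => q%:C ^+ i * z) (E i))).
exact: b_decay.
Qed.

Lemma slice_top : b k = 0.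
Proof.
have K0 : k + (0 * m)%N%:Z *: d = k by rewrite mul0n scale0r addr0.
have [lt|] := ltP (l j).+1%:Z (pairing S j k).
  by rewrite -K0; apply: b_far; rewrite mul0n addr0.
move=> le; have Ep : pairing S j k = (l j).+1%:Z.
  by apply/eqP; rewrite eq_le le large.
have f1 : b (k + m%:Z *: d) = 0.
  have := @b_far 1%N; rewrite mul1n; apply.
  by rewrite Ep ltrDl.
have := b_relation k; rewrite f1 mulr0 subr0.
have XL eta : X k eta (l j).+1%:Z = eta ^ (l j).+1%:Z * b k.
  have /= := kapE 0 (l j).+1%:Z; rewrite K0 Ep subrr mul0n subr0 scale0r addr0.
  by rewrite /X => ->; rewrite Ep.
have X0 eta e : e < (l j).+1%:Z -> X k eta e = 0.
  by move=> he; rewrite -K0; apply: X_lower; rewrite Ep mul0n subr0 subr_lt0.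
have mu0 eta : eta \in mu -> eta != 0.
  by rewrite mem_mu; apply: contraTneq => ->;
    rewrite expr0n (gtn_eqF m0) eq_sym oner_eq0.
(* Only the terms with e = l_j + 1 survive. For s > 0 they leave eta^s, whose sum over the roots is
   0; for s = 0 the powers of eta cancel and g 0 = -1 leaves -q b k for each root. *)
have Es s : (s < m)%N -> \sum_(eta <- mu) m%:R^-1 * eta ^ (s%:Z - (l j)%:Z - 1)
  *
    ((1 - q%:C) * X k eta ((l j).+1%:Z - s%:Z) -
     g (qint S (qsimple j) * s%:Z) *
       (X k eta ((l j).+1%:Z - m%:Z) - X k eta (l j).+1%:Z)) =
    if s == 0%N then - (q%:C * (m%:R^-1 * (size mu)%:R)) * b k else 0.
  move=> sm; case: ifP => [/eqP ->|s0].
    have [_ g0 _] := hg.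
    rewrite (eq_big_seq (fun=> - (q%:C * m%:R^-1) * b k)).
      by rewrite big_const_seq count_predT iter_addr_0 -[LHS]mulr_natr; ring.
    move=> eta emu; have e0 := mu0 _ emu.
    rewrite subr0 mulr0 g0 XL X0; last by rewrite gtrDl oppr_lt0.
    have -> : eta ^ (0 - (l j)%:Z - 1) = (eta ^ (l j).+1%:Z)^-1.
      by rewrite invr_expz; congr (_ ^ _); rewrite -addn1 PoszD; ring.
    have h0 : eta ^ (l j).+1%:Z != 0 by rewrite expfz_neq0.
    move: h0; set E := eta ^ _ => h0.
    have -> : (1 - q%:C) * (E * b k) - -1 * (0 - E * b k) = E * (- q%:C * b k)
      by ring.
    by rewrite -mulrA mulKf //; ring.
  rewrite (eq_big_seq (fun eta => (m%:R^-1 * g (qint S (qsimple j) * s%:Z) * b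
    k) * eta ^+ s)).
    by rewrite -mulr_sumr unity_sum ?mulr0 // lt0n s0.
  move=> eta emu; have e0 := mu0 _ emu.
  rewrite XL !X0; last 2 first.
  - by rewrite gtrDl oppr_lt0.
  - by rewrite gtrDl oppr_lt0 ltz_nat lt0n s0.
  have -> : eta ^ (s%:Z - (l j)%:Z - 1) = eta ^+ s * (eta ^ (l j).+1%:Z)^-1.
    rewrite invr_expz exprnP -expfzDr //; congr (_ ^ _).
    by rewrite -addn1 PoszD; ring.
  have h0 : eta ^ (l j).+1%:Z != 0 by rewrite expfz_neq0.
  set E := eta ^ _ in h0 *.
  have -> : m%:R^-1 * (eta ^+ s / E) * ((1 - q%:C) * 0 - g (qint S (qsimple j)
    * s%:Z) * (0 - E * b k)) =
    m%:R^-1 * g (qint S (qsimple j) * s%:Z) * b k * eta ^+ s * (E^-1 * E) by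
      ring.
  by rewrite mulVf // mulr1.
rewrite big_nat (eq_bigr (fun s => if s == 0%N then - (q%:C * (m%:R^-1 * (size
  mu)%:R)) * b k else 0)); last first.
  by move=> s /andP[_ sm]; exact: Es.
rewrite -big_nat big_ltn // eqxx big_nat big1; last first.
  by move=> s /andP[s1 _]; rewrite (gtn_eqF s1).
rewrite addr0 => E.
(* The coefficient is at least 1 whatever [size mu] is, so the roots need not be counted. *)
have : (1 + q%:C * (m%:R^-1 * (size mu)%:R)) * b k = 0.
  by rewrite mulrDl mul1r {1}E mulNr addNr.
move/eqP; rewrite mulf_eq0 => /orP[|/eqP //].
rewrite gt_eqF // ltr_wpDr // mulr_ge0 ?mulr_ge0 ?invr_ge0 ?ler0n //.
by rewrite ler0c ltW // (lt_trans _ hq).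
Qed.

End Slice.

End Recursion.


(** * Induction on the height *)

Theorem corollary4p5 (R : realType) (r : nat) (S : root_datum R r)
    (n : nat) (hn : (2 <= n)%N) (q : R) (hq : 1 < q)
    (g : int -> Cplx R) (hg : gauss_params n q g)
    (omega : hdual S) (homega : dominant omega)
    (l : 'I_r -> nat)
    (hl : forall i, kform S omega (alpha_check S i) = (l i)%:R)
    (Y1 Y2 : set 'rV[Cplx R]_r) (Z1 Z2 : 'rV[Cplx R]_r -> Cplx R)
    (a1 a2 : Qplus r -> Cplx R)
    (h1 : CG_function S n q g l Y1 Z1 a1)
    (h2 : CG_function S n q g l Y2 Z2 a2)
    (agree : forall lam : Qplus r,
      (forall i, kform S (of_Qplus S lam) (alpha_check S i) <= (l i)%:R) ->
      a1 lam = a2 lam) :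
  forall lam : Qplus r, a1 lam = a2 lam.
Proof.
suff main h (lam : Qplus r) : (\sum_i lam i < h)%N -> a1 lam = a2 lam.
  by move=> lam; exact: main (ltnSn _).
elim: h lam => // h IH lam lamh.
have [|/existsNP[j nj]] := pselect (forall i,
  kform S (of_Qplus S lam) (alpha_check S i) <= (l i)%:R); first exact: agree.
pose d : 'rV[int]_r := delta_mx 0 j.
have large : ((l j).+1%:Z <= pairing S j (qvec lam))%R.
  rewrite leNgt; apply/negP => lt; apply: nj.
  by rewrite pairing_form pmulrn ler_int; move: lt; lia.
(* If c exceeds lam_j the exponent leaves Q^+ and both sides are the default 0; otherwise the height
   drops by c and the induction hypothesis applies. *)
have lower (c : nat) : (0 < c)%N ->
    acoef a1 (qvec lam - c%:Z *: d) = acoef a2 (qvec lam - c%:Z *: d).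
  move=> c0.
  have dE i : (qvec lam - c%:Z *: d) 0 i = (lam i)%:Z - c%:Z * (i == j)%:Z.
    by rewrite mxE qvecE !mxE eqxx /=; case: (i == j).
  have [cl|lc] := leqP c (lam j); last first.
    have neg : (qvec lam - c%:Z *: d) 0 j < 0.
      by rewrite dE eqxx mulr1 subr_lt0 ltz_nat.
    by rewrite !(acoef_neg _ neg).
  pose lam' : Qplus r := [ffun i => (lam i - c * (i == j))%N].
  have lamE i : lam' i = (lam i - c * (i == j))%N by rewrite ffunE.
  have -> : qvec lam - c%:Z *: d = qvec lam'.
    apply/rowP => i; rewrite dE qvecE lamE -PoszM subzn //.
    by case: eqP => [->|_]; rewrite ?muln1 ?muln0.
  rewrite !acoef_qvec; apply: IH; rewrite -ltnS; apply: leq_trans lamh.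
  rewrite ltnS (bigD1 j) //= [X in (_ < X)%N](bigD1 j) //= lamE eqxx muln1.
  have -> : (\sum_(i < r | i != j) lam' i = \sum_(i < r | i != j) lam i)%N.
    by apply: eq_bigr => i /negPf ij; rewrite lamE ij muln0 subn0.
  by rewrite ltn_add2r ltn_subrL c0 (leq_trans c0).
have := slice_top hn hq hg (CG_coef hn hq h1 j) (CG_coef hn hq h2 j)
  large lower.
(* [slice_top] equates the two values of a_lam - q a_(lam - m alpha_j); the shifted terms agree by
   [lower] at c = m. *)
rewrite /bcoef !acoef_qvec lower ?(msimple_gt0 S hn j) // opprB addrA subrK.
by move/eqP; rewrite subr_eq0 => /eqP.
Qed.
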